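(* Let $\mathbb{F}_q$ be a finite field. With the notation of the context: (a) There exists a nonzero finite $\mathbf{GL}^0(\ell\oplus\ell^\diamond)$-invariant Borel measure $\mu$ on $\mathbf{Gr}^0$, and it is unique up to a scalar factor. (b) The restriction of $\mu$ to the cell $\mathcal{M}\simeq\mathbb{F}_q^{\infty\times\infty}$ is (up to a scalar factor) the product measure on the countable product of copies of $\mathbb{F}_q$, each copy carrying the uniform probability measure. (c) If $\mu$ is normalized by the condition $\mu(\mathcal{M})=1$, then the total measure of the Grassmannian is $$\mu(\mathbf{Gr}^0)=\prod_{j=1}^\infty (1-q^{-j})^{-1}.$$
   Context: Spaces and group. $\ell$ is the direct sum of countably many copies of $\mathbb{F}_q$ (basis $e_1,e_2,\dots$), with the discrete topology; $\ell^\diamond$ is the direct product of countably many copies of $\mathbb{F}_q$ (coordinate vectors $f_1,f_2,\dots$; elements are formal infinite combinations $\sum w_j f_j$), with the product topology (compact). $\ell\oplus\ell^\diamond$ has the product topology. Elements are written as row vectors and operators act on the right: $v\mapsto vg$. $\mathbf{GL}(\ell\oplus\ell^\diamond)$ is the group of all continuous linear operators $g=\begin{pmatrix}a&b\\c&d\end{pmatrix}$ in $\ell\oplus\ell^\diamond$ having a continuous inverse. For such $g$, the block $a:\ell\to\ell$ has finite-dimensional kernel and an image of finite codimension, and $\theta(g):=\dim(\ell/\ell a)-\dim\ker a$ is a homomorphism $\mathbf{GL}(\ell\oplus\ell^\diamond)\to\mathbb{Z}$; $\mathbf{GL}^0(\ell\oplus\ell^\diamond)$ is its kernel. Grassmannian.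 For any infinite matrix $T=(t_{ij})_{i,j\ge1}$ over $\mathbb{F}_q$ (equivalently, any linear operator $\ell\to\ell^\diamond$, $v\mapsto vT$) let $\mathrm{graph}(T)=\{v\oplus vT: v\in\ell\}$; $\mathcal{M}$ is the set of all such subspaces of $\ell\oplus\ell^\diamond$, identified with $\mathbb{F}_q^{\infty\times\infty}$. A subspace $M\subset\ell\oplus\ell^\diamond$ is semi-infinite if there is $L\in\mathcal{M}$ with $\dim L/(L\cap M)<\infty$ and $\dim M/(L\cap M)<\infty$; it has relative dimension $0$ if these two dimensions are equal (this does not depend on $L$). $\mathbf{Gr}^0$ is the set of semi-infinite subspaces of relative dimension $0$; $\mathbf{GL}^0(\ell\oplus\ell^\diamond)$ acts on it by $L\mapsto Lg$. Borel structure. For finite subsets $\Omega,\Xi\subset\mathbb{N}$ let $V[\Omega,\Xi]$ be spanned by the $e_i$, $i\notin\Omega$, and the $f_j$, $j\in\Xi$, and let $W[\Omega,\Xi]$ be the topological direct sum of the lines $\mathbb{F}_q e_i$, $i\in\Omega$, and $\mathbb{F}_q f_j$, $j\notin\Xi$ (infinite combinations of the $f_j$ allowed). The chart $\mathcal{M}[\Omega,\Xi]$ is the set of graphs of linear operators $V[\Omega,\Xi]\to W[\Omega,\Xi]$; it is identified via matrix entries with a countable product of copies of $\mathbb{F}_q$, and $\mathcal{M}=\mathcal{M}[\varnothing,\varnothing]$. The charts with $\#\Omega=\#\Xi$ cover $\mathbf{Gr}^0$. A subset of $\mathbf{Gr}^0$ is Borel if its intersection with each chart is Borel for the product topology of that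 chart. *)

(* Defs.v *)
From HB Require Import structures.
From mathcomp Require Import all_boot all_order all_algebra finmap.
From mathcomp Require Import all_classical all_reals all_analysis.

Set Implicit Arguments.
Unset Strict Implicit.
Unset Printing Implicit Defensive.

Import Order.TTheory GRing.Theory Num.Theory.
Local Open Scope classical_set_scope.
Local Open Scope ring_scope.

(** Indices start at 0: the basis vectors are e_i, f_j with i, j : nat. *)

(** The product of copies of the finite field indexed by [I]: product vector
    space, product topology of discrete copies, Borel sigma-algebra. *)
Definition Fprod (F : finFieldType) (I : Type) : Type := I -> F^o.

HB.instance Definition _ (F : finFieldType) (I : Type) :=
  GRing.Lmodule.on (Fprod F I).
HB.instance Definition _ (F : finFieldType) (I : Type) :=
  Topological.copy (Fprod F I) (prod_topology (fun _ : I => discrete_topology F)).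
HB.instance Definition _ (F : finFieldType) (I : Type) :=
  isPointed.Build (Fprod F I) 0.
HB.instance Definition _ (F : finFieldType) (I : Type) :=
  Measurable.copy (Fprod F I) (g_sigma_algebraType (@open (Fprod F I))).

(** [ell F] is the direct sum and [elld F] the direct product of countably many
    copies of F. *)
Definition finsupp_pred (F : finFieldType) : {pred nat -> F^o} :=
  [pred v | `[< finite_set [set i | v i != 0] >]].

Record ell (F : finFieldType) := Ell {
  ell_fun :> nat -> F^o ;
  ell_funP : ell_fun \in @finsupp_pred F }.

HB.instance Definition _ (F : finFieldType) := [isSub for @ell_fun F].
HB.instance Definition _ (F : finFieldType) := [Choice of ell F by <:].

Lemma finsupp_submod (F : finFieldType) : submod_closed (@finsupp_pred F).
Proof.
split=> [|a u v /asboolP fu /asboolP fv]; apply/asboolP.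
  by rewrite (_ : [set _ | _] = set0)//; apply/seteqP; split=> i //=; rewrite eqxx.
apply: (@sub_finite_set _ _ ([set i | u i != 0] `|` [set i | v i != 0])); last first.
  by rewrite finite_setU.
move=> i /= uvi; have [ui0|] := eqVneq (u i) 0; [right|by left].
by apply: contraNneq uvi => vi0; rewrite -[_ i]/(a * u i + v i) ui0 vi0 mulr0 addr0.
Qed.

HB.instance Definition _ (F : finFieldType) :=
  GRing.isSubmodClosed.Build _ _ (@finsupp_pred F) (finsupp_submod F).
HB.instance Definition _ (F : finFieldType) := [SubChoice_isSubLmodule of ell F by <:].
HB.instance Definition _ (F : finFieldType) := hasNbhs.Build (ell F) principal_filter.
HB.instance Definition _ (F : finFieldType) := Discrete_ofNbhs.Build (ell F) erefl.

Definition elld (F : finFieldType) : Type := Fprod F nat.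
HB.instance Definition _ (F : finFieldType) := GRing.Lmodule.on (elld F).
HB.instance Definition _ (F : finFieldType) := Topological.on (elld F).

Definition ellsum (F : finFieldType) : Type := (ell F * elld F)%type.
HB.instance Definition _ (F : finFieldType) := GRing.Lmodule.on (ellsum F).
HB.instance Definition _ (F : finFieldType) := Topological.on (ellsum F).

(** Dimension of the quotient U / W of two subspaces W of U: [is_qdim U W n]
    says that the classes of some b_0, ..., b_(n-1) form a basis of U / W. *)
Definition is_qdim (F : finFieldType) (E : lmodType F) (U W : set E) (n : nat) :=
  exists b : 'I_n -> E, (forall i, U (b i)) /\
    forall u, U u -> exists! c : {ffun 'I_n -> F}, W (u - \sum_i c i *: b i).

Definition qdim (F : finFieldType) (E : lmodType F) (U W : set E) : nat :=
  xget 0%N [set n | is_qdim U W n].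

(** An operator acts by v |-> g v (written vg when operators act on the right). *)
Definition GL (F : finFieldType) : set {linear ellsum F -> ellsum F} :=
  [set g : {linear ellsum F -> ellsum F} | continuous g /\
    exists h : {linear ellsum F -> ellsum F},
      [/\ continuous h, cancel g h & cancel h g]].

Definition block_a (F : finFieldType) (g : ellsum F -> ellsum F) (v : ell F) : ell F :=
  (g (v, 0)).1.

(** Both dimensions are finite when g is in GL, so that the default value of
    [qdim] is not used there. *)
Definition theta (F : finFieldType) (g : ellsum F -> ellsum F) : int :=
  (qdim [set: ell F] (range (block_a g)))%:Z
  - (qdim (block_a g @^-1` [set 0]) [set 0])%:Z.

Definition GL0 (F : finFieldType) : set {linear ellsum F -> ellsum F} :=
  [set g : {linear ellsum F -> ellsum F} | GL g /\ theta g = 0].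

(** The row vector v times the matrix T. The sum has finite support because v
    does. *)
Definition mulvT (F : finFieldType) (v : ell F) (T : Fprod F (nat * nat)) : elld F :=
  fun j => \sum_(i \in [set: nat]) v i * T (i, j).

Definition opgraph (F : finFieldType) (T : Fprod F (nat * nat)) : set (ellsum F) :=
  [set (v, mulvT v T) | v in [set: ell F]].

Definition is_subspace (F : finFieldType) (M : set (ellsum F)) :=
  M 0 /\ forall (a : F) u v, M u -> M v -> M (a *: u + v).

Definition semi_infinite (F : finFieldType) (M : set (ellsum F)) :=
  is_subspace M /\ exists L m n,
    [/\ range (@opgraph F) L, is_qdim L (L `&` M) m & is_qdim M (L `&` M) n].

Definition reldim0 (F : finFieldType) (M : set (ellsum F)) :=
  exists L n,
    [/\ range (@opgraph F) L, is_qdim L (L `&` M) n & is_qdim M (L `&` M) n].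

Definition is_gr0 (F : finFieldType) : set (set (ellsum F)) :=
  [set M | semi_infinite M /\ reldim0 M].

Definition Gr0 (F : finFieldType) : Type := set_type (@is_gr0 F).

(** Coordinates of the pair of spaces V[Om, Xi], W[Om, Xi]: [inl i] stands for e_i
    and [inr j] for f_j; rows index the coordinates of V, columns those of W.
    As Xi is finite, the elements of V are finite combinations; as Om is finite,
    those of W are arbitrary formal combinations. *)
Definition ecoord (F : finFieldType) (u : ellsum F) (x : nat + nat) : F :=
  match x with inl i => u.1 i | inr j => u.2 j end.

Definition in_row (Om Xi : {fset nat}) (x : nat + nat) : bool :=
  match x with inl i => i \notin Om | inr j => j \in Xi end.

Definition rows (Om Xi : {fset nat}) := {x : nat + nat | in_row Om Xi x}.
Definition cols (Om Xi : {fset nat}) := {x : nat + nat | ~~ in_row Om Xi x}.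

Definition chartV (F : finFieldType) (Om Xi : {fset nat}) : set (ellsum F) :=
  [set u | forall y : cols Om Xi, ecoord u (val y) = 0].

Definition chartW (F : finFieldType) (Om Xi : {fset nat}) : set (ellsum F) :=
  [set u | forall x : rows Om Xi, ecoord u (val x) = 0].

(** The graph of the operator V[Om, Xi] -> W[Om, Xi] with matrix T. *)
Definition chart_graph (F : finFieldType) (Om Xi : {fset nat})
    (T : Fprod F (rows Om Xi * cols Om Xi)) : set (ellsum F) :=
  [set u | exists v w : ellsum F, [/\ chartV Om Xi v, chartW Om Xi w, u = v + w &
    forall y : cols Om Xi, ecoord w (val y) =
      \sum_(x \in [set: rows Om Xi]) ecoord v (val x) * T (x, y)]].

Lemma is_qdim_dual (F : finFieldType) (E : lmodType F) (U W : set E) n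
    (b : 'I_n -> E) (phi : 'I_n -> E -> F) :
  (forall i a u v, phi i (a *: u + v) = a * phi i u + phi i v) ->
  (forall a u v, U u -> U v -> U (a *: u + v)) ->
  (forall i, U (b i)) -> (forall i j, phi i (b j) = (i == j)%:R) ->
  (forall u, U u -> W u <-> forall i, phi i u = 0) ->
  is_qdim U W n.
Proof.
move=> phiL UL Ub phib WP; exists b; split=> // u Uu.
have phiB i c (r : seq 'I_n) : phi i (u - \sum_(k <- r) c k *: b k) =
    phi i u - \sum_(k <- r) c k * (i == k)%:R.
  elim: r => [|k r IH]; first by rewrite !big_nil !subr0.
  rewrite !big_cons !opprD addrCA -scaleNr phiL IH phib mulNr.
  by rewrite [RHS]addrCA.
have UB (c : {ffun 'I_n -> F}) (r : seq 'I_n) : U (u - \sum_(k <- r) c k *: b k).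
  elim: r => [|k r IH]; first by rewrite big_nil subr0.
  by rewrite big_cons opprD addrCA -scaleNr; apply: UL.
have del i (c : {ffun 'I_n -> F}) : \sum_k c k * (i == k)%:R = c i.
  rewrite (bigD1 i)//= eqxx mulr1 big1 ?addr0// => k /negPf.
  by rewrite eq_sym => ->; rewrite mulr0.
exists [ffun i => phi i u]; split=> [|c].
  by apply/WP => [|i]; [exact: UB | rewrite phiB del ffunE subrr].
move=> /WP - /(_ (UB _ _)) H; apply/ffunP => i; have := H i.
by rewrite phiB del ffunE => /eqP; rewrite subr_eq0 => /eqP.
Qed.

Definition fsupp (I : choiceType) (F : finFieldType) (f : I -> F) :=
  finite_set [set i | f i != 0].

Lemma fsum_linear (F : finFieldType) (I : choiceType) (f g t : I -> F) (a : F) :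
  fsupp f -> fsupp g ->
  \sum_(i \in [set: I]) (a * f i + g i) * t i =
  a * (\sum_(i \in [set: I]) f i * t i) + \sum_(i \in [set: I]) g i * t i.
Proof.
move=> ff fg; set A := [set i | f i != 0] `|` [set i | g i != 0].
have fA : finite_set A by rewrite finite_setU.
have out i : ~ A i -> f i = 0 /\ g i = 0.
  move=> /not_orP[/negP/negPn/eqP -> /negP/negPn/eqP ->]; by [].
have W (h : I -> F) : (forall i, ~ A i -> h i = 0) ->
    \sum_(i \in [set: I]) h i = \sum_(i <- fset_set A) h i.
  move=> h0; rewrite -(@fsbig_finite _ _ _ _ A)//; apply/esym.
  by apply: fsbig_widen => // i [_ /h0].
rewrite !W; first last.
- by move=> i /out[-> ->]; rewrite mulr0 addr0 mul0r.
- by move=> i /out[-> _]; rewrite mul0r.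
- by move=> i /out[_ ->]; rewrite mul0r.
by rewrite big_distrr -big_split/=; apply: eq_bigr => i _; rewrite mulrDl mulrA.
Qed.

Lemma fsum_eq1 (F : finFieldType) (I : choiceType) (f : I -> F) (i : I) :
  (forall k, k != i -> f k = 0) -> \sum_(k \in [set: I]) f k = f i.
Proof.
move=> f0; rewrite -(@fsbig_set1 _ 0 +%R _ i f); apply/esym/fsbig_widen => //.
by move=> k [_ /eqP /f0].
Qed.

Lemma fsupp_ell (F : finFieldType) (v : ell F) : @fsupp nat F v.
Proof. exact/asboolP/(ell_funP v). Qed.

Lemma fsupp_coord (F : finFieldType) (Om Xi : {fset nat}) (u : ellsum F) :
  @fsupp (rows Om Xi) F (fun x => ecoord u (val x)).
Proof.
have fA : finite_set ((inl : nat -> nat + nat) @` [set i | u.1 i != 0] `|`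
    (inr : nat -> nat + nat) @` [set` Xi]).
  rewrite finite_setU; split; apply: finite_image; last exact: finite_fset.
  exact: fsupp_ell.
apply: (@sub_finite_set _ _ (val @^-1` _) _ (finite_preimage _ fA)) => [|? ? _ _]; last exact: val_inj.
by move=> [[i|j] xP] /= ?; [left; exists i | right; exists j].
Qed.

Lemma ex_ell (F : finFieldType) (g : nat -> F) :
  fsupp g -> exists v : ell F, forall i, v i = g i.
Proof. by move=> fg; exists (Ell (asboolT fg : g \in @finsupp_pred F)). Qed.

Lemma ex_ell_fset (F : finFieldType) (A : {fset nat}) (g : nat -> F) :
  exists v : ell F, forall i, v i = if i \in A then g i else 0.
Proof.
apply: ex_ell; apply: (@sub_finite_set _ _ [set` A]) => // i /=.
by case: ifP => //; rewrite eqxx.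
Qed.

Lemma coordL (F : finFieldType) (a : F) (u v : ellsum F) x :
  ecoord (a *: u + v) x = a * ecoord u x + ecoord v x.
Proof. by case: x. Qed.

Lemma space_eq (F : finFieldType) (u v : ellsum F) :
  (forall x, ecoord u x = ecoord v x) -> u = v.
Proof.
case: u v => u1 u2 [v1 v2] uv; congr (_, _).
  by apply/val_inj/funext => i; exact: (uv (inl i)).
by apply/funext => i; exact: (uv (inr i)).
Qed.

Lemma graphP (F : finFieldType) (T : Fprod F (nat * nat)) (u : ellsum F) :
  opgraph T u <-> forall j, u.2 j = \sum_(i \in [set: nat]) u.1 i * T (i, j).
Proof.
split=> [[v _ <-] //|uT]; exists u.1 => //.
by rewrite [RHS]surjective_pairing; congr (_, _); apply/funext => j; rewrite uT.
Qed.

Lemma graph_sub (F : finFieldType) (T : Fprod F (nat * nat)) : is_subspace (opgraph T).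
Proof.
split=> [|a u v /graphP uT /graphP vT]; apply/graphP => j.
  by rewrite fsbig1// => i _; rewrite mul0r.
rewrite -[LHS]/(a * u.2 j + v.2 j) uT vT.
by rewrite -(@fsum_linear F _ _ _ (fun i => T (i, j)) a (fsupp_ell u.1) (fsupp_ell v.1)).
Qed.

Definition rsum (F : finFieldType) (Om Xi : {fset nat})
    (T : Fprod F (rows Om Xi * cols Om Xi)) (u : ellsum F) (y : cols Om Xi) : F :=
  \sum_(x \in [set: rows Om Xi]) ecoord u (val x) * T (x, y).

Lemma rsumL (F : finFieldType) (Om Xi : {fset nat})
    (T : Fprod F (rows Om Xi * cols Om Xi)) (a : F) (u v : ellsum F) (y : cols Om Xi) :
  rsum T (a *: u + v) y = a * rsum T u y + rsum T v y.
Proof.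
rewrite /rsum -(@fsum_linear F _ _ _ (fun x => T (x, y)) a (fsupp_coord Om Xi u) (fsupp_coord Om Xi v)).
by apply: eq_fsbigr => x _; rewrite coordL.
Qed.

Lemma chart_graphP (F : finFieldType) (Om Xi : {fset nat})
    (T : Fprod F (rows Om Xi * cols Om Xi)) (u : ellsum F) :
  chart_graph T u <-> forall y, ecoord u (val y) = rsum T u y.
Proof.
split=> [[v [w [Vv Ww -> wT]]] y|uT].
  have -> : v + w = 1 *: v + w by rewrite scale1r.
  rewrite coordL rsumL Vv mulr0 add0r wT mul1r [Xi in _ = _ + Xi](_ : _ = 0) ?addr0//.
  by rewrite /rsum fsbig1// => x _; rewrite Ww mul0r.
have [w1 w1E] := @ex_ell_fset F Om u.1.
pose w : ellsum F := (w1, fun j => if j \in Xi then 0 else u.2 j).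
have wE x : ecoord w x = if in_row Om Xi x then 0 else ecoord u x.
  by case: x => [i|j] //=; rewrite w1E; case: (i \in Om).
have vE x : ecoord (u - w) x = if in_row Om Xi x then ecoord u x else 0.
  by rewrite addrC -scaleN1r coordL wE mulN1r; case: ifP; rewrite ?oppr0 ?add0r ?addNr.
exists (u - w), w; split.
- by move=> [y /= yP]; rewrite vE (negPf yP).
- by move=> [x /= xP]; rewrite wE xP.
- by rewrite subrK.
- move=> y; rewrite wE (negPf (valP y)) uT; apply: eq_fsbigr => x _.
  by rewrite vE (valP x).
Qed.

Lemma chart_graph_sub (F : finFieldType) (Om Xi : {fset nat})
    (T : Fprod F (rows Om Xi * cols Om Xi)) : is_subspace (chart_graph T).
Proof.
split=> [|a u v /chart_graphP uT /chart_graphP vT]; apply/chart_graphP => y.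
  rewrite [LHS](_ : _ = 0); last by case: (val y).
  by rewrite /rsum fsbig1// => x _; case: (val x) => i; rewrite mul0r.
by rewrite coordL rsumL uT vT.
Qed.

Lemma rsum_graph (F : finFieldType) (Om Xi : {fset nat})
    (T : Fprod F (rows Om Xi * cols Om Xi)) (u : ellsum F) (y : cols Om Xi) :
  (forall j, j \in Xi -> u.2 j = 0) ->
  rsum T u y = \sum_(i \in [set: nat]) u.1 i *
    (if insub (inl i) is Some x then T (x, y) else 0).
Proof.
move=> uX; pose G z : F := ecoord u z * (if insub z is Some x then T (x, y) else 0).
have -> : rsum T u y = \sum_(z \in val @` [set: rows Om Xi]) G z.
  rewrite fsbig_image; last by move=> ? ? _ _; exact: val_inj.
  by apply: eq_fsbigr => x _; rewrite /G valK.
have -> : \sum_(i \in [set: nat]) u.1 i * (if insub (inl i) is Some x then T (x, y) else 0)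
    = \sum_(z \in inl @` [set: nat]) G z.
  by rewrite fsbig_image// => ? ? _ _ [].
transitivity (\sum_(z \in [set: nat + nat]) G z); [|apply/esym]; apply: fsbig_widen => //.
  move=> z [_ /= nz]; rewrite /preimage /= /G; case: insubP => [x _ xz|]; last by rewrite mulr0.
  by exfalso; apply: nz; exists x.
move=> [i|j] [_ /= nz]; first by exfalso; apply: nz; exists i.
rewrite /preimage /= /G; case: insubP => [x /= jX _|]; last by rewrite mulr0.
by rewrite /= uX// mul0r.
Qed.

Section gr0_chart.
Variables (F : finFieldType) (Om Xi : {fset nat}) (T : Fprod F (rows Om Xi * cols Om Xi)).

Let S : Fprod F (nat * nat) := fun p =>
  if (insub (inl p.1), insub (inr p.2)) is (Some x, Some y) then T (x, y) else 0.

Let inrC j : j \notin Xi -> exists y : cols Om Xi, val y = inr j /\ insub (inr j) = Some y.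
Proof. 
move=> jX; pose y : cols Om Xi := exist _ (inr j) jX.
by exists y; split=> //; exact: (@valK _ _ (cols Om Xi) y).
Qed.

Let graphSE u : opgraph S u <-> (forall j, j \in Xi -> u.2 j = 0) /\
  (forall y : cols Om Xi, forall j, val y = inr j -> u.2 j = rsum T u y).
Proof.
split=> [/graphP uS|[uX uT]].
  have uX j : j \in Xi -> u.2 j = 0.
    move=> jX; rewrite uS fsbig1// => i _; rewrite /S/=; case: insubP => [x|]; rewrite ?mulr0//.
    by case: insubP => //; rewrite ?mulr0//= jX.
  split=> // y j yj; rewrite uS rsum_graph//; apply: eq_fsbigr => i _.
  rewrite /S /= -yj valK; by case: insubP.
apply/graphP => j; have [jX|jX] := boolP (j \in Xi).
  rewrite uX// fsbig1// => i _; rewrite /S/=; case: insubP => [x|]; rewrite ?mulr0//.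
  by case: insubP => //; rewrite ?mulr0//= jX.
have [y [yj iy]] := inrC jX; rewrite (uT _ _ yj) rsum_graph//; apply: eq_fsbigr => i _.
by rewrite /S/= iy; case: insubP.
Qed.

Let inlC i : i \in Om -> {y : cols Om Xi | val y = inl i}.
Proof. by move=> iO; have h : ~~ in_row Om Xi (inl i); [by rewrite /= iO|exists (exist _ (inl i) h)]. Qed.

Let inrR j : j \in Xi -> {x : rows Om Xi | val x = inr j}.
Proof. by move=> jX; exists (exist _ (inr j) jX). Qed.

Let nthO (i : 'I_#|` Om|) : nth 0%N Om i \in Om. Proof. exact: mem_nth. Qed.
Let nthX (i : 'I_#|` Xi|) : nth 0%N Xi i \in Xi. Proof. exact: mem_nth. Qed.

Lemma chart_gr0_L : is_qdim (opgraph S) (opgraph S `&` chart_graph T) #|` Om|.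
Proof.
pose phi (i : 'I_#|` Om|) (u : ellsum F) : F := u.1 (nth 0%N Om i) - rsum T u (projT1 (inlC (nthO i))).
have : forall i : 'I_#|` Om|, exists v : ell F, forall k, v k = (k == nth 0%N Om i)%:R.
  move=> i; have [v vE] := @ex_ell_fset F Om (fun k => (k == nth 0%N Om i)%:R : F).
  exists v => k; rewrite vE; case: ifP => // kO; case: eqP => // ki.
  by move: kO; rewrite ki nthO.
move=> /choice[e eE].
have rs0 i y : rsum T ((e i, 0) : ellsum F) y = 0.
  rewrite /rsum fsbig1// => -[[k|j] /= xP] _; last by rewrite mul0r.
  rewrite eE; case: eqP => [ki|]; last by rewrite mul0r.
  by exfalso; move: xP; rewrite ki nthO.
apply: (@is_qdim_dual _ _ _ _ _ (fun i => (e i, 0) : ellsum F) phi).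
- move=> i a u v; rewrite /phi rsumL; set k := nth _ _ _.
  by rewrite [Xi in Xi - _](_ : _ = a * u.1 k + v.1 k)// mulrBr opprD addrACA.
- by have [_] := graph_sub S.
- by move=> i; apply/graphSE; split=> // y j yj; rewrite rs0.
- move=> i j; rewrite /phi rs0 subr0 /= eE nth_uniq ?fset_uniq//.
- move=> u uS; split=> [[_ /chart_graphP uT] i|u0].
    apply/eqP; rewrite subr_eq0 -uT; case: (inlC _) => /= y ->//.
  split=> //; apply/chart_graphP => y; have /graphSE[uX uT] := uS.
  case yE : (val y) => [k|j]; last exact: uT.
  have kO : k \in Om by have := valP y; rewrite yE /= negbK.
  have ik : (index k Om < #|` Om|)%N by rewrite index_mem.
  have /eqP := u0 (Ordinal ik); rewrite subr_eq0; case: (inlC _) => /= y' y'E.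
  have <- : y = y' by apply: val_inj; rewrite yE -[RHS]/(sval y') y'E /= nth_index.
  by move=> /eqP <-; rewrite nth_index.
Qed.

Lemma chart_gr0_M : is_qdim (chart_graph T) (opgraph S `&` chart_graph T) #|` Xi|.
Proof.
have : forall i : 'I_#|` Xi|, exists b : ellsum F, chart_graph T b /\
    forall j, j \in Xi -> b.2 j = (j == nth 0%N Xi i)%:R.
  move=> i; have [x xE] := inrR (nthX i).
  pose t z := if insub z is Some y then T (x, y) else 0.
  have [v vE] := @ex_ell_fset F Om (fun k => t (inl k)).
  pose b : ellsum F := (v, fun j => if j \in Xi then (j == nth 0%N Xi i)%:R else t (inr j)).
  exists b; split; last by move=> j /= ->.
  apply/chart_graphP => y; rewrite /rsum (@fsum_eq1 _ _ _ x) => [|x' x'x].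
    rewrite xE /= nthX eqxx mul1r; have <- : t (val y) = T (x, y) by rewrite /t valK.
    rewrite -[sval y]/(val y); move: (val y) (valP y) => [k /negPn kO|j /negPf jX] /=.
      by rewrite vE kO.
    by rewrite [j \in Xi]jX.
  case: x' x'x => [[k|j] /= xP] x'x; first by rewrite vE (negPf xP) mul0r.
  rewrite xP; case: eqP => [ji|]; last by rewrite mul0r.
  by case/eqP: x'x; apply: val_inj; rewrite /= xE ji.
move=> /choice[b bP].
apply: (@is_qdim_dual _ _ _ _ _ b (fun i (u : ellsum F) => u.2 (nth 0%N Xi i))) => //.
- by have [_] := chart_graph_sub T.
- by move=> i; have [] := bP i.
- by move=> i j; have [_ ->//] := bP j; rewrite nth_uniq ?fset_uniq.
- move=> u uT; split=> [[/graphSE[uX _] _] i|u0]; first exact: uX.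
  split=> //; apply/graphSE; split=> [j jX|y j yj].
    have ij : (index j Xi < #|` Xi|)%N by rewrite index_mem.
    by have := u0 (Ordinal ij); rewrite /= nth_index.
  by have /chart_graphP/(_ y) := uT; rewrite yj.
Qed.

Lemma chart_gr0 : #|` Om| = #|` Xi| -> is_gr0 (chart_graph T).
Proof.
move=> OX; have h : reldim0 (chart_graph T).
  exists (opgraph S), #|` Om|; split; first by exists S.
    exact: chart_gr0_L.
  by rewrite OX; exact: chart_gr0_M.
split=> //; split; first exact: chart_graph_sub.
by have [L [n [? ? ?]]] := h; exists L, n, n.
Qed.

End gr0_chart.

Lemma graph_gr0 (F : finFieldType) (T : Fprod F (nat * nat)) : is_gr0 (opgraph T).
Proof.
have q0 : is_qdim (opgraph T) (opgraph T `&` opgraph T) 0.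
  have [_ TL] := graph_sub T.
  apply: (@is_qdim_dual _ _ _ _ _ (fun=> 0) (fun _ _ => 0)) => //; try by case.
have h : reldim0 (opgraph T) by exists (opgraph T), 0%N; split=> //; exists T.
split=> //; split; first exact: graph_sub.
by have [L [n [? ? ?]]] := h; exists L, n, n.
Qed.

Definition chart (F : finFieldType) (Om Xi : {fset nat}) (OX : #|` Om| = #|` Xi|)
    (T : Fprod F (rows Om Xi * cols Om Xi)) : Gr0 F :=
  exist _ (chart_graph T) (mem_set (chart_gr0 T OX)).

Definition cell_chart (F : finFieldType) (T : Fprod F (nat * nat)) : Gr0 F :=
  exist _ (opgraph T) (mem_set (graph_gr0 T)).

Definition main_cell (F : finFieldType) : set (Gr0 F) := range (@cell_chart F).

(** The charts with #|Om| = #|Xi| cover the relative dimension 0 subspaces. *)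
Definition gr_borel (F : finFieldType) : set (set (Gr0 F)) :=
  [set A | forall (Om Xi : {fset nat}) (OX : #|` Om| = #|` Xi|),
    measurable (chart (F := F) OX @^-1` A)].

Lemma gr_borel0 (F : finFieldType) : @gr_borel F set0.
Proof. by move=> Om Xi OX; rewrite preimage_set0; exact: measurable0. Qed.

Lemma gr_borelC (F : finFieldType) (A : set (Gr0 F)) : gr_borel A -> gr_borel (~` A).
Proof. by move=> mA Om Xi OX; rewrite preimage_setC; apply: measurableC; exact: mA. Qed.

Lemma gr_borel_bigcup (F : finFieldType) (A : (set (Gr0 F))^nat) :
  (forall i, gr_borel (A i)) -> gr_borel (\bigcup_i A i).
Proof.
move=> mA Om Xi OX; rewrite preimage_bigcup.
by apply: bigcupT_measurable => i; exact: mA.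
Qed.

HB.instance Definition _ (F : finFieldType) := Choice.on (Gr0 F).
HB.instance Definition _ (F : finFieldType) := isPointed.Build (Gr0 F) (cell_chart 0).
HB.instance Definition _ (F : finFieldType) :=
  isMeasurable.Build default_measure_display (Gr0 F)
    (@gr_borel0 F) (@gr_borelC F) (@gr_borel_bigcup F).

(** The image of the set of subspaces A under L |-> Lg. *)
Definition gr_act (F : finFieldType) (g : ellsum F -> ellsum F) (A : set (Gr0 F)) :
    set (Gr0 F) :=
  [set M : Gr0 F | exists2 L : Gr0 F, A L & val M = g @` val L].

Definition GL0_invariant (R : realType) (F : finFieldType)
    (mu : set (Gr0 F) -> \bar R) :=
  forall g : {linear ellsum F -> ellsum F}, GL0 g ->
    forall A : set (Gr0 F), measurable A -> mu (gr_act g A) = mu A.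

(** P is the product of the uniform probability measures on the copies of F. *)
Definition is_uniform_product (R : realType) (F : finFieldType) (I : choiceType)
    (P : probability (Fprod F I) R) :=
  forall (A : {fset I}) (B : I -> {set F}),
    P [set T | forall k, k \in A -> (T k : F) \in B k] =
    (\prod_(k <- A) (#|B k|%:R / #|F|%:R))%:E.

(* Main.v *)
Require Import Defs.
From HB Require Import structures.
From mathcomp Require Import all_boot all_order all_algebra finmap.
From mathcomp Require Import all_classical all_reals all_analysis.
From mathcomp Require Import mxabelem ring lra.

Set Implicit Arguments.
Unset Strict Implicit.
Unset Printing Implicit Defensive.

Import Order.TTheory GRing.Theory Num.Theory.
Import numFieldNormedType.Exports.
Local Open Scope classical_set_scope.
Local Open Scope ring_scope.

(** Write E for the sum of l and l^diamond and q for #|F|. For each m let K_m be the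
    space of vectors whose e-coordinates all vanish and whose f-coordinates of
    index smaller than m vanish, and let U_m be the space of vectors whose
    e-coordinates of index at least m vanish. These are compact open subspaces and
    U_m / K_m is F^(2m). Call a subspace L good at level m if it meets K_m in 0, if
    it spans E together with U_m, and if its shadow, the image of L cap U_m in
    U_m / K_m, has dimension m. The points of the Grassmannian are the subspaces
    that are good at some level ([gr0_good], [good_gr0]); a good subspace remains
    good at higher levels, and its shadow there determines the lower ones
    ([shadow_refine]). So the Grassmannian is an increasing union of sets [goodset n],
    each of which is a limit of finite sets. A cylinder of level N is a condition on
    the shadow of level N; the cylinders form a ring of sets and generate the Borel
    sets ([gr_borelE]).

    Uniqueness. An invertible matrix of size 2N acts on U_N / K_N and extends to a
    finite operator [finop] in the group. These operators are transitive on the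
    N-dimensional subspaces of F^(2N), so that an invariant measure gives all shadows of
    level N the same mass. The cell consists of the points that are good at level
    0, and its shadows of level N are the graphs of the q^(N^2) matrices of size N.
    Hence a cylinder with k shadows has k / q^(N^2) times the mass of the cell
    ([invariant_density]). On the cell this is the counting of corners of matrices,
    that is, the uniform product measure ([cell_probability]).

    Existence. The same formula defines a premeasure on cylinders. It does not depend
    on the level, again by transitivity ([card_shadows_lift]), and it is countably
    additive because cylinders are compact ([cylinder_finite_cover]), so that it
    extends to [gr_measure]. Invariance under finite operators is clear. An arbitrary
    operator g of index 0 moves the cylinder of a shadow S according to its effect on
    the flag K_m, S, U_m. The index 0 condition means that the image of this flag
    has the same dimensions over a small K_N as the flag itself, and therefore g can
    be replaced there by a finite operator ([GL0_finite_model], [act_local]).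

    Total mass. The good points of level n have measure c_n, the number of
    n-dimensional subspaces of F^(2n) divided by q^(n^2), which is the product of the
    (1 - q^-(n+j)) / (1 - q^-j) for 1 <= j <= n ([density_good]). These numbers are
    bounded by 4, whence finiteness, and they have the same limit as the products
    of the (1 - q^-j)^-1 ([density_good_cvg]). *)

(** Dimension counts without bases: the image of X is a union of #I translates of
    the image of Y, which are disjoint because Y absorbs the kernel of p. In this
    way infinite-dimensional spaces are compared through finite images. *)
Lemma card_image_fibers (E : zmodType) (W : finZmodType) (p : {additive E -> W})
    (X Y : set E) (A B : {set W}) (I : finType) (beta : I -> E) :
  (forall w, w \in A <-> exists2 u, X u & p u = w) ->
  (forall w, w \in B <-> exists2 u, Y u & p u = w) ->
  (forall u v, X u -> X v -> X (u - v)) -> (forall u v, Y u -> Y v -> Y (u - v)) ->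
  Y `<=` X -> (forall c, X (beta c)) ->
  (forall u, X u -> exists c, Y (u - beta c)) ->
  (forall c d, Y (beta c - beta d) -> c = d) ->
  (forall u, X u -> p u = 0 -> Y u) ->
  #|A| = (#|I| * #|B|)%N.
Proof.
move=> AP BP XB YB YX Xb surj inj ker.
pose f (cw : I * W) := p (beta cw.1) + cw.2.
have YD u v : Y u -> Y v -> Y (u + v).
  move=> Yu Yv; have Y0 : Y 0 by rewrite -(subrr u); exact: YB.
  by rewrite -[v]opprK -[- v]add0r; do 2 apply: (YB) => //.
have XD u v : X u -> X v -> X (u + v).
  move=> Xu Xv; have X0 : X 0 by rewrite -(subrr u); exact: XB.
  by rewrite -[v]opprK -[- v]add0r; do 2 apply: (XB) => //.
have -> : A = f @: (finset.setX [set: I] B).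
  apply/setP => w; apply/idP/imsetP => [/AP[u Xu <-]|[[c w'] /setXP[_ /= /BP[y Yy yw] ->]]].
    have [c Yc] := surj _ Xu; exists (c, p (u - beta c)); last by rewrite /f/= -raddfD addrC subrK.
    by apply/setXP; split=> //; apply/BP; exists (u - beta c).
  apply/AP; exists (beta c + y); last by rewrite raddfD yw.
  by apply: XD => //; exact: YX.
rewrite card_in_imset ?cardsX ?cardsT// => -[c w] [d w'].
move=> /setXP[_ /= /BP[y Yy yw]] /setXP[_ /= /BP[y' Yy' yw']]; rewrite /f/= => e.
suff cd : c = d by rewrite cd; move: e; rewrite cd => /addrI ->.
apply: inj; have Yz : Y ((beta c + y) - (beta d + y')).
  apply: ker; first by apply: XB; apply: XD => //; exact: YX.
  by rewrite raddfB (raddfD p (beta c)) (raddfD p (beta d)) yw yw' e subrr.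
suff -> : beta c - beta d = ((beta c + y) - (beta d + y')) - (y - y').
  by apply: (YB) => //; apply: (YB).
by rewrite (opprD (beta d)) addrACA addrK.
Qed.

(** * The subspaces K_m and U_m, and shadows *)

Section Coordinates.
Variable F : finFieldType.
Implicit Types (u v : ellsum F) (m n N : nat) (L : set (ellsum F)).

(** The coordinates of a vector of U_m modulo K_m. *)
Definition coords m u : 'rV[F]_(m + m) :=
  row_mx (\row_(i < m) (u.1 i : F)) (\row_(j < m) (u.2 j : F)).

Lemma coords_is_linear m : linear (coords m).
Proof.
move=> a u v; rewrite /coords scale_row_mx add_row_mx; congr row_mx;
by apply/rowP => i; rewrite !mxE.
Qed.
HB.instance Definition _ m :=
  GRing.isLinear.Build F (ellsum F) 'rV[F]_(m + m) _ (coords m) (coords_is_linear m).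

Lemma of_coords_finsupp m (w : 'rV[F]_(m + m)) :
  (fun i : nat => if insub i is Some k then w 0 (lshift m k) else 0 : F^o)
    \in @finsupp_pred F.
Proof.
apply/asboolP; apply: (@sub_finite_set _ _ `I_m); last exact: finite_II.
by move=> i /=; case: insubP => [k im _ //|]; rewrite eqxx.
Qed.

(** The representatives modulo K_m that lie in the span of the e_i and f_j with
    i, j < m. *)
Definition of_coords m (w : 'rV[F]_(m + m)) : ellsum F :=
  (Ell (of_coords_finsupp w),
   fun j : nat => if insub j is Some k then w 0 (rshift m k) else 0 : F^o).

Lemma of_coords_is_linear m : linear (@of_coords m).
Proof.
move=> a u v; apply: space_eq => -[i|j]; rewrite coordL /=.
  by case: insubP => [k _ _|_]; rewrite ?mxE// mulr0 addr0.
by case: insubP => [k _ _|_]; rewrite ?mxE// mulr0 addr0.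
Qed.
HB.instance Definition _ m :=
  GRing.isLinear.Build F 'rV[F]_(m + m) (ellsum F) _ (@of_coords m) (@of_coords_is_linear m).

Lemma of_coordsK m : cancel (@of_coords m) (@coords m).
Proof.
move=> w; rewrite -[RHS]hsubmxK; congr row_mx; apply/rowP => i; rewrite !mxE /=.
  by case: insubP => [k _ ki|]; [congr (w 0 (lshift _ _)); apply: val_inj|rewrite ltn_ord].
by case: insubP => [k _ ki|]; [congr (w 0 (rshift _ _)); apply: val_inj|rewrite ltn_ord].
Qed.

(** [inU m] and [inK m] are the compact open subspaces U_m and K_m; the former
    exhaust E, the latter form a neighbourhood basis of 0, and U_m / K_m has
    dimension 2m. For m = 0 both are l^diamond. *)
Definition inU m u := forall i, (m <= i)%N -> u.1 i = 0.
Definition inK m u := inU m u /\ coords m u = 0.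

Lemma eq_coordsP m u v : coords m u = coords m v <->
  (forall i, (i < m)%N -> u.1 i = v.1 i) /\ (forall j, (j < m)%N -> u.2 j = v.2 j).
Proof.
split=> [/eq_row_mx[/rowP e1 /rowP e2]|[e1 e2]].
  split=> i im; first by have := e1 (Ordinal im); rewrite !mxE.
  by have := e2 (Ordinal im); rewrite !mxE.
by congr row_mx; apply/rowP => i; rewrite !mxE ?e1 ?e2.
Qed.

Lemma inKP m u : inK m u <-> (forall i, u.1 i = 0) /\ (forall j, (j < m)%N -> u.2 j = 0).
Proof.
have E : coords m u = 0 <-> coords m u = coords m 0 by rewrite linear0.
split=> [[uU /E/eq_coordsP[u1 u2]]|[u1 u2]].
  by split=> // i; case: (ltnP i m) => [/u1//|/uU].
by split=> [i _|]; [|apply/E/eq_coordsP; split=> i]; auto.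
Qed.

Lemma inUL m a u v : inU m u -> inU m v -> inU m (a *: u + v).
Proof.
move=> uU vU i mi; rewrite -[LHS]/(ecoord (a *: u + v) (inl i)) coordL /=.
by rewrite uU// vU// mulr0 addr0.
Qed.
Lemma inU0 m : inU m 0. Proof. by []. Qed.
Lemma inKL m a u v : inK m u -> inK m v -> inK m (a *: u + v).
Proof.
move=> [uU u0] [vU v0]; split; first exact: inUL.
by rewrite linearP/= u0 v0 scaler0 addr0.
Qed.
Lemma inK0 m : inK m 0. Proof. by split=> //; rewrite linear0. Qed.

Lemma subU m : is_subspace (inU m : set (ellsum F)).
Proof. by split=> [|a u v]; [exact: inU0|exact: inUL]. Qed.
Lemma subK m : is_subspace (inK m : set (ellsum F)).
Proof. by split=> [|a u v]; [exact: inK0|exact: inKL]. Qed.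

Lemma inU_of_coords m w : inU m (@of_coords m w).
Proof. by move=> i mi /=; case: insubP => // k; rewrite ltnNge mi. Qed.

Lemma inU_mono m N u : (m <= N)%N -> inU m u -> inU N u.
Proof. by move=> mN uU i /(leq_trans mN); exact: uU. Qed.
Lemma inK_mono m N u : (m <= N)%N -> inK N u -> inK m u.
Proof. by move=> mN /inKP[u1 u2]; apply/inKP; split=> // j /leq_trans/(_ mN)/u2. Qed.
Lemma inKU m N u : inK m u -> inU N u.
Proof. by move=> /inKP[u1 _] i _. Qed.

Section Subspace.
Variable L : set (ellsum F).
Hypothesis Ls : is_subspace L.
Lemma sub0 : L 0. Proof. by case: Ls. Qed.
Lemma subZ a u : L u -> L (a *: u).
Proof. by case: Ls => L0 LL Lu; rewrite -[_ *: _]addr0; apply: LL. Qed.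
Lemma subD u v : L u -> L v -> L (u + v).
Proof. by case: Ls => L0 LL Lu Lv; rewrite -[u]scale1r; apply: LL. Qed.
Lemma subN u : L u -> L (- u).
Proof. by rewrite -scaleN1r; exact: subZ. Qed.
Lemma subB u v : L u -> L v -> L (u - v).
Proof. by move=> Lu /subN; exact: subD. Qed.
Lemma sub_sum (I : Type) (r : seq I) (P : pred I) (f : I -> ellsum F) :
  (forall i, P i -> L (f i)) -> L (\sum_(i <- r | P i) f i).
Proof. by move=> Lf; elim/big_rec: _ => [|i x Pi]; [exact: sub0|apply: subD; apply: Lf]. Qed.
End Subspace.

Lemma subI L L' : is_subspace L -> is_subspace L' -> is_subspace (L `&` L').
Proof.
by move=> [L0 LL] [L0' LL']; split=> // a u v [Lu Lu'] [Lv Lv']; split; [apply: LL|apply: LL'].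
Qed.

Lemma sub_image L (g : {linear ellsum F -> ellsum F}) :
  is_subspace L -> is_subspace (g @` L).
Proof.
move=> [L0 LL]; split=> [|a u v [u' Lu <-] [v' Lv <-]]; first by exists 0; rewrite ?linear0.
by exists (a *: u' + v'); [exact: LL|rewrite linearP].
Qed.

(** The image of L cap U_m in U_m / K_m. *)
Definition shadow m L : {set 'rV[F]_(m + m)} :=
  [set v | `[< exists2 u, L u /\ inU m u & coords m u = v >]].

Lemma shadowP m L w : w \in shadow m L <-> exists2 u, L u /\ inU m u & coords m u = w.
Proof. by rewrite inE; split=> /asboolP. Qed.

Lemma shadow_mem m L u : L u -> inU m u -> coords m u \in shadow m L.
Proof. by move=> Lu uU; apply/shadowP; exists u. Qed.

End Coordinates.

(** * Finite subspaces as row spaces *)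

Section LinAlg.
Variable F : finFieldType.

Lemma card_field_gt1 : (1 < #|F|)%N.
Proof. by apply/card_gt1P; exists 1, 0; split=> //; exact: oner_neq0. Qed.

Lemma card_rowspace n k (A : 'M[F]_(k, n)) :
  #|[set v : 'rV[F]_n | (v <= A)%MS]%SET| = (#|F| ^ \rank A)%N.
Proof.
by rewrite -card_rowg; apply: eq_card => v; rewrite !inE.
Qed.

Lemma rowspace_of_set n (S : {set 'rV[F]_n}) : 0 \in S ->
  (forall a u v, u \in S -> v \in S -> a *: u + v \in S) ->
  exists A : 'M[F]_(#|S|, n), forall v, (v \in S) = (v <= A)%MS.
Proof.
move=> S0 SL; exists (\matrix_(i < #|S|) enum_val i) => v.
apply/idP/submxP => [vS|[w ->]].
  exists (delta_mx 0 (enum_rank_in vS v)).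
  by rewrite -rowE rowK enum_rankK_in.
rewrite mulmx_sum_row; elim/big_rec: _ => // i x _ xS; apply: SL => //.
by rewrite rowK enum_valP.
Qed.

(** Finite subspaces are given as sets; a basis turns them into matrices, the
    number of rows being read off the cardinality. *)
Lemma row_free_of_set n m (S : {set 'rV[F]_n}) : 0 \in S ->
  (forall a u v, u \in S -> v \in S -> a *: u + v \in S) ->
  #|S| = (#|F| ^ m)%N ->
  exists A : 'M[F]_(m, n), row_free A /\ forall v, (v \in S) = (v <= A)%MS.
Proof.
move=> S0 SL; have [A AP] := rowspace_of_set S0 SL.
have -> : #|S| = (#|F| ^ \rank A)%N.
  by rewrite -card_rowspace; apply: eq_card => v; rewrite inE AP.
move=> /eqP; rewrite (eqn_exp2l _ _ card_field_gt1) => /eqP <-.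
exists (row_base A); split; first exact: row_base_free.
by move=> v; rewrite AP eq_row_base.
Qed.

End LinAlg.

(** * Good subspaces and charts *)

Section Charts.
Variable F : finFieldType.
Implicit Types (u v x : ellsum F) (m n N : nat) (L : set (ellsum F)) (Om Xi : {fset nat}).

(** Under the first two conditions the shadow has dimension m + d, where d is the
    relative dimension of L; the third condition says that d = 0. *)
Definition good m L :=
  [/\ forall u, L u -> inK m u -> u = 0,
      forall x, exists2 u, L u & inU m (x - u) &
      #|shadow m L| = (#|F| ^ m)%N].

Definition bounded m Om Xi :=
  (forall i, i \in Om -> (i < m)%N) /\ (forall j, j \in Xi -> (j < m)%N).

Definition transversal L (W : set (ellsum F)) :=
  (forall u, L u -> W u -> u = 0) /\ (forall x, exists2 u, L u & W (x - u)).

Lemma chartWP Om Xi u :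
  chartW Om Xi u <-> forall z, in_row Om Xi z -> ecoord u z = 0.
Proof.
split=> [uW z zr|uW [z zr]]; last exact: uW.
exact: (uW (exist _ z zr)).
Qed.

Lemma sub_chartW Om Xi : is_subspace (chartW (F := F) Om Xi).
Proof.
split=> [|a u v uW vW] x; first by case: (val x).
by rewrite coordL uW vW mulr0 addr0.
Qed.

Lemma ecoord0 z : ecoord (0 : ellsum F) z = 0. Proof. by case: z. Qed.

Lemma ecoordB u v z : ecoord (u - v) z = ecoord u z - ecoord v z.
Proof. by rewrite addrC -scaleN1r coordL mulN1r addrC. Qed.

Lemma ecoord_sum (I : Type) (r : seq I) (c : I -> F) (f : I -> ellsum F) z :
  ecoord (\sum_(i <- r) c i *: f i) z = \sum_(i <- r) c i * ecoord (f i) z.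
Proof.
elim: r => [|i r IH]; first by rewrite !big_nil ecoord0.
by rewrite !big_cons coordL IH.
Qed.

Lemma inK_chartW m Om Xi u : bounded m Om Xi -> inK m u -> chartW Om Xi u.
Proof. by move=> [_ bX] /inKP[u1 u2]; apply/chartWP => -[i|j] //= /bX/u2. Qed.

Lemma chartW_inU m Om Xi u : bounded m Om Xi -> chartW Om Xi u -> inU m u.
Proof.
move=> [bO _] /chartWP uW i mi; apply: (uW (inl i)) => /=.
by apply/negP => /bO; rewrite ltnNge mi.
Qed.

(** The modified coordinates of the first summand are indexed by the finite set
    [Om], so that supports remain finite. *)
Lemma ex_glue Om Xi u (t : nat + nat -> F) :
  exists v : ellsum F, forall z, ecoord v z = if in_row Om Xi z then ecoord u z else t z.
Proof.
have [|v1 v1E] := @ex_ell F (fun i => if i \notin Om then u.1 i else t (inl i)).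
  apply: (@sub_finite_set _ _ ([set i | u.1 i != 0] `|` [set` Om])); last first.
    by rewrite finite_setU; split; [exact: fsupp_ell|exact: finite_fset].
  by move=> i /=; case: ifPn => [_ ?|]; [left|rewrite negbK; right].
exists (v1, fun j => if j \in Xi then u.2 j else t (inr j)).
by move=> [i|j] //=.
Qed.

Lemma chart_transversal Om Xi (T : Fprod F (rows Om Xi * cols Om Xi)) :
  transversal (chart_graph T) (chartW Om Xi).
Proof.
split=> [u /chart_graphP uT uW|x].
  apply: space_eq => z; rewrite ecoord0; have [zr|zr] := boolP (in_row Om Xi z).
    by have /chartWP := uW; apply.
  have -> := uT (exist _ z zr : cols Om Xi); rewrite /rsum fsbig1// => y _.
  by rewrite uW mul0r.
have [u uE] := ex_glue Om Xi x (fun z => if insub z is Some y then rsum T x y else 0).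
have rE r : in_row Om Xi r -> ecoord u r = ecoord x r by move=> rr; rewrite uE rr.
exists u; last by apply/chartWP => r rr; rewrite ecoordB rE// subrr.
apply/chart_graphP => y; rewrite uE (negPf (valP y)) valK.
by apply: eq_fsbigr => r _; rewrite rE//; exact: (valP r).
Qed.

Lemma row_fsum Om Xi (h : rows Om Xi -> F) u :
  \sum_(x \in [set: rows Om Xi]) ecoord u (val x) * h x =
  \sum_(x <- fset_set [set x : rows Om Xi | ecoord u (val x) != 0])
     ecoord u (val x) * h x.
Proof.
rewrite -(@fsbig_finite _ _ _ _ [set x : rows Om Xi | ecoord u (val x) != 0])//; last first.
  exact: fsupp_coord.
by apply/esym/fsbig_widen => // x [_ /= /negP]; rewrite negbK => /eqP /= ->; rewrite mul0r.
Qed.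

(** The row of T with index x is given by the unique vector of L that differs from
    the basis vector with index x by an element of W[Om, Xi]. *)
Lemma transversal_chart Om Xi L : is_subspace L -> transversal L (chartW Om Xi) ->
  exists T : Fprod F (rows Om Xi * cols Om Xi), L = chart_graph T.
Proof.
move=> Ls [LW LV].
have : forall x : rows Om Xi, exists b, L b /\
    forall z, in_row Om Xi z -> ecoord b z = (z == val x)%:R.
  move=> x; have [e' e'E] : exists e : ellsum F, forall z, ecoord e z = (z == val x)%:R.
    have [|v vE] := @ex_ell F (fun i => (inl i == val x)%:R).
      apply: (@sub_finite_set _ _ (inl @^-1` [set val x])).
        by move=> i /=; case: (inl i =P sval x) => // _; rewrite eqxx.
      by apply: finite_preimage; [move=> ? ? _ _ []|exact: finite_set1].
    by exists (v, fun j => (inr j == val x)%:R) => -[i|j] /=; rewrite ?vE.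
  have [b Lb /chartWP bW] := LV e'; exists b; split=> // z zr.
  by have /eqP := bW z zr; rewrite ecoordB subr_eq0 e'E => /eqP.
(* s u is the vector of L with the same row coordinates as u *)
move=> /choice[b bP]; exists (fun xy => ecoord (b xy.1) (val xy.2)).
set T : Fprod _ _ := fun _ => _.
have [s sP] : exists s : ellsum F -> ellsum F, forall u, L (s u) /\
    (forall z, in_row Om Xi z -> ecoord (s u) z = ecoord u z) /\
    (forall y : cols Om Xi, ecoord (s u) (val y) = rsum T u y).
  pose s u := \sum_(x <- fset_set [set x : rows Om Xi | ecoord u (val x) != 0])
     ecoord u (val x) *: b x.
  exists s => u; split; [|split].
  - by apply: (sub_sum Ls) => x _; apply: (subZ Ls); have [] := bP x.
  - move=> z zr; rewrite ecoord_sum.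
    under eq_bigr => x _ do rewrite (bP x).2//.
    rewrite -row_fsum (@fsum_eq1 _ _ _ (exist _ z zr : rows Om Xi)) /= ?eqxx ?mulr1//.
    move=> k kz; case: eqP => [zk|]; last by rewrite mulr0.
    by case/eqP: kz; apply: val_inj.
  - by move=> y; rewrite ecoord_sum /rsum row_fsum.
have bW u : L u -> (forall z, in_row Om Xi z -> ecoord u z = 0) -> u = 0.
  by move=> Lu u0; apply: LW => //; apply/chartWP.
apply/seteqP; split=> [u Lu|u /chart_graphP uT].
  apply/chart_graphP => y; have [Ls' [sr sc]] := sP u; rewrite -sc; congr (ecoord _ _).
  apply/eqP; rewrite -subr_eq0; apply/eqP.
  by apply: bW => [|z zr]; [exact: subB|rewrite ecoordB sr// subrr].
have [Ls' [sr sc]] := sP u; suff -> : u = s u by [].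
apply: space_eq => z; have [zr|zr] := boolP (in_row Om Xi z); first by rewrite sr.
by have := uT (exist _ z zr : cols Om Xi); rewrite -sc.
Qed.
End Charts.

Section GoodCharts.
Variable F : finFieldType.
Implicit Types (u v x : ellsum F) (m n N : nat) (L : set (ellsum F)) (Om Xi : {fset nat}).

(** The coordinate of E that is read by the k-th entry of [coords m]. *)
Definition kcoord m (k : 'I_(m + m)) : nat + nat :=
  match fintype.split k with inl i => inl (nat_of_ord i) | inr j => inr (nat_of_ord j) end.

Lemma kcoord_l m i : kcoord (lshift m i) = inl (nat_of_ord i).
Proof. by rewrite /kcoord (unsplitK (inl i)). Qed.
Lemma kcoord_r m i : kcoord (rshift m i) = inr (nat_of_ord i).
Proof. by rewrite /kcoord (unsplitK (inr i)). Qed.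

Lemma coordsE m u (k : 'I_(m + m)) : coords m u 0 k = ecoord u (kcoord k).
Proof.
rewrite -[k]fintype.splitK; case: (fintype.split k) => i /=.
  by rewrite kcoord_l row_mxEl mxE.
by rewrite kcoord_r row_mxEr mxE.
Qed.

Definition pivots m Om Xi := [set k : 'I_(m + m) | in_row Om Xi (kcoord k)]%SET.

Lemma sum_bounded m (A : {fset nat}) : (forall i, i \in A -> (i < m)%N) ->
  (\sum_(i < m) (nat_of_ord i \in A) = #|` A|)%N.
Proof.
move=> Am; rewrite -(big_mkord xpredT (fun i => nat_of_bool (i \in A))).
rewrite -big_mkcond /= sum1_count -size_filter; apply: perm_size.
apply: uniq_perm; rewrite ?filter_uniq ?iota_uniq ?fset_uniq// => i.
rewrite mem_filter mem_index_iota /=; case: (boolP (i \in A)) => iA; rewrite ?andbF//.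
by rewrite Am.
Qed.

(** Choosing m of the 2m coordinates amounts to choosing [Om] and [Xi] with the
    same number of elements. *)
Lemma card_pivots m Om Xi : bounded m Om Xi ->
  (#|pivots m Om Xi| + #|` Om| = m + #|` Xi|)%N.
Proof.
move=> [bO bX]; rewrite -sum1dep_card big_mkcond big_split_ord /= -(sum_bounded bO) -(sum_bounded bX).
rewrite addnAC -big_split /=; congr (_ + _)%N; last first.
  by apply: eq_bigr => i _; rewrite kcoord_r /=; case: ifP.
rewrite -[m in RHS]card_ord -sum1_card; apply: eq_bigr => i _.
by rewrite kcoord_l /=; case: (_ \in Om).
Qed.

Lemma pivots_chartW m Om Xi u : bounded m Om Xi -> inU m u ->
  (forall k, k \in pivots m Om Xi -> coords m u 0 k = 0) -> chartW Om Xi u.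
Proof.
move=> [bO bX] uU up; apply/chartWP => -[i|j] /= zr.
  case: (ltnP i m) => [im|/uU//]; have := up (lshift m (Ordinal im)).
  by rewrite inE coordsE kcoord_l /= => ->.
have := up (rshift m (Ordinal (bX _ zr))).
by rewrite inE coordsE kcoord_r /= => ->.
Qed.

Lemma shadow_subspace m L : is_subspace L -> 0 \in shadow m L /\
  forall a w w', w \in shadow m L -> w' \in shadow m L -> a *: w + w' \in shadow m L.
Proof.
move=> [L0 LL]; split; first by apply/shadowP; exists 0; rewrite ?linear0.
move=> a _ _ /shadowP[u [Lu uU] <-] /shadowP[v [Lv vU] <-]; apply/shadowP.
by exists (a *: u + v); [split; [exact: LL|exact: inUL]|rewrite linearP].
Qed.

(** A complement of W[Om, Xi] is parametrized by its pivot coordinates, and m of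
    them remain in U_m. *)
Lemma transversal_good m Om Xi L : bounded m Om Xi -> #|` Om| = #|` Xi| ->
  is_subspace L -> transversal L (chartW Om Xi) -> good m L.
Proof.
move=> bd OX Ls [LW LV]; split=> [u Lu uK|x|].
- by apply: LW => //; exact: inK_chartW uK.
- by have [u Lu uW] := LV x; exists u => //; exact: chartW_inU uW.
pose P := pivots m Om Xi; pose I := {ffun {k | k \in P} -> F}.
have Pm : #|P| = m by have := card_pivots bd; rewrite OX => /addIn.
pose w (c : I) : 'rV[F]_(m + m) := \row_k (if insub k is Some p then c p else 0).
have /choice[beta bP] : forall c : I, exists b, L b /\ chartW Om Xi (of_coords (w c) - b).
  by move=> c; have [b Lb bW] := LV (of_coords (w c)); exists b.
have bU c : inU m (beta c).
  rewrite -[beta c](subKr (of_coords (w c))); apply: (subB (@subU F m)); first exact: inU_of_coords.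
  by have [_ /(chartW_inU bd)] := bP c.
have bp c (k : {k | k \in P}) : coords m (beta c) 0 (val k) = c k.
  have [_ /chartWP bW] := bP c; rewrite coordsE.
  have /bW : in_row Om Xi (kcoord (val k)) by have := valP k; rewrite inE.
  by rewrite ecoordB -coordsE of_coordsK mxE valK => /eqP; rewrite subr_eq0 => /eqP <-.
pose B : {set 'rV[F]_(m + m)} := [set 0]%SET.
rewrite (@card_image_fibers _ _ (coords m) (L `&` inU m) [set 0] (shadow m L) B I beta).
- by rewrite cards1 muln1 card_ffun card_sig -[#|[pred _ | _]|]/#|P| Pm.
- by move=> v; rewrite shadowP.
- move=> v; rewrite /B finset.in_set1; split=> [/eqP ->|[_ -> <-]]; last by rewrite raddf0.
  by exists 0; rewrite ?raddf0.
- by move=> u v [Lu uU] [Lv vU]; split; [exact: subB|exact: (subB (@subU F m))].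
- by move=> u v -> ->; rewrite /= subr0.
- by move=> _ ->; split; [exact: sub0|exact: inU0].
- by move=> c; split; [have [] := bP c|].
- move=> u [Lu uU]; exists [ffun k => coords m u 0 (val k)]; apply: LW.
    by apply: subB => //; have [] := bP [ffun k => coords m u 0 (val k)].
  apply: (pivots_chartW bd) => [|k kP]; first exact: (subB (@subU F m)).
  rewrite [coords m _]raddfB mxE [X in _ + X]mxE; set c := [ffun _ => _].
  by rewrite (bp c (exist _ k kP) : coords m (beta c) 0 k = _) ffunE subrr.
- move=> c d /= cd; apply/ffunP => k; rewrite -!bp.
  by move/eqP: cd; rewrite subr_eq0 => /eqP ->.
- by move=> u [Lu uU] u0; apply: LW => //; apply: (inK_chartW bd).
Qed.

(** Some m coordinates restrict to an isomorphism from the m-dimensional shadow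
    to F^m, that is, the remaining ones span a complement. This is where
    coordinate charts come from. *)
Lemma good_transversal m L : is_subspace L -> good m L ->
  exists Om Xi, [/\ bounded m Om Xi, #|` Om| = #|` Xi| & transversal L (chartW Om Xi)].
Proof.
move=> Ls [LK LU cL]; have [t0 tL] := shadow_subspace m Ls.
have [A [Af AP]] := row_free_of_set t0 tL cL.
have ATf : row_full A^T by rewrite /row_full mxrank_tr.
pose f := fullrankfun ATf; have finj : injective f := @fullrankfun_inj _ _ _ _ ATf.
pose Q := f @: [set: 'I_m]%SET.
have Qm : #|Q| = m by rewrite card_imset// cardsT card_ord.
pose Om : {fset nat} := seq_fset tt [seq nat_of_ord i | i <- enum 'I_m & lshift m i \notin Q].
pose Xi : {fset nat} := seq_fset tt [seq nat_of_ord i | i <- enum 'I_m & rshift m i \in Q].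
have OmP (i : 'I_m) : (nat_of_ord i \in Om) = (lshift m i \notin Q).
  by rewrite seq_fsetE (mem_map val_inj) mem_filter mem_enum andbT.
have XiP (i : 'I_m) : (nat_of_ord i \in Xi) = (rshift m i \in Q).
  by rewrite seq_fsetE (mem_map val_inj) mem_filter mem_enum andbT.
have bd : bounded m Om Xi.
  by split=> i; rewrite seq_fsetE => /mapP[j _ ->].
have PQ : pivots m Om Xi = Q.
  apply/setP => k; rewrite inE -[k]fintype.splitK; case: (fintype.split k) => i /=.
    by rewrite kcoord_l /= OmP negbK.
  by rewrite kcoord_r /= XiP.
exists Om, Xi; split=> //.
  by have := card_pivots bd; rewrite PQ Qm => /addnI.
pose B := rowsub f A^T; have Bu : B \in unitmx by exact: fullrowsub_unit.
have BE (w : 'rV_m) i : (w *m B^T) 0 i = (w *m A) 0 (f i).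
  by rewrite !mxE; apply: eq_bigr => k _; rewrite !mxE.
split=> [u Lu uW|x].
  have uU := chartW_inU bd uW; have := shadow_mem Lu uU; rewrite AP => /submxP[w wE].
  apply: LK => //; split=> //; rewrite wE; suff -> : w = 0 by rewrite mul0mx.
  have BTu : B^T \in unitmx by rewrite unitmx_tr.
  rewrite -[w](mulmxK BTu); suff -> : w *m B^T = 0 by rewrite mul0mx.
  apply/rowP => i; rewrite BE -wE coordsE [RHS]mxE.
  have : f i \in pivots m Om Xi by rewrite PQ imset_f ?inE.
  by rewrite inE; move/chartWP : uW; apply.
have [u Lu uU] := LU x.
pose t : 'rV[F]_m := \row_i coords m (x - u) 0 (f i).
pose w := t *m invmx B^T.
have : w *m A \in shadow m L by rewrite AP submxMl.
move=> /shadowP[u' [Lu' uU'] uA]; exists (u + u'); first exact: subD.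
rewrite opprD addrA; apply: (pivots_chartW bd); first exact: (subB (@subU F m)).
move=> k; rewrite PQ => /imsetP[i _ ->].
rewrite [coords m _]linearB /= mxE [X in _ + X]mxE uA -BE mulmxKV ?unitmx_tr//.
have -> : t 0 i = coords m (x - u) 0 (f i) by rewrite mxE.
by rewrite subrr.
Qed.

(** The complement W[Om, Xi] of L found at level m serves at all higher levels. *)
Lemma good_mono m N L : is_subspace L -> (m <= N)%N -> good m L -> good N L.
Proof.
move=> Ls mN /(good_transversal Ls)[Om [Xi [[bO bX] OX tL]]].
apply: (transversal_good _ OX Ls tL); split=> i iA; apply: leq_trans mN; [exact: bO|exact: bX].
Qed.

End GoodCharts.

(** * Points of the Grassmannian are good subspaces *)

Section Grassmannian.
Variable F : finFieldType.
Implicit Types (u v x : ellsum F) (m n N : nat) (L M : set (ellsum F)) (Om Xi : {fset nat}).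

Lemma ex_inU u : exists m, inU m u.
Proof.
exists (\max_(i <- fset_set [set i | u.1 i != 0%R]) i.+1)%N => i mi.
apply/eqP/negPn/negP => ui; move: mi; rewrite leqNgt => /negP; apply.
apply: (@leq_bigmax_seq _ _ xpredT (fun i => i.+1)) => //.
by rewrite in_fset_set ?inE//; exact: fsupp_ell.
Qed.

Lemma ex_inU_fam (I : finType) (b : I -> ellsum F) : exists m, forall i, inU m (b i).
Proof.
have /choice[f fP] : forall i, exists m, inU m (b i) by move=> i; exact: ex_inU.
by exists (\max_i f i)%N => i; apply: inU_mono (fP i); exact: leq_bigmax.
Qed.

Lemma inK_all u : (forall m, inK m u) -> u = 0.
Proof.
move=> uK; apply: space_eq => -[i|j]; rewrite ecoord0 /=.
  by have /inKP[-> _] := uK 0%N.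
by have /inKP[_ ->] := uK j.+1.
Qed.

(** L has at most one vector in l^diamond for each index c, hence finitely many,
    and each nonzero one is outside K_m for m large. *)
Lemma inK_bigcap_eq0 L (I : finType) (p : ellsum F -> I -> Prop) :
  is_subspace L -> (forall u, L u -> exists c, p u c) ->
  (forall u v c, L u -> L v -> p u c -> p v c -> inK 0 u -> inK 0 v -> u = v) ->
  exists m, forall u, L u -> inK m u -> u = 0.
Proof.
move=> Ls pL pinj.
have /choice[f fP] : forall c, exists m, forall u, L u -> p u c -> inK m u -> u = 0.
  move=> c; have [[u [Lu puc u0 uK]]|no] := pselect (exists u, [/\ L u, p u c, u <> 0 & inK 0 u]).
    have [m mu] : exists m, ~ inK m u.
      by apply/existsNP => uK'; apply: u0; exact: inK_all.
    exists m => v Lv pvc vK; exfalso; apply: mu.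
    by rewrite (pinj u v c)//; exact: inK_mono vK.
  exists 0%N => u Lu puc uK; apply: contrapT => u0; apply: no; by exists u.
exists (\max_c f c)%N => u Lu uK; have [c puc] := pL u Lu.
by apply: (fP c) => //; apply: inK_mono uK; exact: leq_bigmax.
Qed.

(** Dimensions of quotients become ratios of cardinalities of shadows. *)
Lemma sub_is_qdim_card m n (X Y : set (ellsum F)) (b : 'I_n -> ellsum F) :
  is_subspace X -> is_subspace Y -> Y `<=` X ->
  (forall i, X (b i)) -> (forall i, inU m (b i)) ->
  (forall u, X u -> exists! c : {ffun 'I_n -> F}, Y (u - \sum_i c i *: b i)) ->
  (forall u, X u -> inK m u -> u = 0) ->
  #|shadow m X| = (#|F| ^ n * #|shadow m Y|)%N.
Proof.
move=> Xs Ys YX Xb Ub XY XK; pose beta (c : {ffun 'I_n -> F}) := \sum_i c i *: b i.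
have Xbeta c : X (beta c) by apply: (sub_sum Xs) => i _; exact: (subZ Xs).
have Ubeta c : inU m (beta c).
  by apply: (sub_sum (@subU F m)) => i _; exact: (subZ (@subU F m)).
have -> : (#|F| ^ n)%N = #|{ffun 'I_n -> F}| by rewrite card_ffun card_ord.
apply: (@card_image_fibers _ _ (coords m) (X `&` inU m) (Y `&` inU m) _ _ _ beta).
- by move=> w; rewrite shadowP.
- by move=> w; rewrite shadowP.
- by move=> u v [Xu uU] [Xv vU]; split; [exact: (subB Xs)|exact: (subB (@subU F m))].
- by move=> u v [Xu uU] [Xv vU]; split; [exact: (subB Ys)|exact: (subB (@subU F m))].
- by move=> u [/YX].
- by [].
- move=> u [Xu uU]; have [c [Yc _]] := XY u Xu.
  by exists c; split=> //; apply: (subB (@subU F m)).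
- move=> c d [Ycd _]; have [e [_ eu]] := XY _ (Xbeta c).
  have <- : e = c by apply: eu; rewrite -/(beta c) subrr; exact: sub0.
  by apply: eu; rewrite -/(beta d).
- move=> u [Xu uU] u0; rewrite (XK u)//.
  by split; [exact: sub0|exact: inU0].
Qed.

Lemma opgraph_inK T u : opgraph T u -> inK 0 u -> u = 0 :> ellsum F.
Proof.
move=> /graphP uT /inKP[u1 _]; apply: space_eq => -[i|j]; rewrite ecoord0 /=; first exact: u1.
by rewrite uT fsbig1// => i _; rewrite u1 mul0r.
Qed.

Lemma good0P L : is_subspace L ->
  good 0 L <-> transversal L (fun u => forall i, u.1 i = 0).
Proof.
move=> Ls; split=> [[LK LU _]|[LK LU]]; split.
- by move=> u Lu u1; apply: LK => //; apply/inKP.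
- by move=> x; have [u Lu uU] := LU x; exists u => // i; exact: uU.
- by move=> u Lu /inKP[u1 _]; exact: LK.
- by move=> x; have [u Lu uU] := LU x; exists u => // i _; exact: uU.
- rewrite expn0; have [t0 _] := shadow_subspace 0 Ls.
  apply/eqP/cards1P; exists 0; apply/setP => w; rewrite finset.in_set1.
  by apply/idP/eqP => [_|->//]; apply/rowP => -[].
Qed.

Lemma opgraph_good0 T : good 0 (@opgraph F T).
Proof.
apply/good0P; first exact: graph_sub.
split=> [u Lu u1|x]; first by apply: (opgraph_inK Lu); apply/inKP.
exists (x.1, mulvT x.1 T); first by exists x.1.
by move=> i; rewrite -[LHS]/(ecoord (x - _) (inl i)) ecoordB /= subrr.
Qed.

(** A graph L is good at every level, and L and M have the same codimension over
    L cap M. Once m is so large that U_m contains representatives of both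
    quotients and K_m avoids M, the shadows of L and M have equally many elements. *)
Lemma gr0_good M : is_gr0 M -> exists m, good m M.
Proof.
move=> [[Ms _] [L [n [[T _ LT] [bL [bLL bLP]] [bM [bMM bMP]]]]]].
have Ls : is_subspace L by rewrite -LT; exact: graph_sub.
have Ns : is_subspace (L `&` M) by exact: subI.
have L0 : good 0 L by rewrite -LT; exact: opgraph_good0.
have [m1 bL1] := ex_inU_fam bL; have [m2 bM1] := ex_inU_fam bM.
have [m3 MK] : exists m, forall u, M u -> inK m u -> u = 0.
  apply: (@inK_bigcap_eq0 _ _ (fun u (c : {ffun 'I_n -> F}) =>
    (L `&` M) (u - \sum_i c i *: bM i))) => //.
    by move=> u /bMP[c [cP _]]; exists c.
  move=> u v c Mu Mv uc vc uK vK; apply/eqP; rewrite -subr_eq0; apply/eqP.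
  have [+ _ _] := L0; apply; last exact: (subB (@subK F 0)).
  by have := subB Ns uc vc; rewrite opprB addrA subrK => -[].
pose m := (m1 + m2 + m3)%N; exists m.
have {bL1}bLU i : inU m (bL i) by apply: inU_mono (bL1 i); rewrite /m -addnA leq_addr.
have {bM1}bMU i : inU m (bM i).
  by apply: inU_mono (bM1 i); rewrite /m addnAC addnC leq_addr.
have {}MK u : M u -> inK m u -> u = 0.
  by move=> Mu uK; apply: MK => //; apply: inK_mono uK; rewrite /m leq_addl.
have [LK LU Lc] : good m L by apply: good_mono L0.
split=> // [x|]; last first.
  have NL : L `&` M `<=` L by move=> ? [].
  have NM : L `&` M `<=` M by move=> ? [].
  rewrite (sub_is_qdim_card Ms Ns NM bMM bMU bMP)//.
  by rewrite -(sub_is_qdim_card Ls Ns NL bLL bLU bLP).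
have [v Lv vU] := LU x; have [c [[_ Mc] _]] := bLP v Lv.
exists (v - \sum_i c i *: bL i) => //; rewrite opprB addrCA addrC.
apply: (subD (@subU F m)) => //.
by apply: (sub_sum (@subU F m)) => i _; exact: (subZ (@subU F m)).
Qed.

Lemma good_chart m L : is_subspace L -> good m L ->
  exists Om Xi (OX : #|` Om| = #|` Xi|) (T : Fprod F (rows Om Xi * cols Om Xi)),
    bounded m Om Xi /\ L = chart_graph T.
Proof.
move=> Ls /(good_transversal Ls)[Om [Xi [bd OX /(transversal_chart Ls)[T LT]]]].
by exists Om, Xi, OX, T.
Qed.

Lemma good_gr0 m L : is_subspace L -> good m L -> is_gr0 L.
Proof. by move=> Ls /(good_chart Ls)[Om [Xi [OX [T [_ ->]]]]]; exact: chart_gr0. Qed.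

Lemma gr0_sub (M : Gr0 F) : is_subspace (val M).
Proof. by have /set_mem[[]] := valP M. Qed.

Lemma gr0_ex_good (M : Gr0 F) : exists m, good m (val M).
Proof. by apply: gr0_good; exact/set_mem/(valP M). Qed.

Lemma chart_good m Om Xi (T : Fprod F (rows Om Xi * cols Om Xi)) :
  #|` Om| = #|` Xi| -> bounded m Om Xi -> good m (chart_graph T).
Proof.
move=> OX bd; apply: (transversal_good bd OX); first exact: chart_graph_sub.
exact: chart_transversal.
Qed.

(** The shadow of level N remembers L cap U_N up to K_N. *)
Lemma shadow_lift N L L' u : shadow N L = shadow N L' -> L u -> inU N u ->
  exists u', [/\ L' u', inU N u' & inK N (u - u')].
Proof.
move=> LL' Lu uU; have := shadow_mem Lu uU; rewrite LL' => /shadowP[u' [Lu' uU'] uu'].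
exists u'; split=> //; split; first exact: (subB (@subU F N)).
by rewrite linearB /= uu' subrr.
Qed.

(** Whether L is transversal to a subspace between K_N and U_N is visible in the
    shadow of level N: a vector of L' can be replaced by one of L up to K_N. This
    applies to K_m, U_m with m <= N and to the complements W[Om, Xi]. *)
Lemma shadow_disjoint N L L' J : good N L' -> is_subspace J -> inK N `<=` J -> J `<=` inU N ->
  shadow N L = shadow N L' -> (forall u, L u -> J u -> u = 0) -> forall u, L' u -> J u -> u = 0.
Proof.
move=> [LK' _ _] Js KJ JU LL' LJ u Lu uJ.
have [u' [Lu' uU' uuK]] := shadow_lift (esym LL') Lu (JU _ uJ).
apply: LK' => //; suff u'0 : u' = 0 by move: uuK; rewrite u'0 subr0.
by apply: LJ => //; rewrite -[u'](subKr u); apply: (subB Js) => //; exact: KJ.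
Qed.

Lemma shadow_span N L L' J : good N L' -> is_subspace L' -> is_subspace J ->
  inK N `<=` J -> J `<=` inU N -> shadow N L = shadow N L' ->
  (forall x, exists2 u, L u & J (x - u)) -> forall x, exists2 u, L' u & J (x - u).
Proof.
move=> [_ LU' _] Ls' Js KJ JU LL' LJ x.
have [u Lu uU] := LU' x; have [y Ly yJ] := LJ (x - u).
have yU : inU N y by rewrite -[y](subKr (x - u)); apply: (subB (@subU F N)) => //; exact: JU.
have [y' [Ly' yU' yyK]] := shadow_lift LL' Ly yU.
exists (u + y'); first exact: subD.
have -> : x - (u + y') = (x - u - y) + (y - y') by rewrite addrA subrK opprD addrA.
by apply: (subD Js) => //; exact: KJ.
Qed.

Lemma shadow_sub m N L L' : (m <= N)%N -> shadow N L = shadow N L' -> shadow m L \subset shadow m L'.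
Proof.
move=> mN LL'; apply/fintype.subsetP => w /shadowP[u [Lu uU] <-].
have [u' [Lu' uU' uuK]] := shadow_lift LL' Lu (inU_mono mN uU).
have uuK' := inK_mono mN uuK.
have -> : coords m u = coords m u' by apply/eqP; rewrite -subr_eq0 -linearB; apply/eqP; case: uuK'.
apply: shadow_mem => //; rewrite -[u'](subKr u); apply: (subB (@subU F m)) => //.
by case: uuK'.
Qed.

(** A point that is good at level N is known at all lower levels once its shadow
    of level N is known. *)
Lemma shadow_refine m N L L' : (m <= N)%N -> is_subspace L' -> good N L' ->
  shadow N L = shadow N L' -> good m L -> good m L' /\ shadow m L = shadow m L'.
Proof.
move=> mN Ls' gN LL' [LK LU Lc].
have e : shadow m L = shadow m L'.
  by apply/eqP; rewrite finset.eqEsubset !(shadow_sub mN)// LL'.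
split=> //; split; last by rewrite -e.
- apply: (shadow_disjoint gN (@subK F m)) LL' LK => u; first exact: inK_mono.
  by move/inKU.
- apply: (shadow_span gN Ls' (@subU F m)) LL' LU => u; last exact: inU_mono.
  by move/inKU.
Qed.

(** Equality of the finitely many entries whose indices are smaller than N. *)
Definition agree N Om Xi (T T' : Fprod F (rows Om Xi * cols Om Xi)) :=
  forall xy : rows Om Xi * cols Om Xi,
    (exists k : 'I_(N + N), kcoord k = val xy.1) ->
    (exists k : 'I_(N + N), kcoord k = val xy.2) -> T xy = T' xy.

Lemma kcoordP N z : (exists k : 'I_(N + N), kcoord k = z) <->
  match z with inl i => (i < N)%N | inr j => (j < N)%N end.
Proof.
split=> [[k <-]|]; first by rewrite /kcoord; case: fintype.split => i.
case: z => i iN; first by exists (lshift N (Ordinal iN)); rewrite kcoord_l.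
by exists (rshift N (Ordinal iN)); rewrite kcoord_r.
Qed.

(** Replacing T by T' changes a vector of the graph in U_N only in coordinates that
    K_N leaves free. *)
Lemma shadow_chart_sub N Om Xi (T T' : Fprod F (rows Om Xi * cols Om Xi)) :
  bounded N Om Xi -> agree N T T' ->
  shadow N (chart_graph T) \subset shadow N (chart_graph T').
Proof.
move=> bd TT'; apply/fintype.subsetP => w /shadowP[u [/chart_graphP uT uU] <-].
have [v vE] := ex_glue Om Xi u (fun z => if insub z is Some y then rsum T' u y else 0).
have rE (y : cols Om Xi) : rsum T' v y = rsum T' u y.
  by apply: eq_fsbigr => x _; rewrite vE; have -> := valP x.
have vK : inK N (u - v).
  apply/inKP; suff H z : (if z is inr j then (j < N)%N else true) -> ecoord (u - v) z = 0.
    by split=> i; [exact: (H (inl i))|exact: (H (inr i))].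
  move=> zN; rewrite ecoordB vE; case: ifPn => zr; first by rewrite subrr.
  case: insubP => [y _ yz|]; last by rewrite zr.
  have -> : ecoord u z = rsum T u y by rewrite -yz uT.
  apply/eqP; rewrite subr_eq0; apply/eqP; apply: eq_fsbigr => x _.
  have [uz|uz] := eqVneq (ecoord u (val x)) 0; first by rewrite uz !mul0r.
  congr (_ * _); apply: TT'; apply/kcoordP => /=.
    case: x uz => -[i|j] /= xr uz; last by case: bd => _; apply.
    by rewrite ltnNge; apply: contra_neqN uz => /uU.
  rewrite [val y]yz; case: (z) zN zr => [i|//] _ /=; rewrite negbK.
  by case: bd => + _; apply.
have vU : inU N v by rewrite -[v](subKr u); apply: (subB (@subU F N)) => //; exact: inKU vK.
have -> : coords N u = coords N v by apply/eqP; rewrite -subr_eq0 -linearB; apply/eqP; case: vK.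
apply: shadow_mem => //; apply/chart_graphP => y; rewrite rE vE (negPf (valP y)) valK.
by [].
Qed.

Lemma shadow_chart N Om Xi (T T' : Fprod F (rows Om Xi * cols Om Xi)) :
  bounded N Om Xi -> agree N T T' -> shadow N (chart_graph T) = shadow N (chart_graph T').
Proof.
move=> bd TT'; apply/eqP; rewrite finset.eqEsubset !(shadow_chart_sub bd)//.
by move=> xy x y; rewrite TT'.
Qed.

(** The entry T (x, y) with x, y < N is a coordinate of the vector over the basis
    vector with index x; this vector lies in U_N, so that its coordinates of index
    smaller than N are visible in the shadow. *)
Lemma shadow_chart_agree N Om Xi (T T' : Fprod F (rows Om Xi * cols Om Xi)) :
  bounded N Om Xi -> shadow N (chart_graph T) = shadow N (chart_graph T') -> agree N T T'.
Proof.
move=> bd LT -[x y] /kcoordP/= xN /kcoordP/= yN.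
have [e eE] : exists e : ellsum F, forall z, ecoord e z = (z == val x)%:R.
  have [|v vE] := @ex_ell F (fun i => (inl i == val x)%:R).
    apply: (@sub_finite_set _ _ (inl @^-1` [set val x])).
      by move=> i /=; case: (inl i =P sval x) => // _; rewrite eqxx.
    by apply: finite_preimage; [move=> ? ? _ _ []|exact: finite_set1].
  by exists (v, fun j => (inr j == val x)%:R) => -[i|j] /=; rewrite ?vE.
have rowcoord (S : Fprod F (rows Om Xi * cols Om Xi)) u : chart_graph S u ->
    (forall z, in_row Om Xi z -> ecoord u z = (z == val x)%:R) -> ecoord u (val y) = S (x, y).
  move=> /chart_graphP uS ux; rewrite uS /rsum (@fsum_eq1 _ _ _ x) => [|k kx].
    by rewrite ux ?eqxx ?mul1r//; exact: (valP x).
  by rewrite ux ?(valP k)// -[_ == _]/(val k == val x) (inj_eq val_inj) (negPf kx) mul0r.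
have [_ /(_ e)[u uT /[dup] /chartWP eu euW]] := chart_transversal T.
have ux z : in_row Om Xi z -> ecoord u z = (z == val x)%:R.
  by move=> zr; have /eqP := eu z zr; rewrite ecoordB subr_eq0 eE => /eqP <-.
have uU : inU N u.
  rewrite -[u](subKr e); apply: (subB (@subU F N)); last exact: chartW_inU bd euW.
  move=> i Ni; rewrite -[LHS]/(ecoord e (inl i)) eE; case: eqP => // xi.
  by move: xN; rewrite -[sval x]/(val x) -xi ltnNge Ni.
have [u' [Lu' uU' uuK]] := shadow_lift LT uT uU.
have := rowcoord T u uT ux; rewrite -(rowcoord T' u').
- move=> <-; have : ecoord (u - u') (val y) = 0.
    have /inKP[k1 k2] := uuK; move: yN; rewrite -[sval y]/(val y).
    by case: (val y) => [i _|j jN]; [exact: k1|exact: k2].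
  by move/eqP; rewrite ecoordB subr_eq0 => /eqP.
- by [].
- move=> z zr; rewrite -ux//; apply/esym/eqP; rewrite -subr_eq0 -ecoordB; apply/eqP.
  by have /chartWP := inK_chartW bd uuK; apply.
Qed.

Lemma shadow_chart_inj N Om Xi (T : Fprod F (rows Om Xi * cols Om Xi)) L :
  bounded N Om Xi -> is_subspace L -> good N L -> shadow N L = shadow N (chart_graph T) ->
  exists2 T' : Fprod F (rows Om Xi * cols Om Xi), L = chart_graph T' & agree N T T'.
Proof.
move=> bd Ls gN LT; have [T' LT'] : exists T' : Fprod F (rows Om Xi * cols Om Xi), L = chart_graph T'.
  apply: transversal_chart => //; have [CJ CV] := chart_transversal T.
  have KJ : inK N `<=` chartW (F := F) Om Xi by move=> u; exact: inK_chartW.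
  have JU : chartW (F := F) Om Xi `<=` inU N by move=> u; exact: chartW_inU.
  split; first exact: (shadow_disjoint gN (sub_chartW F Om Xi) KJ JU (esym LT) CJ).
  exact: (shadow_span gN Ls (sub_chartW F Om Xi) KJ JU (esym LT) CV).
by exists T' => //; apply: shadow_chart_agree => //; rewrite -LT LT'.
Qed.

End Grassmannian.

(** * Cylinders generate the Borel sets *)

Section ProductTopology.
Variables (F : finFieldType) (I : choiceType).
Implicit Types (T : Fprod F I) (B : set (Fprod F I)).

Lemma nbhs_coords (s : seq I) T : nbhs T [set T' | forall k, k \in s -> T' k = T k].
Proof.
elim: s => [|k s IH]; first by apply: filterS filterT.
have Tk : nbhs T [set T' : Fprod F I | T' k = T k].
  exact: (@proj_continuous I (fun=> discrete_topology F) k T _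
    (discrete_set1 (T k : discrete_topology F))).
apply: filterS (filterI Tk IH) => T' [Tk' Ts] l.
by rewrite inE => /orP[/eqP ->|/Ts].
Qed.

Lemma open_coords (s : seq I) B :
  (forall T T', (forall k, k \in s -> T k = T' k) -> B T -> B T') -> open B.
Proof.
move=> Bs; rewrite openE => T BT; apply: filterS (nbhs_coords s T) => T' T'T.
by apply: Bs BT => k ks; rewrite T'T.
Qed.

(** Used in contrapositive form: points outside an open set cannot agree with one of its
    points T in more and more coordinates, so that finitely many coordinates
    determine a neighbourhood of T. *)
Lemma open_ev B T (T_ : nat -> Fprod F I) : open B -> B T ->
  (forall k, exists n, forall i, (n <= i)%N -> T_ i k = T k) -> exists n, B (T_ n).
Proof.
move=> oB BT T_T; have Tcvg : T_ @ \oo --> T.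
  apply/cvg_sup => k U [V] [[W] oW <-] WT WU.
  apply: (filterS WU); rewrite nbhs_simpl; have [n nT] := T_T k.
  by exists n => // i /= /nT ->.
have /Tcvg : nbhs T B by exact: open_nbhs_nbhs.
by rewrite nbhs_simpl => -[n _ /(_ n (leqnn n))]; exists n.
Qed.

Lemma compact_fprod : compact [set: Fprod F I].
Proof.
have := @tychonoff I (fun=> discrete_topology F) (fun=> setT).
rewrite (_ : [set f | _] = setT); last by apply/seteqP; split.
apply => _; apply: finite_compact; exact: finite_finset.
Qed.

End ProductTopology.

Section Cylinders.
Variable F : finFieldType.
Implicit Types (m n N : nat) (A B : set (Gr0 F)) (L : Gr0 F) (Om Xi : {fset nat}).

Definition goodset N : set (Gr0 F) := [set L | good N (val L)].

(** The level-N cylinders are the unions of fibres of the shadow map of level N on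
    the points that are good at that level. *)
Definition cylinder N A := A `<=` goodset N /\
  forall L L', goodset N L -> goodset N L' -> shadow N (val L) = shadow N (val L') -> A L -> A L'.

Lemma goodset_mono m N : (m <= N)%N -> goodset m `<=` goodset N.
Proof. by move=> mN L; apply: good_mono => //; exact: gr0_sub. Qed.

Lemma bigcup_goodset : \bigcup_n goodset n = setT.
Proof.
by apply/seteqP; split=> // L _; have [m mL] := gr0_ex_good L; exists m.
Qed.

Lemma cylinder_mono m N A : (m <= N)%N -> cylinder m A -> cylinder N A.
Proof.
move=> mN [Am AL]; split; first by apply: subset_trans (goodset_mono mN).
move=> L L' gL gL' LL' A_L; have gmL := Am _ A_L.
have [gmL' e] := shadow_refine mN (gr0_sub L') gL' LL' gmL.
exact: AL A_L.
Qed.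

Lemma cylinder_good N : cylinder N (goodset N). Proof. by split. Qed.

Lemma cylinder0 N : cylinder N set0. Proof. by split. Qed.

Lemma cylinderU N A B : cylinder N A -> cylinder N B -> cylinder N (A `|` B).
Proof.
move=> [AN AL] [BN BL]; split=> [L [/AN|/BN]//|L L' gL gL' LL' [/(AL L L')|/(BL L L')]].
  by move=> h; left; exact: h.
by move=> h; right; exact: h.
Qed.

Lemma cylinderD N A B : cylinder N A -> cylinder N B -> cylinder N (A `\` B).
Proof.
move=> [AN AL] [BN BL]; split=> [L [/AN]//|L L' gL gL' LL' [A_L nB_L]].
split; first exact: AL A_L.
by move=> BL'; apply: nB_L; exact: (BL L' L gL' gL (esym LL')).
Qed.

Lemma cylinderI N A B : cylinder N A -> cylinder N B -> cylinder N (A `&` B).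
Proof. by move=> cA cB; rewrite -setDD; apply: cylinderD => //; exact: cylinderD. Qed.

Definition is_cylinder : set (set (Gr0 F)) := [set A | exists N, cylinder N A].

Lemma ex_bounded Om Xi : exists n0, bounded n0 Om Xi.
Proof.
exists (\max_(i <- Om) i.+1 + \max_(j <- Xi) j.+1)%N.
split=> i iA; [apply: leq_trans (leq_addr _ _)|apply: leq_trans (leq_addl _ _)];
  exact: (@leq_bigmax_seq _ _ xpredT (fun i => i.+1)).
Qed.

Lemma bounded_mono m N Om Xi : (m <= N)%N -> bounded m Om Xi -> bounded N Om Xi.
Proof.
by move=> mN [bO bX]; split=> i iA; apply: leq_trans mN; [exact: bO|exact: bX].
Qed.

(** Agreement to level N is a condition on finitely many entries. *)
Lemma agree_seq N Om Xi : exists s : seq (rows Om Xi * cols Om Xi),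
  forall T T' : Fprod F (rows Om Xi * cols Om Xi),
    (forall k, k \in s -> T k = T' k) -> agree N T T'.
Proof.
pose I := 'I_(N + N).
pose f (kl : I * I) : option (rows Om Xi * cols Om Xi) :=
  if (insub (kcoord kl.1), insub (kcoord kl.2)) is (Some x, Some y) then Some (x, y) else None.
exists (pmap f (enum {: I * I})) => T T' TT' [x y] [k /= kx] [l ly]; apply: TT'.
by rewrite mem_pmap; apply/mapP; exists (k, l); rewrite ?mem_enum// /f /= kx ly !valK.
Qed.

(** In the coordinates of a chart, a cylinder is a condition on finitely many matrix
    entries. *)
Lemma open_chart N Om Xi (OX : #|` Om| = #|` Xi|) A :
  cylinder N A -> open (chart (F := F) OX @^-1` A).
Proof.
move=> cA; have [n bn] := ex_bounded Om Xi.
have {cA} [_ cA] := cylinder_mono (leq_addr n N) cA.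
have {}bn : bounded (N + n) Om Xi by apply: bounded_mono bn; exact: leq_addl.
have [s sP] := agree_seq (N + n) Om Xi.
apply: (open_coords (s := s)) => T T' /sP TT'; apply: cA; [exact: chart_good..|].
exact: shadow_chart.
Qed.

Lemma measurable_cylinder A : is_cylinder A -> measurable A.
Proof.
move=> [N cA]; rewrite -[measurable A]/(gr_borel A) => Om Xi OX.
by apply: sub_sigma_algebra; exact: open_chart cA.
Qed.

Lemma agree_trans N Om Xi (T T' T'' : Fprod F (rows Om Xi * cols Om Xi)) :
  agree N T T' -> agree N T' T'' -> agree N T T''.
Proof. by move=> h h' xy x y; rewrite h// h'. Qed.
Lemma agree_ev Om Xi (xy : rows Om Xi * cols Om Xi) :
  exists n, forall N, (n <= N)%N -> forall T T' : Fprod F (rows Om Xi * cols Om Xi),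
    agree N T T' -> T xy = T' xy.
Proof.
pose h (z : nat + nat) := match z with inl i => i.+1 | inr j => j.+1 end.
exists (h (val xy.1) + h (val xy.2))%N => N hN T T'; apply; apply/kcoordP.
  by have := leq_trans (leq_addr _ _) hN; case: (val xy.1).
by have := leq_trans (leq_addl _ _) hN; case: (val xy.2).
Qed.

(** Conversely, conditions on finitely many entries define cylinders. *)
Lemma cylinder_chart N Om Xi (OX : #|` Om| = #|` Xi|) (B : set (Fprod F (rows Om Xi * cols Om Xi))) :
  bounded N Om Xi -> (forall T T', agree N T T' -> B T -> B T') ->
  cylinder N (chart OX @` B).
Proof.
move=> bd BN; split=> [_ [T BT <-]|L L' _ gL' TL' [T BT TL]].
  exact: chart_good.
move: TL'; rewrite -TL /= => /esym TL'.
have [T' L'T' TT'] := shadow_chart_inj bd (gr0_sub L') gL' TL'.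
by exists T'; [exact: BN TT' BT|apply: val_inj].
Qed.

Lemma chart_inj Om Xi (OX : #|` Om| = #|` Xi|) : injective (chart (F := F) OX).
Proof.
move=> T T' /(congr1 val) /= TT'; apply/funext => xy.
have [n nP] := agree_ev xy; have [n0 bn0] := ex_bounded Om Xi.
apply: (nP (n0 + n)%N (leq_addl _ _)).
by apply: shadow_chart_agree; [exact: bounded_mono (leq_addr _ _) bn0|rewrite TT'].
Qed.

(** For B open, let B_n be the set of matrices all of whose modifications beyond
    level n stay in B. The B_n exhaust B and their images are cylinders. Injectivity
    of the chart deals with complements. *)
Lemma sigma_chart Om Xi (OX : #|` Om| = #|` Xi|) (B : set (Fprod F (rows Om Xi * cols Om Xi))) :
  measurable B -> <<s is_cylinder>> (chart OX @` B).
Proof.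
have [n0 bn0] := ex_bounded Om Xi.
have chT : <<s is_cylinder>> (chart (F := F) OX @` setT).
  by apply: sub_sigma_algebra; exists n0; exact: cylinder_chart.
pose G := [set B : set (Fprod F (rows Om Xi * cols Om Xi)) | <<s is_cylinder>> (chart OX @` B)].
move: B; apply: (@smallest_sub _ _ _ G); first split.
- by rewrite /G/= image_set0; exact: sigma_algebra0.
- move=> B GB; rewrite /G/= setTD (_ : _ @` _ = chart OX @` setT `\` chart OX @` B).
    exact: (@measurableD _ (g_sigma_algebraType is_cylinder)).
  apply/seteqP; split=> [_ [T nBT <-]|_ [[T _ <-] nBT]].
    by split; [exists T|move=> [T' BT' /chart_inj e]; apply: nBT; rewrite -e].
  by exists T => // BT; apply: nBT; exists T.
- by move=> B GB; rewrite /G/= image_bigcup; exact: sigma_algebra_bigcup.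
move=> B oB; rewrite /G/=.
pose B_ n := [set T | forall T', agree n T T' -> B T'].
have -> : B = \bigcup_n B_ (n0 + n)%N.
  apply/seteqP; split=> [T BT|T [n _]]; last by apply.
  apply: contrapT => noT.
  have /choice[T_ T_P] : forall n, exists T', agree (n0 + n) T T' /\ ~ B T'.
    move=> n; apply: contrapT => no; apply: noT; exists n => // T' TT'.
    by apply: contrapT => nB; apply: no; exists T'.
  have [|n] := @open_ev F _ _ T T_ oB BT; last by have [] := T_P n.
  move=> xy; have [n nP] := agree_ev xy; exists n => i ni.
  by apply/esym; apply: (nP (n0 + i)%N); [exact: leq_trans ni (leq_addl _ _)|have [] := T_P i].
rewrite image_bigcup; apply: sigma_algebra_bigcup => n; apply: sub_sigma_algebra.
exists (n0 + n)%N; apply: cylinder_chart => [|T T' TT' BT T'' T'T''].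
  exact: bounded_mono (leq_addr _ _) bn0.
by apply: BT; exact: agree_trans TT' T'T''.
Qed.

(** Cylinders are open in every chart; conversely a Borel set is the union of its
    traces on the countably many charts. *)
Lemma gr_borelE : @measurable _ (Gr0 F) = <<s is_cylinder>>.
Proof.
apply/seteqP; split=> A; last first.
  apply: smallest_sub => [|B]; first exact: sigma_algebra_measurable.
  exact: measurable_cylinder.
move=> mA.
pose C (OX : {fset nat} * {fset nat}) : set (Gr0 F) :=
  [set L | A L /\ #|` OX.1| = #|` OX.2| /\
    exists T : Fprod F (rows OX.1 OX.2 * cols OX.1 OX.2), val L = chart_graph T].
have -> : A = \bigcup_n (if (choice.unpickle n : option ({fset nat} * {fset nat})) is Some OX then C OX else set0).
  apply/seteqP; split=> [L AL|L [n _]]; last by case: (choice.unpickle n) => [OX [] //|//].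
  have [m mL] := gr0_ex_good L.
  have [Om [Xi [OX [T [bd LT]]]]] := good_chart (gr0_sub L) mL.
  exists (choice.pickle (Om, Xi)) => //; rewrite choice.pickleK; split=> //=; split=> //.
  by exists T.
apply: sigma_algebra_bigcup => n; case: (choice.unpickle n) => [[Om Xi]|]; last exact: sigma_algebra0.
rewrite /C /=; have [OX|OX] := pselect (#|` Om| = #|` Xi|); last first.
  by rewrite (_ : [set L | _] = set0); [exact: sigma_algebra0|apply/seteqP; split=> // L [_ []]].
rewrite (_ : [set L | _] = chart OX @` (chart OX @^-1` A)).
  by apply: sigma_chart; exact: mA.
apply/seteqP; split=> [L [AL [_ [T LT]]]|_ [T AT <-]]; last first.
  by split=> //; split=> //; exists T.
have e : chart OX T = L by exact: val_inj.
by exists T => //; rewrite /preimage/= e.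
Qed.

End Cylinders.

(** * Transitivity on flags *)

Section FlagConjugation.
Variable F : fieldType.

Lemma unit_transport n k (A B : 'M[F]_(k, n)) :
  \rank A = \rank B -> exists2 H : 'M[F]_n, H \in unitmx & (A *m H :=: B)%MS.
Proof.
move=> rAB; exists (invmx (row_ebase A) *m row_ebase B).
  by rewrite unitmx_mul unitmx_inv !row_ebase_unit.
pose E := col_ebase A *m invmx (col_ebase B).
have -> : A *m (invmx (row_ebase A) *m row_ebase B) = E *m B.
  rewrite /E -{3}[B]mulmx_ebase -{1}[A]mulmx_ebase -!mulmxA.
  by rewrite mulKVmx ?row_ebase_unit// mulKmx ?col_ebase_unit// rAB.
apply: eqmxMfull; rewrite row_full_unit /E unitmx_mul unitmx_inv.
by rewrite !col_ebase_unit.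
Qed.

(** An automorphism of C that carries A to B is extended by the identity on a
    complement, so that nothing moves modulo C. *)
Lemma unit_transport_in n (A B C : 'M[F]_n) :
  (A <= C)%MS -> (B <= C)%MS -> \rank A = \rank B ->
  exists H : 'M[F]_n, [/\ H \in unitmx, (A *m H :=: B)%MS & (H - 1%:M <= C)%MS].
Proof.
have [C0 [C0f C0E]] : exists C0 : 'M[F]_(\rank C, n), row_free C0 /\ (C0 :=: C)%MS.
  by exists (row_base C); split; [exact: row_base_free|exact: eq_row_base].
have [P C0P] : exists P, C0 *m P = 1%:M by exact/row_freeP.
move=> AC BC; have /submxP[A0 ->] : (A <= C0)%MS by rewrite C0E.
have /submxP[B0 ->] : (B <= C0)%MS by rewrite C0E.
move=> rAB.
have [|h hu hAB] := @unit_transport _ _ A0 B0.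
  by move: rAB; rewrite !mxrankMfree.
(* K g acts by g on C and by the identity on the kernel of P *)
pose K (g : 'M[F]_(\rank C)) : 'M[F]_n := 1%:M + P *m (g - 1%:M) *m C0.
have KM g g' : K g *m K g' = K (g *m g').
  rewrite /K (mulmxDl 1%:M) mul1mx (mulmxDr _ 1%:M) mulmx1 -!addrA; congr (_ + _).
  rewrite -!mulmxA (mulmxA C0 P) C0P mul1mx -!mulmxDr; congr (_ *m _).
  have -> : C0 + (g' - 1%:M) *m C0 = g' *m C0 by rewrite mulmxBl mul1mx addrC subrK.
  by rewrite !mulmxBl !mul1mx mulmxA addrC addrA subrK.
exists (K h); split.
- rewrite -row_free_unit; apply/row_freeP; exists (K (invmx h)).
  by rewrite KM mulmxV// /K subrr mulmx0 mul0mx addr0.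
- rewrite /K mulmxDr mulmx1 -!mulmxA (mulmxA C0 P) C0P mul1mx mulmxA mulmxBr mulmx1 mulmxBl.
  by rewrite addrC subrK; exact: eqmxMr.
- by rewrite /K addrC addKr -C0E submxMl.
Qed.

Lemma sub_rank_eqmx n (A B : 'M[F]_n) : (A <= B)%MS -> \rank A = \rank B -> (A :=: B)%MS.
Proof. by move=> AB rAB; apply/eqmxP; rewrite -(geq_leqif (mxrank_leqif_eq AB)) rAB. Qed.

(** The largest subspace is moved first; each later correction takes place inside a
    subspace that is already in place, hence preserves the larger ones. *)
Lemma flag_conj n (A1 A2 A3 B1 B2 B3 : 'M[F]_n) :
  (A1 <= A2)%MS -> (A2 <= A3)%MS -> (B1 <= B2)%MS -> (B2 <= B3)%MS ->
  \rank A1 = \rank B1 -> \rank A2 = \rank B2 -> \rank A3 = \rank B3 ->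
  exists H : 'M[F]_n, [/\ H \in unitmx, (A1 *m H :=: B1)%MS, (A2 *m H :=: B2)%MS &
    (A3 *m H :=: B3)%MS].
Proof.
move=> A12 A23 B12 B23 r1 r2 r3.
have fix_ (C D H : 'M[F]_n) : H \in unitmx -> (D <= C)%MS -> (H - 1%:M <= D)%MS ->
    (C *m H :=: C)%MS.
  move=> Hu DC HD; apply: sub_rank_eqmx; last by rewrite mxrankMfree ?row_free_unit.
  rewrite -[H](subrK 1%:M) mulmxDr mulmx1 addmx_sub//.
  exact: submx_trans (submxMl _ _) (submx_trans HD DC).
have [H3 H3u H3E] := unit_transport r3.
have h23 : (A2 *m H3 <= B3)%MS by rewrite -H3E submxMr.
have [|H2 [H2u H2E H2B]] := unit_transport_in h23 B23.
  by rewrite mxrankMfree ?row_free_unit.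
have A3E : (A3 *m H3 *m H2 :=: B3)%MS.
  by apply: eqmx_trans (eqmxMr _ H3E) _; exact: fix_ H2B.
have h12 : (A1 *m H3 *m H2 <= B2)%MS by rewrite -H2E !submxMr.
have [|H1 [H1u H1E H1B]] := unit_transport_in h12 B12.
  by rewrite !mxrankMfree ?row_free_unit.
exists (H3 *m H2 *m H1); rewrite !unitmx_mul H3u H2u H1u !mulmxA; split=> //.
  by apply: eqmx_trans (eqmxMr _ H2E) _; exact: fix_ H1B.
by apply: eqmx_trans (eqmxMr _ A3E) _; apply: fix_ B23 H1B.
Qed.

End FlagConjugation.

(** * Continuous operators and finite operators *)

Section Operators.
Variable F : finFieldType.
Implicit Types (u v x : ellsum F) (m n N : nat) (L M : set (ellsum F)).
Notation V := (ellsum F).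

(** The cosets of the K_m form neighbourhood bases, which makes continuity of linear
    maps a statement about the K_m alone. *)
Lemma nbhs_ellsum u (A : set V) :
  nbhs u A <-> exists m, forall v, inK m (v - u) -> A v.
Proof.
split=> [[[P Q] /= [Pu Qu] PQA]|[m mA]].
  have Pu1 : P u.1 by have := Pu; rewrite nbhs_principalE => /principal_filterP.
  have [B [oB Bu BQ]] : exists B : set (Fprod F nat), [/\ open B, B u.2 & B `<=` Q].
    by move: Qu; rewrite nbhsE => -[B [oB Bu] BQ]; exists B.
  apply: contrapT => no.
  have /choice[v_ v_P] : forall m, exists v, inK m (v - u) /\ ~ A v.
    move=> m; apply: contrapT => nv; apply: no; exists m => v vK.
    by apply: contrapT => nA; apply: nv; exists v.
  have v1 m : (v_ m).1 = u.1.
    have [/inKP[v1 _] _] := v_P m; apply/val_inj/funext => i.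
    by apply/eqP; rewrite -subr_eq0; apply/eqP/(v1 i).
  have [|m Bm] := @open_ev F nat B u.2 (fun m => (v_ m).2) oB Bu.
    move=> k; exists k.+1 => i ki; have [/inKP[_ v2] _] := v_P i.
    by apply/eqP; rewrite -subr_eq0; apply/eqP/(v2 k).
  have [_] := v_P m; apply; apply: PQA; split; [by rewrite /= v1|exact: BQ].
exists ([set u.1], [set w | forall k, k \in iota 0 m -> w k = u.2 k]) => /=.
  split; first by rewrite nbhs_principalE; exact/principal_filterP.
  exact: (@nbhs_coords F nat).
move=> [v1 v2] [/= -> v2u]; apply: mA; apply/inKP; split=> [i|j jm].
  by rewrite -[LHS]/(u.1 i - u.1 i) subrr.
by rewrite -[LHS]/(v2 j - u.2 j) v2u ?subrr// mem_iota.
Qed.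

Lemma continuous_linearP (g : {linear V -> V}) :
  continuous g <-> forall n, exists m, forall u, inK m u -> inK n (g u).
Proof.
split=> [gc n|gc u A]; last first.
  rewrite nbhs_filterE => /nbhs_ellsum[n nA]; have [m mn] := gc n.
  by apply/nbhs_ellsum; exists m => v vu; apply: nA; rewrite -linearB; exact: mn.
have /gc : nbhs (g 0) [set u | inK n u].
  by apply/nbhs_ellsum; exists n => v; rewrite linear0 subr0.
by rewrite nbhs_filterE => /nbhs_ellsum[m mP]; exists m => u uK; apply: mP; rewrite subr0.
Qed.

Lemma ell_decomp N u : inU N u -> inK N (u - of_coords (coords N u)).
Proof.
move=> uU; split; last by rewrite linearB /= of_coordsK subrr.
by apply: (subB (@subU F N)) => //; exact: inU_of_coords.
Qed.

(** By continuity some K_M is sent into l^diamond, and U_m is contained in the sum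
    of K_M and of a finite set. *)
Lemma linear_inU (g : {linear V -> V}) m : continuous g ->
  exists N, forall u, inU m u -> inU N (g u).
Proof.
move=> /continuous_linearP/(_ 0%N)[m' m'0].
pose M := (m + m')%N.
have [N NP] := ex_inU_fam (fun w : 'rV[F]_(M + M) => g (of_coords w)).
exists N => u uU; have {}uU : inU M u by apply: inU_mono uU; exact: leq_addr.
rewrite -[u](subrK (of_coords (coords M u))) linearD; apply: (subD (@subU F N)) => //.
by apply: inKU (m'0 _ _); apply: inK_mono (ell_decomp uU); exact: leq_addl.
Qed.

Definition finop_fun N (H : 'M[F]_(N + N)) u : V := u + of_coords (coords N u *m H - coords N u).

Lemma finop_is_linear N H : linear (@finop_fun N H).
Proof.
move=> a u v; rewrite /finop_fun linearP /= mulmxDl -scalemxAl opprD addrACA -scalerBr linearP /=.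
by rewrite scalerDr addrACA.
Qed.
HB.instance Definition _ N H := GRing.isLinear.Build F V V _ (@finop_fun N H) (@finop_is_linear N H).

(** H acts on the span of the e_i and f_j with i, j < N; the other coordinates are
    fixed. *)
Definition finop N (H : 'M[F]_(N + N)) : {linear V -> V} := @finop_fun N H.

Lemma coords_finop N H u : coords N (@finop N H u) = coords N u *m H.
Proof. by rewrite /finop /= /finop_fun linearD /= of_coordsK addrC subrK. Qed.

Lemma finop_inK N H u : inK N u -> @finop N H u = u.
Proof. by move=> [_ u0]; rewrite /finop /= /finop_fun u0 mul0mx subrr linear0 addr0. Qed.

Lemma finopM N H H' u : finop H' (@finop N H u) = finop (H *m H') u.
Proof.
rewrite -[LHS]/(finop H u + of_coords (coords N (finop H u) *m H' - coords N (finop H u))) coords_finop -mulmxA.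
rewrite -[finop H u]/(u + of_coords (coords N u *m H - coords N u)) -addrA -linearD /=.
by rewrite [X in of_coords X]addrC subrKA.
Qed.

Lemma finop1 N u : @finop N 1%:M u = u.
Proof. by rewrite /finop /= /finop_fun mulmx1 subrr linear0 addr0. Qed.

Lemma finopK N H : H \in unitmx -> cancel (@finop N H) (finop (invmx H)).
Proof. by move=> Hu u; rewrite finopM mulmxV// finop1. Qed.
Lemma finopVK N H : H \in unitmx -> cancel (finop (invmx H)) (@finop N H).
Proof. by move=> Hu u; rewrite finopM mulVmx// finop1. Qed.

Lemma finop_inU N n H u : (N <= n)%N -> inU n (@finop N H u) <-> inU n u.
Proof.
move=> Nn; have ioU : inU n (of_coords (coords N u *m H - coords N u)).
  by apply: inU_mono Nn _; exact: inU_of_coords.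
split=> uU; last exact: (subD (@subU F n)).
by rewrite -[u](addrK (of_coords (coords N u *m H - coords N u))); exact: (subB (@subU F n)).
Qed.

Lemma finop_inKP N n H u : H \in unitmx -> (N <= n)%N -> inK n (@finop N H u) <-> inK n u.
Proof.
move=> Hu Nn; split=> uK; last by rewrite finop_inK//; exact: inK_mono Nn _.
by rewrite -(finopK Hu u) finop_inK//; exact: inK_mono Nn _.
Qed.

Lemma finop_continuous N H : continuous (@finop N H).
Proof.
apply/continuous_linearP => n; exists (N + n)%N => u uK.
by rewrite finop_inK; apply: inK_mono uK; [exact: leq_addl|exact: leq_addr].
Qed.

Lemma finop_GL N H : H \in unitmx -> GL (@finop N H).
Proof.
move=> Hu; split; first exact: finop_continuous.
by exists (finop (invmx H)); split; [exact: finop_continuous|exact: finopK|exact: finopVK].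
Qed.

Section LevelAutomorphism.
Variables (n : nat) (g h : {linear V -> V}).
Hypotheses (gK : cancel g h) (hK : cancel h g).
Hypotheses (gU : forall u, inU n (g u) <-> inU n u) (gKn : forall u, inK n (g u) <-> inK n u).

(** Automorphisms that preserve U_n and K_n act on shadows through U_n / K_n. *)
Lemma shadow_image : exists2 f : 'rV[F]_(n + n) -> 'rV[F]_(n + n), injective f &
  forall L, shadow n (g @` L) = f @: shadow n L.
Proof.
pose f (w : 'rV[F]_(n + n)) := coords n (g (of_coords w)); exists f => [w w' /eqP|L].
  rewrite /f -subr_eq0 -!linearB /= => /eqP ww.
  have : inK n (g (of_coords (w - w'))) by split=> //; apply/gU; exact: inU_of_coords.
  by move=> /gKn[_]; rewrite of_coordsK => /eqP; rewrite subr_eq0 => /eqP.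
have piE u : inU n u -> coords n (g u) = f (coords n u).
  move=> uU; apply/eqP; rewrite /f -subr_eq0 -!linearB /=; apply/eqP.
  by have /gKn[] := ell_decomp uU.
apply/setP => w; apply/idP/imsetP => [/shadowP[_ [[u Lu <-] /gU uU] <-]|[_ /shadowP[u [Lu uU] <-] ->]].
  by exists (coords n u); [exact: shadow_mem|exact: piE].
by apply/shadowP; exists (g u); [split; [exists u|exact/gU]|exact: piE].
Qed.

Lemma good_image L : good n L -> good n (g @` L).
Proof.
move=> [LK LU Lc]; split.
- by move=> _ [u Lu <-] /gKn uK; rewrite (LK u)// linear0.
- move=> x; have [u Lu uU] := LU (h x); exists (g u); first by exists u.
  by rewrite -[x]hK -linearB; exact/gU.
by have [f finj ->] := shadow_image; rewrite card_imset.
Qed.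

End LevelAutomorphism.

Lemma good_finop N n H L : H \in unitmx -> (N <= n)%N -> good n L ->
  good n (@finop N H @` L).
Proof.
move=> Hu Nn gL; apply: (good_image (finopVK Hu)) => // u.
  exact: finop_inU.
exact: finop_inKP.
Qed.

Lemma shadow_finop N H L : shadow N (@finop N H @` L) = [set w *m H | w in shadow N L]%SET.
Proof.
apply/setP => w; apply/idP/imsetP => [/shadowP[_ [[u Lu <-] uU] <-]|[_ /shadowP[u [Lu uU] <-] ->]].
  by exists (coords N u); [apply: shadow_mem => //; apply/(finop_inU H _ (leqnn N))|exact: coords_finop].
apply/shadowP; exists (@finop N H u); last exact: coords_finop.
by split; [exists u|apply/(finop_inU H _ (leqnn N))].
Qed.

End Operators.

(** * The index of an operator *)

Section Dimensions.
Variables (F : finFieldType) (E : lmodType F).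
Implicit Types (U W : set E).

Definition lin_closed U := U 0 /\ forall a u v, U u -> U v -> U (a *: u + v).

Lemma lin_closedB U u v : lin_closed U -> U u -> U v -> U (u - v).
Proof. by move=> [_ UL] Uu Uv; rewrite addrC -scaleN1r; exact: UL. Qed.

Lemma lin_closed_sum U (I : Type) (r : seq I) (c : I -> F) (f : I -> E) :
  lin_closed U -> (forall i, U (f i)) -> U (\sum_(i <- r) c i *: f i).
Proof. by move=> [U0 UL] Uf; elim/big_rec: _ => // i x _ Ux; exact: UL. Qed.

(** The coordinates in the two bases give an injection from F^n to F^n'. *)
Lemma is_qdim_le U W n n' : lin_closed U -> lin_closed W ->
  is_qdim U W n -> is_qdim U W n' -> (n <= n')%N.
Proof.
move=> cU cW [b [Ub bP]] [b' [Ub' bP']].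
pose s (c : {ffun 'I_n -> F}) := \sum_i c i *: b i.
pose s' (c : {ffun 'I_n' -> F}) := \sum_i c i *: b' i.
have Us c : U (s c) by exact: lin_closed_sum.
have /choice[f fP] : forall c, exists c', W (s c - s' c').
  by move=> c; have [c' [cc' _]] := bP' _ (Us c); exists c'.
have finj : injective f.
  move=> c d fcd; have [e [_ eP]] := bP _ (Us c).
  have <- : e = c by apply: eP; rewrite -/(s c) subrr; case: cW.
  apply: eP; rewrite -/(s d) -[s c](subrK (s' (f c))) -addrA.
  rewrite -[s' (f c) - s d]opprB; apply: lin_closedB => //; by rewrite fcd.
have := leq_card f finj; rewrite !card_ffun !card_ord.
by rewrite leq_exp2l// card_field_gt1.
Qed.

Lemma is_qdimE U W n : lin_closed U -> lin_closed W -> is_qdim U W n -> qdim U W = n.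
Proof.
move=> cU cW Un; rewrite /qdim; have := @xgetPex _ 0%N [set k | is_qdim U W k] (ex_intro _ n Un).
by move=> /= Uk; apply/eqP; rewrite eqn_leq (is_qdim_le cU cW Uk Un) (is_qdim_le cU cW Un Uk).
Qed.

(** A space that embeds in a finite one has a dimension, which is the logarithm of
    its number of elements. *)
Lemma is_qdim_inj U n (p : {linear E -> 'rV[F]_n}) (S : {set 'rV[F]_n}) :
  lin_closed U -> (forall u, U u -> p u = 0 -> u = 0) ->
  (forall w, w \in S <-> exists2 u, U u & p u = w) ->
  exists2 k, is_qdim U [set 0] k & #|S| = (#|F| ^ k)%N.
Proof.
move=> cU pU SP; have [A0 A0P] : exists A0 : 'M[F]_(#|S|, n), forall v, (v \in S) = (v <= A0)%MS.
  apply: rowspace_of_set; first by apply/SP; exists 0; [case: cU|rewrite linear0].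
  move=> a _ _ /SP[u Uu <-] /SP[v Uv <-]; apply/SP; exists (a *: u + v).
    by case: cU => _; apply.
  by rewrite linearP.
exists (\rank A0); last by rewrite -card_rowspace; apply: eq_card => v; rewrite inE A0P.
set k := \rank A0.
have [A [Af AE]] : exists A : 'M[F]_(k, n), row_free A /\ (A :=: A0)%MS.
  by exists (row_base A0); split; [exact: row_base_free|exact: eq_row_base].
have /choice[b bP] : forall i, exists u, U u /\ p u = row i A.
  move=> i; have : row i A \in S by rewrite A0P -AE row_sub.
  by move=> /SP[u Uu pu]; exists u.
have ps c : p (\sum_i c i *: b i) = (\row_i c i) *m A.
  rewrite linear_sum mulmx_sum_row; apply: eq_bigr => i _.
  by rewrite linearZ /= (bP i).2 mxE.
exists b; split=> [i|u Uu]; first by have [] := bP i.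
have : p u \in S by apply/SP; exists u.
rewrite A0P -AE => /submxP[c pc]; exists [ffun i => c 0 i].
have rc : \row_i [ffun i => c 0 i] i = c by apply/rowP => i; rewrite !mxE ffunE.
split=> [|d /= /eqP].
  apply: pU; last by rewrite linearB ps rc pc subrr.
  apply: lin_closedB => //; apply: lin_closed_sum => // i; by have [] := bP i.
rewrite subr_eq0 => /eqP ud; apply/ffunP => i; rewrite ffunE.
move: pc; rewrite ud ps => /(row_free_inj Af)/rowP/(_ i); rewrite mxE => ->.
by [].
Qed.

(** Likewise for a quotient of a finite space; a basis is supplied by a complement of
    the kernel. *)
Lemma is_qdim_surj U W n (t : {linear 'rV[F]_n -> E}) (S : {set 'rV[F]_n}) :
  lin_closed U -> lin_closed W -> (forall w, U (t w)) ->
  (forall u, U u -> exists w, W (u - t w)) ->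
  (forall w, w \in S <-> W (t w)) ->
  exists2 k, is_qdim U W k & (#|S| * #|F| ^ k = #|F| ^ n)%N.
Proof.
move=> cU cW Ut tW SP.
have [A AP] : exists A : 'M[F]_(#|S|, n), forall v, (v \in S) = (v <= A)%MS.
  apply: rowspace_of_set; first by apply/SP; rewrite linear0; case: cW.
  move=> a u v /SP Wu /SP Wv; apply/SP; rewrite linearP.
  by case: cW => _; apply.
have {A AP} [A AP] : exists A : 'M[F]_n, forall v, (v \in S) = (v <= A)%MS.
  by exists <<A>>%MS => v; rewrite genmxE.
exists (\rank (A^C)%MS); last first.
  have -> : #|S| = (#|F| ^ \rank A)%N.
    by rewrite -card_rowspace; apply: eq_card => v; rewrite inE AP.
  by rewrite -expnD mxrank_compl subnKC// rank_leq_col.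
set k := \rank _.
have [B [Bf BE]] : exists B : 'M[F]_(k, n), row_free B /\ (B :=: A^C)%MS.
  by exists (row_base (A^C)%MS); split; [exact: row_base_free|exact: eq_row_base].
exists (fun i => t (row i B)); split=> // u /tW[w Ww].
have ts (c : 'I_k -> F) : \sum_i c i *: t (row i B) = t ((\row_i c i) *m B).
  rewrite mulmx_sum_row linear_sum; apply: eq_bigr => i _.
  by rewrite linearZ /= mxE.
have /sub_addsmxP[[x y] /= wxy] : (w <= A + B)%MS.
  by rewrite (adds_eqmx (eqmx_refl A) BE) submx_full// addsmx_compl_full.
exists [ffun i => (y *m 1%:M) 0 i].
have ry : \row_i [ffun i => (y *m 1%:M) 0 i] i = y.
  by apply/rowP => i; rewrite mxE ffunE mulmx1.
split=> [|d /= Wd].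
  rewrite ts ry -(subrK (t w) u) -addrA -linearB /= wxy addrK.
  have WA : W (t (x *m A)) by apply/SP; rewrite AP submxMl.
  by case: (cW) => _ /(_ 1 _ _ WA Ww); rewrite scale1r addrC wxy.
apply/ffunP => i; rewrite ffunE mulmx1; move: Wd; rewrite ts => Wd.
have : W (t (w - (\row_i d i) *m B)).
  rewrite linearB /= -[t w](subKr u) addrAC; exact: lin_closedB.
move=> /SP; rewrite AP wxy -addrA -mulmxBl => AB.
have : ((y - \row_i d i) *m B <= A :&: B)%MS.
  rewrite sub_capmx submxMl andbT -[_ *m B](addKr (x *m A)).
  by rewrite addmx_sub// -mulNmx submxMl.
have -> : (A :&: B = 0)%MS.
  by apply/eqP; rewrite -submx0 -(capmx_compl A) capmxS// BE.
rewrite submx0 => /eqP; rewrite -[RHS](mul0mx _ B) => /(row_free_inj Bf)/eqP.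
by rewrite subr_eq0 => /eqP ->; rewrite mxE.
Qed.

End Dimensions.

Section Theta.
Variable F : finFieldType.
Implicit Types (u v x : ellsum F) (m n N : nat) (L M : set (ellsum F)).
Notation V := (ellsum F).

Definition ellset : set V := [set u | u.2 = 0].

Lemma sub_ellset : is_subspace ellset.
Proof.
split=> // a u v u0 v0; rewrite /ellset/= -[LHS]/(a *: u.2 + v.2) u0 v0.
by rewrite scaler0 addr0.
Qed.

Lemma ellset_inK0 u : ellset u -> inK 0 u -> u = 0.
Proof.
move=> /= u2 /inKP[u1 _]; apply: space_eq => -[i|j]; rewrite ecoord0 /=; first exact: u1.
by rewrite u2.
Qed.

Lemma ecoordD u v z : ecoord (u + v) z = ecoord u z + ecoord v z.
Proof. by rewrite -[u]scale1r coordL mul1r scale1r. Qed.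

(** The decomposition of E as the sum of l and l^diamond = K_0. *)
Lemma ell_split u : exists y z, [/\ ellset y, inK 0 z & u = y + z].
Proof.
exists ((u.1, 0) : V), ((0, u.2) : V); split=> //; first by apply/inKP.
apply: space_eq => -[i|j]; rewrite ecoordD.
  by rewrite -[RHS]/(u.1 i + 0) addr0.
by rewrite -[RHS]/(0 + u.2 j) add0r.
Qed.

Lemma ellset_good0 : good 0 ellset.
Proof.
apply/good0P; first exact: sub_ellset.
split=> [u uE u1|x]; first by apply: ellset_inK0 => //; apply/inKP.
have [y [z [yE zK ->]]] := ell_split x; exists y => //.
by rewrite addrC addKr; have /inKP[] := zK.
Qed.

Definition injl (v : ell F) : V := (v, 0).
Lemma injl_is_linear : linear injl.
Proof.
move=> a u v; apply: space_eq => -[i|j]; rewrite coordL //=.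
by rewrite mulr0 addr0.
Qed.
HB.instance Definition _ := GRing.isLinear.Build F (ell F) V _ injl injl_is_linear.

Definition prl (u : V) : ell F := u.1.
Lemma prl_is_linear : linear prl. Proof. by []. Qed.
HB.instance Definition _ := GRing.isLinear.Build F V (ell F) _ prl prl_is_linear.

Lemma prl_eq0 u : prl u = 0 <-> inK 0 u.
Proof.
split=> [u0|/inKP[u1 _]]; first by apply/inKP; split=> // i; rewrite -[u.1]/(prl u) u0.
by apply/val_inj/funext.
Qed.

(** The first half of the coordinates of level N: those along e_0, ..., e_(N-1). *)
Definition pad_row N (w : 'rV[F]_N) : 'rV[F]_(N + N) := row_mx w 0.
Lemma pad_row_is_linear N : linear (@pad_row N).
Proof. by move=> a u v; rewrite /pad_row scale_row_mx add_row_mx scaler0 addr0. Qed.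
HB.instance Definition _ N := GRing.isLinear.Build F _ _ _ (@pad_row N) (@pad_row_is_linear N).

Section ThetaShadow.
Variables (g h : {linear V -> V}) (N : nat).
Hypotheses (gK : cancel g h) (hK : cancel h g).
Hypothesis hKN : forall u, inK N u -> inK 0 (h u).
Hypothesis gU : forall u, inK 0 u -> inU N (g u).

Let L : set V := g @` ellset.
Let Ls : is_subspace L. Proof. exact: sub_image sub_ellset. Qed.

Let a : {linear ell F -> ell F} := prl \o g \o injl.
Let aE : block_a g = a. Proof. by []. Qed.

Let LKN u : L u -> inK N u -> u = 0.
Proof.
move=> [x xE <-] /hKN; rewrite gK => xK.
by rewrite (ellset_inK0 xE xK) linear0.
Qed.

(** Let L be the image of l under g. The kernel of the block a is L cap l^diamond,
    and its cokernel is E / (L + l^diamond). Projecting L cap U_N to the span of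
    e_0, ..., e_(N-1), whose cokernel is that of a, shows that the shadow of L has
    dimension N + dim ker a - dim coker a. The two hypotheses on N say that K_N
    is in the image of l^diamond and that this image is in U_N. *)
Lemma theta_shadow : theta g = 0 <-> #|shadow N L| = (#|F| ^ N)%N.
Proof.
pose kerU : set (ell F) := block_a g @^-1` [set 0].
pose p : {linear ell F -> 'rV[F]_(N + N)} := @coords F N \o g \o injl.
(* the image of ker a, as v goes to (v, 0) g *)
pose X := L `&` inK 0.
have kerc : lin_closed kerU.
  split=> [|c u v]; rewrite /kerU /= aE ?linear0// => u0 v0.
  by rewrite linearP /= -[prl _]/(a u) -[prl (g (injl v))]/(a v) u0 v0 scaler0 addr0.
have [k kP kc] : exists2 k, is_qdim kerU [set 0] k & #|shadow N X| = (#|F| ^ k)%N.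
  apply: (@is_qdim_inj _ _ _ _ p).
  - exact: kerc.
  - move=> u; rewrite /kerU /= aE => u0 pu.
    have : g (injl u) = 0.
      by apply: LKN; [exists (injl u)|split=> //; apply: inKU; apply/prl_eq0; exact: u0].
    by move=> /(congr1 (prl \o h)) /=; rewrite gK linear0.
  - move=> w; rewrite shadowP; split=> [[u [[[x xE xu] u0] uU] uw]|[u u0 uw]].
      exists x.1; first by rewrite /kerU /= aE; apply/prl_eq0; rewrite /= (_ : injl _ = x) ?xu// [RHS]surjective_pairing xE.
      by rewrite /p /= (_ : injl _ = x) ?xu// [RHS]surjective_pairing xE.
    have gK0 : inK 0 (g (injl u)) by apply/prl_eq0; exact: u0.
    by exists (g (injl u)) => //; split; [split=> //; exists (injl u)|exact: inKU gK0].
pose t : {linear 'rV[F]_N -> ell F} := prl \o @of_coords F N \o @pad_row N.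
(* the vectors of the span of e_0, ..., e_(N-1) that are in the image of a *)
pose A : {set 'rV[F]_N} := [set w | `[< range (block_a g) (t w) >]]%SET.
have AP w : w \in A <-> range (block_a g) (t w) by rewrite inE; split=> /asboolP.
have rc : lin_closed (range (block_a g)).
  split; first by exists 0 => //; rewrite aE linear0.
  by move=> c _ _ [u _ <-] [v _ <-]; exists (c *: u + v) => //; rewrite aE linearP.
have tP u : inU N u -> prl u = t (lsubmx (coords N u)).
  move=> uU; apply/val_inj/funext => i /=; case: insubP => [j _ ji|].
    by rewrite /pad_row row_mxEl mxE /coords row_mxEl mxE ji.
  by rewrite -leqNgt => /uU.
have [c cP cc] : exists2 c, is_qdim [set: ell F] (range (block_a g)) c &
    (#|A| * #|F| ^ c = #|F| ^ N)%N.
  apply: (@is_qdim_surj _ _ _ _ _ t) => // x _.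
  have [y [z [yE zK xyz]]] := ell_split (h (injl x)).
  exists (lsubmx (coords N (g z))); rewrite -tP; last exact: gU.
  have yE' : injl y.1 = y by rewrite [RHS]surjective_pairing yE.
  exists y.1 => //; rewrite aE /a /= yE'; have /(congr1 (prl \o g)) := xyz.
  by rewrite /= hK linearD linearD /= => ->; rewrite addrK.
have cnt : #|shadow N L| = (#|A| * #|shadow N X|)%N.
  have /choice[beta0 bP0] : forall w : 'rV[F]_N, exists u, w \in A ->
      [/\ L u, inU N u & prl u = t w].
    move=> w; have [/AP[v _ vw]|wA] := boolP (w \in A); last by exists 0.
    exists (g (injl v)) => _; split=> //; first by exists (injl v).
    move=> i Ni; rewrite -[LHS]/(block_a g v i) vw /=.
    by case: insubP => // j; rewrite ltnNge Ni.
  pose beta (w : {w | w \in A}) := beta0 (val w).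
  have bP (w : {w | w \in A}) := bP0 (val w) (valP w).
  rewrite (@card_image_fibers _ _ (@coords F N) (L `&` inU N) (X `&` inU N) _ (shadow N X) _ beta).
  - by rewrite card_sig; congr (_ * _)%N; apply: eq_card => w; rewrite inE.
  - by move=> w; rewrite shadowP.
  - by move=> w; rewrite shadowP.
  - by move=> u v [Lu uU] [Lv vU]; split; [exact: (subB Ls)|exact: (subB (@subU F N))].
  - move=> u v [[Lu uK] uU] [[Lv vK] vU]; split; last exact: (subB (@subU F N)).
    by split; [exact: (subB Ls)|exact: (subB (@subK F 0))].
  - by move=> u [[]].
  - by move=> w; have [] := bP w.
  - move=> u [Lu uU].
    have uA : lsubmx (coords N u) \in A.
      apply/AP; rewrite -tP//; have [x xE xu] := Lu; exists x.1 => //.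
      by rewrite aE /a /= (_ : injl _ = x) ?xu// [RHS]surjective_pairing xE.
    pose w0 : {w | w \in A} := exist (fun w => w \in A) _ uA.
    exists w0; have [Lb bU bt] := bP w0.
    split; last exact: (subB (@subU F N)).
    split; first exact: (subB Ls).
    by apply/prl_eq0; rewrite linearB /= bt -tP ?subrr.
  - move=> w w' [[_ /prl_eq0]]; rewrite linearB /=.
    have [_ _ ->] := bP w; have [_ _ ->] := bP w' => + _.
    move=> /eqP; rewrite subr_eq0 => /eqP ww; apply: val_inj.
    apply/rowP => i; have /(congr1 (fun v : ell F => v i)) := ww.
    rewrite /= !insubT//= => ilt; rewrite !row_mxEl.
    by move=> e; rewrite (_ : i = Ordinal ilt)//; apply: val_inj.
  - move=> u [Lu uU] u0; rewrite (LKN Lu) //.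
    split; last exact: inU0.
    by split; [exact: sub0|exact: inK0].
have q1 := card_field_gt1 F.
have qpos e : (0 < #|F| ^ e)%N by rewrite expn_gt0 (ltn_trans _ q1).
have zc : lin_closed [set 0 : ell F] by split=> // ? ? ? /= -> ->; rewrite scaler0 addr0.
rewrite /theta (is_qdimE _ rc cP)// (is_qdimE kerc zc kP).
rewrite cnt kc -cc; split=> [/eqP|/eqP].
  by rewrite subr_eq0 => /eqP[->].
have A0 : (0 < #|A|)%N by move: (qpos N); rewrite -cc muln_gt0 => /andP[].
by rewrite eqn_pmul2l// eqn_exp2l// => /eqP ->; rewrite subrr.
Qed.

End ThetaShadow.
End Theta.

(** * Operators of index 0 act on flags as finite operators *)

Section Fit.
Variable F : finFieldType.
Implicit Types (u v x : ellsum F) (m n N : nat) (L M : set (ellsum F)).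
Notation V := (ellsum F).

Lemma finop_GL0 N H : H \in unitmx -> GL0 (@finop F N H).
Proof.
move=> Hu; split; first exact: finop_GL.
apply/(theta_shadow (N := N) (finopK Hu) (finopVK Hu)).
- by move=> u uK; rewrite finop_inK//; exact: inK_mono uK.
- by move=> u uK; apply/finop_inU => //; exact: inKU uK.
have E0 := sub_ellset F.
have [_ _ //] : good N (finop H @` @ellset F).
by apply: good_finop => //; apply: good_mono (ellset_good0 F).
Qed.

(** The subspaces between K_m and U_m, indexed by the subspaces of U_m / K_m. *)
Definition between m (Q : {set 'rV[F]_(m + m)}) : set V :=
  [set u | inU m u /\ coords m u \in Q].

Section Between.
Variables (m : nat) (Q : {set 'rV[F]_(m + m)}).
Hypothesis Q0 : 0 \in Q.
Hypothesis QL : forall a (w w' : 'rV[F]_(m + m)), w \in Q -> w' \in Q -> a *: w + w' \in Q.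

Lemma sub_between : is_subspace (between Q).
Proof.
split=> [|a u v [uU uQ] [vU vQ]]; first by split; [exact: inU0|rewrite linear0].
by split; [exact: inUL|rewrite linearP; exact: QL].
Qed.

Lemma inK_between u : inK m u -> between Q u.
Proof. by move=> [uU u0]; split=> //; rewrite u0. Qed.

End Between.

(** Unlike [shadow], the image of all of X, which need not lie in U_N. *)
Definition coords_im N (X : set V) : {set 'rV[F]_(N + N)} :=
  [set w | `[< exists2 u, X u & coords N u = w >]]%SET.

Lemma coords_imP N X w : w \in coords_im N X <-> exists2 u, X u & coords N u = w.
Proof. by rewrite inE; split=> /asboolP. Qed.

Section Levels.
Variables (g h : {linear V -> V}) (m N : nat).
Hypotheses (gK : cancel g h) (hK : cancel h g).
Hypothesis hKN : forall u, inK N u -> inK m (h u).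
Hypothesis gU : forall u, inU m u -> inU N (g u).

Lemma coords_im_closed X : is_subspace X -> 0 \in coords_im N (g @` X) /\
  forall a w w', w \in coords_im N (g @` X) -> w' \in coords_im N (g @` X) ->
    a *: w + w' \in coords_im N (g @` X).
Proof.
move=> Xs; have gXs := sub_image g Xs; split.
  by apply/coords_imP; exists 0; [exact: sub0|rewrite linear0].
move=> a _ _ /coords_imP[u Xu <-] /coords_imP[v Xv <-]; apply/coords_imP; exists (a *: u + v).
  by case: gXs => _; apply.
by rewrite linearP.
Qed.

(** An automorphism preserves indices between nested subspaces. *)
Lemma card_coords_between (Q : {set 'rV[F]_(m + m)}) : 0 \in Q ->
  (forall a w w', w \in Q -> w' \in Q -> a *: w + w' \in Q) ->
  #|coords_im N (g @` between Q)| = (#|Q| * #|coords_im N (g @` inK m)|)%N.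
Proof.
move=> Q0 QL; have Xs := sub_between Q0 QL.
have -> : #|Q| = #|{: {w | w \in Q}}| by rewrite card_sig; apply: eq_card => w; rewrite inE.
apply: (@card_image_fibers _ _ (@coords F N) (g @` between Q) (g @` inK m) _ _ _
  (fun w : {w | w \in Q} => g (of_coords (val w)))).
- by move=> w; rewrite coords_imP.
- by move=> w; rewrite coords_imP.
- by move=> u v Xu Xv; exact: (subB (sub_image g Xs)).
- by move=> u v Xu Xv; exact: (subB (sub_image g (@subK F m))).
- by move=> _ [u uK <-]; exists u => //; exact: inK_between.
- move=> w; exists (of_coords (val w)) => //; split; first exact: inU_of_coords.
  by rewrite of_coordsK; exact: (valP w).
- move=> _ [u [uU uQ] <-]; pose w0 : {w | w \in Q} := exist (fun w => w \in Q) _ uQ.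
  by exists w0; rewrite -linearB; exists (u - of_coords (coords m u)) => //; exact: ell_decomp.
- move=> w w' [k kK]; rewrite -linearB => /(can_inj gK) kE; apply: val_inj.
  by have [_] := kK; rewrite kE linearB /= !of_coordsK => /eqP; rewrite subr_eq0 => /eqP.
- move=> _ [u [uU uQ] <-] gu0; exists u => //; rewrite -[u]gK; apply: hKN.
  by split=> //; exact: gU.
Qed.

(** E is the direct sum of the images of l and l^diamond under g, and the latter is in
    U_N. Hence U_N is the direct sum of its intersection with the image of l, of
    dimension N because g has index 0, and of the image of l^diamond. So the latter
    has the same dimension over K_N as l^diamond itself. *)
Lemma card_coords_elld : theta g = 0 ->
  (#|F| ^ N * #|coords_im N (g @` inK 0)|)%N = #|{: 'rV[F]_(N + N)}|.
Proof.
have hKN0 u : inK N u -> inK 0 (h u) by move=> /hKN; exact: inK_mono.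
have gU0 u : inK 0 u -> inU N (g u) by move=> uK; apply: gU; exact: inKU uK.
move=> /(theta_shadow gK hK hKN0 gU0) <-.
have Ls := sub_image g (sub_ellset F); set L := g @` _ in Ls *.
have LK u : L u -> (g @` inK 0) u -> u = 0.
  move=> [x xE <-] [y yK /(can_inj gK) yx]; rewrite yx in yK.
  by rewrite (ellset_inK0 xE yK) linear0.
have -> : #|shadow N L| = #|{: {w | w \in shadow N L}}|.
  by rewrite card_sig; apply: eq_card => w; rewrite inE.
have /choice[beta bP] : forall w : {w | w \in shadow N L}, exists u,
    [/\ L u, inU N u & coords N u = val w].
  by move=> w; have /shadowP[u [Lu uU] uw] := valP w; exists u.
have -> : #|{: 'rV[F]_(N + N)}| = #|[set: 'rV[F]_(N + N)]%SET| by rewrite cardsT.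
apply/esym.
apply: (@card_image_fibers _ _ (@coords F N) (inU N) (g @` inK 0) _ _ _ beta).
- by move=> w; rewrite finset.in_setT; split=> // _; exists (of_coords w); [exact: inU_of_coords|exact: of_coordsK].
- by move=> w; rewrite coords_imP.
- by move=> u v; exact: (subB (@subU F N)).
- by move=> u v; exact: (subB (sub_image g (@subK F 0))).
- by move=> _ [u uK <-]; exact: gU0.
- by move=> w; have [] := bP w.
- move=> u uU; have [y [z [yE zK hu]]] := ell_split (h u).
  have ugyz : u = g y + g z by rewrite -linearD -hu hK.
  have gyU : inU N (g y).
    by rewrite -[g y](addrK (g z)) -ugyz; apply: (subB (@subU F N)) => //; exact: gU0.
  have Lgy : L (g y) by exists y.
  pose w0 : {w | w \in shadow N L} := exist (fun w => w \in shadow N L) _ (shadow_mem Lgy gyU).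
  exists w0; have [Lb bU bw] := bP w0.
  have -> : beta w0 = g y.
    apply/eqP; rewrite -subr_eq0; apply/eqP; apply: LK; first exact: subB.
    have /hKN0 dK : inK N (beta w0 - g y).
      by split; [exact: (subB (@subU F N))|rewrite linearB /= bw subrr].
    by exists (h (beta w0 - g y)).
  by rewrite ugyz addrC addKr; exists z.
- move=> w w' ww; have [Lb _ bw] := bP w; have [Lb' _ bw'] := bP w'.
  apply: val_inj; rewrite -bw -bw'; congr (coords N _); apply/eqP; rewrite -subr_eq0; apply/eqP.
  by apply: LK => //; exact: subB.
- move=> u uU u0; exists (h u) => //; exact: hKN0.
Qed.

End Levels.

Lemma set_rowspace n (S : {set 'rV[F]_n}) : 0 \in S ->
  (forall a w w', w \in S -> w' \in S -> a *: w + w' \in S) ->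
  exists A : 'M[F]_n, (forall w, (w \in S) = (w <= A)%MS) /\ #|S| = (#|F| ^ \rank A)%N.
Proof.
move=> S0 SL; have [A AP] := rowspace_of_set S0 SL.
have e w : (w \in S) = (w <= <<A>>)%MS by rewrite genmxE.
by exists <<A>>%MS; split=> //; rewrite -card_rowspace; apply: eq_card => v; rewrite inE e.
Qed.

(** The form of [flag_conj] that is needed for subspaces given as sets. *)
Lemma set_flag_conj n (S S' : 'I_3 -> {set 'rV[F]_n}) :
  (forall i, 0 \in S i) -> (forall i a w w', w \in S i -> w' \in S i -> a *: w + w' \in S i) ->
  (forall i, 0 \in S' i) -> (forall i a w w', w \in S' i -> w' \in S' i -> a *: w + w' \in S' i) ->
  (forall i j : 'I_3, (i <= j)%N -> S i \subset S j) ->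
  (forall i j : 'I_3, (i <= j)%N -> S' i \subset S' j) ->
  (forall i, #|S i| = #|S' i|) ->
  exists2 H : 'M[F]_n, H \in unitmx & forall i w, (w *m H \in S' i) = (w \in S i).
Proof.
move=> S0 SL S0' SL' SS SS' cS.
have /choice[A AP] : forall i, exists A : 'M[F]_n, (forall w, (w \in S i) = (w <= A)%MS) /\ #|S i| = (#|F| ^ \rank A)%N.
  by move=> i; apply: set_rowspace; [exact: S0|exact: SL].
have /choice[B BP] : forall i, exists A : 'M[F]_n, (forall w, (w \in S' i) = (w <= A)%MS) /\ #|S' i| = (#|F| ^ \rank A)%N.
  by move=> i; apply: set_rowspace; [exact: S0'|exact: SL'].
have AA (i j : 'I_3) : (i <= j)%N -> (A i <= A j)%MS.
  move=> /SS /fintype.subsetP ij; apply/row_subP => k.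
  by rewrite -(AP j).1; apply: ij; rewrite (AP i).1 row_sub.
have BB (i j : 'I_3) : (i <= j)%N -> (B i <= B j)%MS.
  move=> /SS' /fintype.subsetP ij; apply/row_subP => k.
  by rewrite -(BP j).1; apply: ij; rewrite (BP i).1 row_sub.
have rAB i : \rank (A i) = \rank (B i).
  by have /eqP := cS i; rewrite (AP i).2 (BP i).2 eqn_exp2l ?card_field_gt1// => /eqP.
pose i0 : 'I_3 := ord0; pose i1 : 'I_3 := inord 1; pose i2 : 'I_3 := ord_max.
have [||||H [Hu H0 H1 H2]] := @flag_conj _ _ (A i0) (A i1) (A i2) (B i0) (B i1) (B i2) _ _ _ _ (rAB _) (rAB _) (rAB _).
- by apply: AA.
- by apply: AA; rewrite inordK.
- by apply: BB.
- by apply: BB; rewrite inordK.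
exists H => // i w; rewrite (AP i).1 (BP i).1.
have HAB : (A i *m H :=: B i)%MS.
  suff [->|[->|->]] : i = i0 \/ i = i1 \/ i = i2 by [].
  by case: i => -[|[|[|//]]] ilt; [left|right; left|right; right]; apply: val_inj; rewrite /= ?inordK.
rewrite -HAB; apply/idP/idP => [|/submxMr//].
by move=> /(submxMr (invmx H)); rewrite !mulmxK.
Qed.

End Fit.

Section Action.
Variable F : finFieldType.
Implicit Types (u v x : ellsum F) (m n N : nat) (L M : set (ellsum F)).
Notation V := (ellsum F).

Definition lin_closed_set n (S : {set 'rV[F]_n}) :=
  0 \in S /\ forall a w w', w \in S -> w' \in S -> a *: w + w' \in S.

Lemma lin_closed_set0 n : lin_closed_set [set 0 : 'rV[F]_n]%SET.
Proof.
split=> [|a w w']; rewrite !finset.in_set1// => /eqP -> /eqP ->.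
by rewrite scaler0 addr0.
Qed.
Lemma lin_closed_setT n : lin_closed_set [set: 'rV[F]_n]%SET.
Proof. by split=> *; rewrite finset.in_setT. Qed.

Lemma between0 m : between [set 0 : 'rV[F]_(m + m)]%SET = inK m.
Proof.
apply/seteqP; split=> u [uU]; last by move=> u0; split=> //; rewrite u0 finset.in_set1.
by rewrite finset.in_set1 => /eqP.
Qed.
Lemma betweenT m : between [set: 'rV[F]_(m + m)]%SET = inU m.
Proof. by apply/seteqP; split=> u; [case|split=> //; rewrite finset.in_setT]. Qed.

Definition flag m (S : {set 'rV[F]_(m + m)}) (i : 'I_3) : {set 'rV[F]_(m + m)} :=
  if i == 0%N :> nat then [set 0]%SET else if i == 1%N :> nat then S else [set: 'rV_(m + m)]%SET.

Lemma flag_closed m (S : {set 'rV[F]_(m + m)}) i : lin_closed_set S -> lin_closed_set (flag S i).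
Proof.
move=> cS; rewrite /flag; case: ifP => _; first exact: lin_closed_set0.
by case: ifP => _ //; exact: lin_closed_setT.
Qed.

Lemma flag_mono m (S : {set 'rV[F]_(m + m)}) (i j : 'I_3) : lin_closed_set S ->
  (i <= j)%N -> flag S i \subset flag S j.
Proof.
move=> [S0 _] ij; apply/fintype.subsetP => w; rewrite /flag; move: ij.
case: i j => [[|[|[|i]]] // ilt] [[|[|[|j]]] // jlt] //= _; rewrite ?finset.in_setT//.
by rewrite finset.in_set1 => /eqP ->.
Qed.

(** For N large, g sends the flag K_m, S, U_m to a flag between K_N and U_N. Its
    dimensions over K_N are unchanged: by [card_coords_between] it suffices to look at
    one of its members, or at l^diamond, where the index 0 condition enters through
    [card_coords_elld]. Hence an element of GL(U_N / K_N) has the same effect on it. *)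
Lemma GL0_finite_model (g : {linear V -> V}) m (S : {set 'rV[F]_(m + m)}) : GL0 g -> lin_closed_set S ->
  exists N (H : 'M[F]_(N + N)), [/\ (m <= N)%N, H \in unitmx &
    forall i, g @` between (flag S i) = finop H @` between (flag S i)].
Proof.
move=> [[gc [h [hc gK hK]]] gth] cS.
have [N1 hN1] := (continuous_linearP h).1 hc m.
have [N2 gN2] := linear_inU m gc.
pose N := (m + N1 + N2)%N.
have mN : (m <= N)%N by rewrite /N -addnA leq_addr.
have hKN u : inK N u -> inK m (h u).
  by move=> uK; apply: hN1; apply: inK_mono uK; rewrite /N addnAC leq_addl.
have gU u : inU m u -> inU N (g u).
  by move=> /gN2; apply: inU_mono; rewrite /N leq_addl.
have I1 : (1%:M : 'M[F]_(N + N)) \in unitmx by exact: unitmx1.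
pose g1 : {linear V -> V} := finop (1%:M : 'M[F]_(N + N)).
have g1E u : g1 u = u by exact: finop1.
have [_ g1th] : GL0 g1 by exact: finop_GL0.
have g1K : cancel g1 g1 by move=> u; rewrite !g1E.
have hKN1 u : inK N u -> inK m (g1 u) by move=> uK; rewrite g1E; exact: inK_mono uK.
have gU1 u : inU m u -> inU N (g1 u) by move=> uU; rewrite g1E; exact: inU_mono uU.
have cF i := flag_closed i cS.
have Xs i : is_subspace (between (flag S i)) by have [? ?] := cF i; exact: sub_between.
(* l^diamond as a subspace between K_m and U_m *)
pose D : {set 'rV[F]_(m + m)} := [set w | lsubmx w == 0]%SET.
have DK : between D = inK 0.
  apply/seteqP; split=> u; rewrite /between /= inE.
    move=> [uU /eqP u0]; apply/inKP; split=> // i; case: (ltnP i m) => [im|/uU//].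
    have /rowP/(_ (Ordinal im)) := u0; rewrite mxE /coords row_mxEl !mxE.
    by [].
  move=> /inKP[u1 _]; split=> //; rewrite /coords row_mxKl.
  by apply/eqP/rowP => i; rewrite !mxE u1.
have [D0 DL] : lin_closed_set D.
  split=> [|a w w']; rewrite !inE ?linear0// => /eqP w0 /eqP w0'.
  by rewrite linearP /= w0 w0' scaler0 addr0.
(* K_m has the same index in l^diamond before and after applying g *)
have cK : #|coords_im N (g @` inK m)| = #|coords_im N (g1 @` inK m)|.
  have e := card_coords_elld gK hK hKN gU gth.
  rewrite -(card_coords_elld g1K g1K hKN1 gU1 g1th) -!DK in e.
  rewrite (card_coords_between gK hKN gU D0 DL) (card_coords_between g1K hKN1 gU1 D0 DL) in e.
  move/eqP: e; rewrite !mulnA eqn_pmul2l => [/eqP //|].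
  rewrite muln_gt0 expn_gt0 (ltn_trans _ (card_field_gt1 F))//=.
  by apply/card_gt0P; exists 0.
have cE i : #|coords_im N (g1 @` between (flag S i))| = #|coords_im N (g @` between (flag S i))|.
  have [? ?] := cF i.
  by rewrite (card_coords_between gK hKN gU)// (card_coords_between g1K hKN1 gU1)// cK.
have mono (f : {linear V -> V}) (i j : 'I_3) : (i <= j)%N ->
    coords_im N (f @` between (flag S i)) \subset coords_im N (f @` between (flag S j)).
  move=> ij; apply/fintype.subsetP => w /coords_imP[_ [u [uU uS] <-] <-]; apply/coords_imP.
  exists (f u) => //; exists u => //; split=> //.
  by have /fintype.subsetP := flag_mono cS ij; apply.
have [H Hu HE] := @set_flag_conj _ _ (fun i => coords_im N (g1 @` between (flag S i)))
  (fun i => coords_im N (g @` between (flag S i)))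
  (fun i => (coords_im_closed g1 N (Xs i)).1) (fun i => (coords_im_closed g1 N (Xs i)).2)
  (fun i => (coords_im_closed g N (Xs i)).1) (fun i => (coords_im_closed g N (Xs i)).2)
  (mono g1) (mono g) cE.
exists N, H; split=> // i; apply/seteqP; split=> [_ [u uX <-]|_ [u uX <-]].
  have : coords N (g u) *m invmx H \in coords_im N (g1 @` between (flag S i)).
    by rewrite -HE mulmxKV//; apply/coords_imP; exists (g u) => //; exists u.
  move=> /coords_imP[_ [u' uX' <-]]; rewrite g1E => u'E.
  pose k := g u - finop H u'.
  have kK : inK N k.
    split; last by rewrite linearB /= coords_finop u'E mulmxKV// subrr.
    apply: (subB (@subU F N)); first by apply: gU; case: uX.
    by apply/(finop_inU H _ (leqnn N)); case: uX' => + _; exact: inU_mono.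
  exists (u' + k); last by rewrite linearD (finop_inK _ kK) addrC subrK.
  by apply: (subD (Xs i)) => //; apply: inK_between; [case: (cF i)|exact: inK_mono kK].
have : coords N u *m H \in coords_im N (g @` between (flag S i)).
  by rewrite HE; apply/coords_imP; exists u => //; exists u.
move=> /coords_imP[_ [u' uX' <-] u'E]; pose k := finop H u - g u'.
have kK : inK N k.
  split; last by rewrite linearB /= coords_finop u'E subrr.
  apply: (subB (@subU F N)); last by apply: gU; case: uX'.
  by apply/(finop_inU H _ (leqnn N)); case: uX => + _; exact: inU_mono.
exists (u' + h k); last by rewrite linearD hK addrC subrK.
by apply: (subD (Xs i)) => //; apply: inK_between; [case: (cF i)|exact: hKN].
Qed.

(** Being good with shadow S is a condition on the position of L relative to K_m, S
    and U_m, so that it is preserved by maps preserving these three subspaces. *)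
Lemma good_between (f f' : {linear V -> V}) m L :
  cancel f f' -> cancel f' f -> is_subspace L -> good m L ->
  (forall i, f @` between (flag (shadow m L) i) = between (flag (shadow m L) i)) ->
  good m (f @` L) /\ shadow m (f @` L) = shadow m L.
Proof.
move=> fK fK' Ls [LK LU Lc] fX.
have fX' i u : between (flag (shadow m L) i) (f u) <-> between (flag (shadow m L) i) u.
  by rewrite -{1}fX; split=> [[v vX /(can_inj fK) <-]//|uX]; exists u.
have fKm u : inK m (f u) <-> inK m u by rewrite -between0; exact: (fX' ord0).
have fUm u : inU m (f u) <-> inU m u by rewrite -betweenT; exact: (fX' ord_max).
have fS u : between (shadow m L) (f u) <-> between (shadow m L) u.
  by have := fX' (inord 1) u; rewrite /flag inordK.
have e : shadow m (f @` L) = shadow m L.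
  apply/eqP; rewrite finset.eqEsubset; apply/andP; split; apply/fintype.subsetP => w.
    move=> /shadowP[_ [[u Lu <-] /fUm uU] <-].
    have /fS[//] : between (shadow m L) u by split=> //; exact: shadow_mem.
  move=> wL; have : between (shadow m L) (of_coords w) by split; [exact: inU_of_coords|rewrite of_coordsK].
  rewrite -[of_coords w]fK' => /fS[xU /shadowP[u [Lu uU] ux]].
  have kK : inK m (f' (of_coords w) - u).
    by split; [exact: (subB (@subU F m))|rewrite linearB /= ux subrr].
  have /fKm[_] := kK; rewrite linearB fK' linearB /= of_coordsK => /eqP.
  by rewrite subr_eq0 => /eqP ->; apply: shadow_mem; [exists u|exact/fUm].
split=> //; split; last by rewrite e.
- by move=> _ [u Lu <-] /fKm uK; rewrite (LK u)// linear0.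
- move=> x; have [u Lu uU] := LU (f' x); exists (f u); first by exists u.
  by rewrite -[x]fK' -linearB; exact/fUm.
Qed.

Definition cyl1 m (S : {set 'rV[F]_(m + m)}) : set (Gr0 F) :=
  [set L | good m (val L) /\ shadow m (val L) = S].

(** Up to a finite operator, g preserves the set of good points with shadow S. *)
Lemma act_local (g : {linear V -> V}) m (S : {set 'rV[F]_(m + m)}) : GL0 g -> lin_closed_set S ->
  exists N (H : 'M[F]_(N + N)) (f f' : {linear V -> V}),
    [/\ (m <= N)%N, H \in unitmx, cancel f f' /\ cancel f' f,
     forall u, g u = finop H (f u) &
     forall L, is_subspace L -> good m L -> shadow m L = S ->
       (good m (f @` L) /\ shadow m (f @` L) = S) /\
       (good m (f' @` L) /\ shadow m (f' @` L) = S)].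
Proof.
move=> Gg cS; have [N [H [mN Hu HE]]] := GL0_finite_model Gg cS.
have [[_ [h [_ gK hK]]] _] := Gg.
pose f : {linear V -> V} := finop (invmx H) \o g; pose f' : {linear V -> V} := h \o finop H.
have fK : cancel f f' by move=> u; rewrite /f /f' /= finopVK// gK.
have fK' : cancel f' f by move=> u; rewrite /f /f' /= hK finopK.
have fE i : f @` between (flag S i) = between (flag S i).
  apply/seteqP; split=> [_ [u uX <-]|u uX].
    have [v vX vE] : (finop H @` between (flag S i)) (g u) by rewrite -HE; exists u.
    by rewrite /f /= -vE finopK.
  have [v vX vE] : (g @` between (flag S i)) (finop H u) by rewrite HE; exists u.
  by exists v => //; rewrite /f /= vE finopK.
have fE' i : f' @` between (flag S i) = between (flag S i).
  rewrite -{1}fE; apply/seteqP; split=> [_ [_ [u uX <-] <-]|u uX]; rewrite ?fK//.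
  by exists (f u); [exists u|rewrite fK].
exists N, H, f, f'; split=> //; first by move=> u; rewrite /f /= finopVK.
move=> L Ls gL LS; split.
  by have := good_between fK fK' Ls gL; rewrite LS => /(_ fE).
by have := good_between fK' fK Ls gL; rewrite LS => /(_ fE').
Qed.

Lemma shadow_closed m L : is_subspace L -> lin_closed_set (shadow m L).
Proof. by move=> Ls; exact: shadow_subspace. Qed.

(** Locally g is a finite operator, which preserves goodness at its level. *)
Lemma gr0_act (g : {linear V -> V}) (L : Gr0 F) : GL0 g -> is_gr0 (g @` val L).
Proof.
move=> Gg; have [m gL] := gr0_ex_good L; have Ls := gr0_sub L.
have [N [H [f [f' [mN Hu _ gE fL]]]]] := act_local Gg (shadow_closed m Ls).
have [[gfL _] _] := fL _ Ls gL erefl.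
have fLs := sub_image f Ls.
apply: (good_gr0 (m := N)); first exact: sub_image.
have -> : g @` val L = finop H @` (f @` val L).
  by rewrite image_comp; apply: eq_imagel => u _; rewrite gE.
by apply: good_finop => //; apply: good_mono gfL.
Qed.

Definition gr_map (g : {linear V -> V}) (Gg : GL0 g) (L : Gr0 F) : Gr0 F :=
  exist _ (g @` val L) (mem_set (gr0_act L Gg)).

Lemma gr_actE (g : {linear V -> V}) (Gg : GL0 g) A : gr_act g A = gr_map Gg @` A.
Proof.
apply/seteqP; split=> [M [L AL ML]|_ [L AL <-]]; last by exists L.
by exists L => //; apply: val_inj.
Qed.

Lemma gr_map_inj (g : {linear V -> V}) (Gg : GL0 g) : injective (gr_map Gg).
Proof.
move=> L L' /(congr1 val) /= gLL'; apply: val_inj.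
have [[_ [h [_ gK hK]]] _] := Gg.
have hE (M : set V) : h @` (g @` M) = M.
  apply/seteqP; split=> [_ [_ [u Mu <-] <-]|u Mu]; rewrite ?gK//.
  by exists (g u); [exists u|rewrite gK].
by rewrite -[LHS]hE -[RHS]hE gLL'.
Qed.

Lemma act_cyl1 (g : {linear V -> V}) m (S : {set 'rV[F]_(m + m)}) : GL0 g -> lin_closed_set S ->
  exists N (H : 'M[F]_(N + N)), [/\ (m <= N)%N, H \in unitmx & gr_act g (cyl1 S) = gr_act (finop H) (cyl1 S)].
Proof.
move=> Gg cS; have [N [H [f [f' [mN Hu [fK fK'] gE fL]]]]] := act_local Gg cS.
exists N, H; split=> //; apply/seteqP; split=> M [L [gL LS] ME].
  have [[gfL fLS] _] := fL _ (gr0_sub L) gL LS.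
  exists (exist _ (f @` val L) (mem_set (good_gr0 (sub_image f (gr0_sub L)) gfL))) => //.
  by rewrite ME [RHS]image_comp; apply: eq_imagel => u _; rewrite gE.
have [_ [gfL fLS]] := fL _ (gr0_sub L) gL LS.
exists (exist _ (f' @` val L) (mem_set (good_gr0 (sub_image f' (gr0_sub L)) gfL))) => //.
by rewrite ME [RHS]image_comp; apply: eq_imagel => u _; rewrite /= gE fK'.
Qed.

End Action.

(** * Counting shadows *)

Section Counting.
Variable F : finFieldType.
Implicit Types (u v x : ellsum F) (m n N : nat) (A B : set (Gr0 F)) (L : Gr0 F).
Notation V := (ellsum F).

(** The Grassmannian of N-dimensional subspaces of F^(2N), encoded as sets. *)
Definition finGr N : {set {set 'rV[F]_(N + N)}} :=
  [set S | `[< lin_closed_set S >] && (#|S| == #|F| ^ N)%N]%SET.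

Lemma finGrP N (S : {set 'rV[F]_(N + N)}) :
  S \in finGr N <-> lin_closed_set S /\ #|S| = (#|F| ^ N)%N.
Proof. by rewrite inE; split=> [/andP[/asboolP ? /eqP]//|[? /eqP ->]]; rewrite andbT; apply/asboolP. Qed.

Lemma shadow_finGr N L : good N (val L) -> shadow N (val L) \in finGr N.
Proof. by move=> [_ _ c]; apply/finGrP; split=> //; exact/shadow_closed/gr0_sub. Qed.

Lemma finGr_conj N (S S' : {set 'rV[F]_(N + N)}) : S \in finGr N -> S' \in finGr N ->
  exists2 H : 'M[F]_(N + N), H \in unitmx & S' = [set w *m H | w in S]%SET.
Proof.
move=> /finGrP[[S0 SL] cS] /finGrP[[S0' SL'] cS'].
have cSS' (i : 'I_3) : #|S| = #|S'| by rewrite cS.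
have [H Hu HE] := @set_flag_conj _ _ (fun=> S) (fun=> S') (fun=> S0) (fun=> SL) (fun=> S0') (fun=> SL')
  (fun _ _ _ => subxx S) (fun _ _ _ => subxx S') cSS'.
exists H => //; apply/setP => w; apply/idP/imsetP => [wS'|[w' wS ->]].
  by exists (w *m invmx H); rewrite ?mulmxKV// -(HE ord0) mulmxKV.
by rewrite (HE ord0).
Qed.

Definition gr0_of N (M : set V) (Ms : is_subspace M) (gM : good N M) : Gr0 F :=
  exist _ M (mem_set (good_gr0 Ms gM)).

Lemma finop_cyl1 m (S : {set 'rV[F]_(m + m)}) (H : 'M[F]_(m + m)) (Hu : H \in unitmx) L :
  cyl1 S L -> cyl1 [set w *m H | w in S]%SET (gr_map (finop_GL0 Hu) L).
Proof.
by move=> [gL LS]; split; [exact: good_finop|rewrite -LS; exact: shadow_finop].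
Qed.

(** The subspace l is good at every level; finite operators carry its shadow to any
    other point of the finite Grassmannian. *)
Lemma finGr_ex N (S : {set 'rV[F]_(N + N)}) : S \in finGr N -> exists L, cyl1 S L.
Proof.
move=> SG; pose L0 : Gr0 F := gr0_of (sub_ellset F) (ellset_good0 F).
have gL0 : good N (val L0) by apply: good_mono (ellset_good0 F) => //; exact: sub_ellset.
have [H Hu ->] := finGr_conj (shadow_finGr gL0) SG.
by exists (gr_map (finop_GL0 Hu) L0); apply: finop_cyl1.
Qed.

(** The level-N shadows of the points of A; a level-N cylinder is determined by them. *)
Definition shadows N A : {set {set 'rV[F]_(N + N)}} :=
  [set S | `[< exists2 L, A L & shadow N (val L) = S >]]%SET.

Lemma shadowsP N A (S : {set 'rV[F]_(N + N)}) :
  S \in shadows N A <-> exists2 L, A L & shadow N (val L) = S.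
Proof. by rewrite inE; split=> /asboolP. Qed.

Lemma shadows_mem N A L : A L -> shadow N (val L) \in shadows N A.
Proof. by move=> AL; apply/shadowsP; exists L. Qed.

Lemma cylinderP N A L : cylinder N A -> A L <-> good N (val L) /\ shadow N (val L) \in shadows N A.
Proof.
move=> [AN AL]; split=> [A_L|[gL /shadowsP[L' AL' LL']]]; first by split; [exact: AN|exact: shadows_mem].
by apply: (AL L' L) => //; exact: AN.
Qed.

Lemma shadows_goodset N : shadows N (@goodset F N) = finGr N.
Proof.
apply/setP => S; apply/idP/idP => [/shadowsP[L gL <-]|/finGr_ex[L [gL LS]]]; first exact: shadow_finGr.
by apply/shadowsP; exists L.
Qed.

Lemma shadows_sub N A B : A `<=` B -> shadows N A \subset shadows N B.
Proof.
by move=> AB; apply/fintype.subsetP => S /shadowsP[L /AB BL <-]; exact: shadows_mem.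
Qed.

Lemma shadows_disjoint N A B : cylinder N A -> cylinder N B -> A `&` B = set0 ->
  [disjoint (shadows N A) & (shadows N B)]%B.
Proof.
move=> cA cB AB; rewrite -setI_eq0; apply/eqP/setP => S; rewrite finset.in_set0 finset.inE.
apply/negP => /andP[/shadowsP[L AL LS] SB].
have : (A `&` B) L; last by rewrite AB.
split=> //; apply/(cylinderP _ cB); rewrite LS; split=> //.
by have /(cylinderP _ cA)[] := AL.
Qed.

Lemma shadowsU N A B : shadows N (A `|` B) = (shadows N A :|: shadows N B)%SET.
Proof.
apply/setP => S; rewrite finset.in_setU; apply/idP/orP => [/shadowsP[L [AL|BL] <-]|[]].
- by left; exact: shadows_mem.
- by right; exact: shadows_mem.
- by move=> /shadowsP[L AL <-]; apply: shadows_mem; left.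
- by move=> /shadowsP[L AL <-]; apply: shadows_mem; right.
Qed.

Lemma shadows0 N : shadows N set0 = finset.set0.
Proof. by apply/setP => S; rewrite finset.in_set0; apply/negP => /shadowsP[]. Qed.

Lemma cylinder_cyl1 m (S : {set 'rV[F]_(m + m)}) : cylinder m (cyl1 S).
Proof. by split=> [L []//|L L' gL gL' LL' [_ LS]]; split; rewrite -?LL'. Qed.

(** A finite operator that maps S to S' acts on the shadows of level N and sends
    refinements of S to refinements of S'. *)
Lemma card_shadows_cyl1_le m N (S S' : {set 'rV[F]_(m + m)}) : (m <= N)%N ->
  S \in finGr m -> S' \in finGr m -> (#|shadows N (cyl1 S)| <= #|shadows N (cyl1 S')|)%N.
Proof.
move=> mN SG SG'; have [H Hu SE] := finGr_conj SG SG'.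
have [f finj fE] := shadow_image (fun u => finop_inU H u mN) (fun u => finop_inKP u Hu mN).
have Finj : injective (fun T : {set 'rV[F]_(N + N)} => f @: T) by exact: imset_inj.
rewrite -(card_imset _ Finj); apply: subset_leq_card; apply/fintype.subsetP => _ /imsetP[T /shadowsP[L ZL <-] ->].
by apply/shadowsP; exists (gr_map (finop_GL0 Hu) L); [rewrite SE; exact: finop_cyl1|rewrite /= fE].
Qed.

Lemma card_shadows_cyl1 m N (S S' : {set 'rV[F]_(m + m)}) : (m <= N)%N ->
  S \in finGr m -> S' \in finGr m -> #|shadows N (cyl1 S)| = #|shadows N (cyl1 S')|.
Proof. by move=> mN SG SG'; apply/eqP; rewrite eqn_leq !card_shadows_cyl1_le. Qed.

(** Lower shadows are obtained from higher ones by a map of finite sets. *)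
Lemma shadow_shadow m N (M : set V) : (m <= N)%N -> shadow m M = shadow m (@of_coords F N @` [set w | w \in shadow N M]).
Proof.
move=> mN; apply/setP => w; apply/idP/idP => /shadowP[u [Mu uU] <-].
  have uUN := inU_mono mN uU; have uK := inK_mono mN (ell_decomp uUN).
  have -> : coords m u = coords m (of_coords (coords N u)).
    by apply/eqP; rewrite -subr_eq0 -linearB; apply/eqP; case: uK.
  apply: shadow_mem; first by exists (coords N u) => //; exact: shadow_mem.
  rewrite -[of_coords _](subKr u); apply: (subB (@subU F m)) => //; by case: uK.
have [w0 /shadowP[v [Mv vU] vw] wu] := Mu.
have vK : inK N (v - u) by rewrite -wu -vw; exact: ell_decomp.
have {}vK := inK_mono mN vK.
have -> : coords m u = coords m v.
  by apply/esym/eqP; rewrite -subr_eq0 -linearB; apply/eqP; case: vK.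
by apply: shadow_mem => //; rewrite -[v](subrK u); apply: (subD (@subU F m)) => //; case: vK.
Qed.

Lemma card_shadows_split m N A : (m <= N)%N -> cylinder m A ->
  #|shadows N A| = (\sum_(S in shadows m A) #|shadows N (cyl1 S)|)%N.
Proof.
move=> mN cA.
(* truncation of shadows from level N to level m *)
pose phi (T : {set 'rV[F]_(N + N)}) := shadow m (@of_coords F N @` [set w | w \in T]).
have phiE L : phi (shadow N (val L)) = shadow m (val L) by rewrite /phi -shadow_shadow.
rewrite -sum1_card (partition_big phi (mem (shadows m A))) /=; last first.
  by move=> T /shadowsP[L AL <-]; rewrite phiE; exact: shadows_mem.
apply: eq_bigr => S SA; rewrite sum1dep_card; apply: eq_card => T; rewrite inE.
apply/andP/idP => [[/shadowsP[L AL <-]]|/shadowsP[L [gL LS] <-]].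
  rewrite phiE => /eqP LS; apply: shadows_mem; split=> //.
  by have /(cylinderP _ cA)[] := AL.
rewrite phiE LS; split=> //; apply: shadows_mem; apply/(cylinderP _ cA).
by rewrite LS.
Qed.

(** By transitivity all shadows of level m have the same number of refinements at
    level N. *)
Lemma card_shadows_mono m N A B : (m <= N)%N -> cylinder m A -> cylinder m B ->
  (#|shadows N A| * #|shadows m B| = #|shadows m A| * #|shadows N B|)%N.
Proof.
move=> mN cA cB; have [gr0|/set0Pn[S0 S0G]] := eqVneq (finGr m) finset.set0.
  have E (C : set (Gr0 F)) : cylinder m C -> shadows m C = finset.set0.
    move=> [Cm _]; apply/eqP; rewrite -finset.subset0 -gr0 -shadows_goodset.
    exact: shadows_sub.
  by rewrite (E A cA) (E B cB) !cards0 muln0.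
have E C : cylinder m C -> (#|shadows N C| = #|shadows m C| * #|shadows N (cyl1 S0)|)%N.
  move=> cC; rewrite (card_shadows_split mN cC) -sum_nat_const; apply: eq_bigr => S SC.
  apply: card_shadows_cyl1 => //; rewrite -shadows_goodset; move: SC.
  by have [Cm _] := cC; apply/fintype.subsetP/shadows_sub.
by rewrite (E A cA) (E B cB) -mulnA; congr (_ * _)%N; rewrite mulnC.
Qed.

Definition cell_num (z : nat + nat) : nat := match z with inl i => i | inr j => j end.
(** The cell is the chart of the empty sets up to the names of the indices. *)
Definition cell_reindex (T : Fprod F (nat * nat)) :
    Fprod F (rows fset0 fset0 * cols fset0 fset0) :=
  fun xy => T (cell_num (val xy.1), cell_num (val xy.2)).

Definition cell_row (i : nat) : rows fset0 fset0 := exist (in_row fset0 fset0) (inl i) isT.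
Definition cell_col (j : nat) : cols fset0 fset0 :=
  exist (fun z => ~~ in_row fset0 fset0 z) (inr j) isT.

Lemma cell_rowK (x : rows fset0 fset0) : cell_row (cell_num (val x)) = x.
Proof. by apply: val_inj; case: x => -[]. Qed.
Lemma cell_colK (y : cols fset0 fset0) : cell_col (cell_num (val y)) = y.
Proof. by apply: val_inj; case: y => -[]. Qed.

Definition cell_unindex (T : Fprod F (rows fset0 fset0 * cols fset0 fset0)) : Fprod F (nat * nat) :=
  fun ij => T (cell_row ij.1, cell_col ij.2).

Lemma cell_reindexK : cancel cell_reindex cell_unindex.
Proof. by move=> T; apply/funext => -[i j]. Qed.
Lemma cell_unindexK : cancel cell_unindex cell_reindex.
Proof. by move=> T; apply/funext => -[x y]; rewrite /cell_reindex /cell_unindex /= cell_rowK cell_colK. Qed.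

Lemma opgraph_chart T : opgraph T = chart_graph (cell_reindex T).
Proof.
have E u y : rsum (cell_reindex T) u y = \sum_(i \in [set: nat]) u.1 i * T (i, cell_num (val y)).
  rewrite rsum_graph//; apply: eq_fsbigr => i _; congr (_ * _).
  by rewrite -[inl i]/(val (cell_row i)) valK.
apply/seteqP; split=> u => [/graphP uT|/chart_graphP uT].
  apply/chart_graphP => y; rewrite E -uT.
  by case: y => -[].
by apply/graphP => j; have := uT (cell_col j); rewrite E.
Qed.

(** Graphs of operators are the complements of l^diamond, which is K_0 and U_0. *)
Lemma main_cellE : @main_cell F = @goodset F 0.
Proof.
apply/seteqP; split=> [_ [T _ <-]|L gL]; first exact: opgraph_good0.
have [Om [Xi [OX [T [[bO bX] LT]]]]] := good_chart (gr0_sub L) gL.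
have e (A : {fset nat}) : (forall i, i \in A -> (i < 0)%N) -> A = fset0.
  by move=> A0; apply/fsetP => i; rewrite in_fset0; apply/negP => /A0.
have eO := e _ bO; have eX := e _ bX; subst Om Xi.
exists (cell_unindex T) => //; apply: val_inj.
by rewrite /= opgraph_chart cell_unindexK LT.
Qed.

(** On the cell, the shadow of level N is the N x N corner of the matrix. *)
Lemma shadow_opgraph N : exists2 f : 'M[F]_N -> {set 'rV[F]_(N + N)}, injective f &
  forall T, shadow N (opgraph T) = f (\matrix_(i, j) T (nat_of_ord i, nat_of_ord j)).
Proof.
have b0 : bounded N fset0 fset0 by split.
pose ext (t : 'M[F]_N) : Fprod F (nat * nat) := fun ij =>
  if (insub ij.1, insub ij.2) is (Some i, Some j) then t i j else 0.
exists (fun t => shadow N (opgraph (ext t))) => [t t'|T].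
  rewrite !opgraph_chart => /(shadow_chart_agree b0) tt'.
  apply/matrixP => i j; have := tt' (cell_row i, cell_col j).
  rewrite /cell_reindex /ext /= !valK; apply; apply/kcoordP => /=; exact: ltn_ord.
rewrite !opgraph_chart; apply: (shadow_chart b0) => -[x y] /kcoordP + /kcoordP.
rewrite /= -[x]cell_rowK -[y]cell_colK /cell_reindex /ext /= => xN yN.
by rewrite !insubT /= mxE.
Qed.

Lemma corner_surj N (t : 'M[F]_N) : exists T : Fprod F (nat * nat),
  \matrix_(i, j) T (nat_of_ord i, nat_of_ord j) = t.
Proof.
exists (fun ij => if (insub ij.1, insub ij.2) is (Some i, Some j) then t i j else 0).
by apply/matrixP => i j; rewrite mxE /= !valK.
Qed.

Lemma card_shadows_cell N : #|shadows N (@main_cell F)| = (#|F| ^ (N * N))%N.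
Proof.
have [f finj fE] := shadow_opgraph N.
rewrite -(card_mx F N N) -cardsT -(card_imset _ finj); apply: eq_card => S.
apply/idP/imsetP => [/shadowsP[_ [T _ <-] <-]|[t _ ->]].
  by rewrite /= fE; exists (\matrix_(i, j) T (nat_of_ord i, nat_of_ord j)); rewrite ?finset.in_setT.
have [T <-] := corner_surj t; rewrite -fE.
by apply/shadowsP; exists (cell_chart T) => //; exists T.
Qed.

(** Comparison with the cell, whose shadows are counted by [card_shadows_cell],
    gives the number of refinements without computing it. *)
Lemma card_shadows_lift m N A : (m <= N)%N -> cylinder m A ->
  (#|shadows N A| * #|F| ^ (m * m) = #|shadows m A| * #|F| ^ (N * N))%N.
Proof.
move=> mN cA; rewrite -!card_shadows_cell; apply: card_shadows_mono => //.
by rewrite main_cellE; apply: (cylinder_mono (leq0n m)); exact: cylinder_good.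
Qed.

End Counting.

(** * The measure *)

Section Compactness.
Variable F : finFieldType.
Implicit Types (A B : set (Gr0 F)) (L : Gr0 F).

(** The matrix space is compact and cylinders are both open and closed in it. *)
Lemma compact_chart Om Xi (OX : #|` Om| = #|` Xi|) N A : bounded N Om Xi -> cylinder N A ->
  compact (chart (F := F) OX @^-1` A).
Proof.
move=> bd cA; apply: (subclosed_compact _ (@compact_fprod F _)) => //.
rewrite -[X in closed X]setCK closedC preimage_setC.
have -> : chart OX @^-1` (~` A) = chart OX @^-1` (@goodset F N `\` A).
  apply/seteqP; split=> T; last by case.
  by move=> nA; split=> //; exact: chart_good.
by apply: open_chart; apply: cylinderD cA; exact: cylinder_good.
Qed.

(** The points with shadow S lie in a single chart, where compactness applies. *)
Lemma cyl1_finite_cover N (S : {set 'rV[F]_(N + N)}) (C : nat -> set (Gr0 F)) :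
  S \in finGr F N -> (forall k, is_cylinder (C k)) -> cyl1 S `<=` \bigcup_k C k ->
  exists K, forall L, cyl1 S L -> exists2 k, (k < K)%N & C k L.
Proof.
move=> SG cC SC; have [L0 [gL0 L0S]] := finGr_ex SG.
have [Om [Xi [OX [T0 [bd LT0]]]]] := good_chart (gr0_sub L0) gL0.
have := @compact_chart _ _ OX _ _ bd (cylinder_cyl1 S); rewrite compact_cover.
move=> /(_ nat setT (fun k => chart OX @^-1` C k)) [].
- by move=> k _; have [n cn] := cC k; exact: open_chart cn.
- by move=> T /SC [k _ CT]; exists k.
move=> D _ DC; exists (\max_(k <- D) k).+1 => L [gL LS].
have e : shadow N (val L) = shadow N (chart_graph T0) by rewrite LS -LT0 L0S.
have [T LT _] := shadow_chart_inj bd (gr0_sub L) gL e.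
have LE : L = chart OX T by exact: val_inj.
have [k kD kT] : (\bigcup_(k in [set` D]) chart OX @^-1` C k) T.
  by apply: DC; rewrite /preimage /= -LE.
exists k; last by rewrite LE.
by rewrite ltnS; apply: (@leq_bigmax_seq _ _ xpredT id).
Qed.

Lemma cylinder_finite_cover N A (C : nat -> set (Gr0 F)) :
  cylinder N A -> (forall k, is_cylinder (C k)) -> A `<=` \bigcup_k C k ->
  exists K, forall L, A L -> exists2 k, (k < K)%N & C k L.
Proof.
move=> cA cC AC.
have /choice[f fP] : forall S : {set 'rV[F]_(N + N)}, exists K, S \in shadows N A ->
    forall L, cyl1 S L -> exists2 k, (k < K)%N & C k L.
  move=> S; have [SA|SA] := boolP (S \in shadows N A); last by exists 0%N.
  have SG : S \in finGr F N.
    by rewrite -shadows_goodset; move: SA; apply/fintype.subsetP/shadows_sub; case: cA.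
  have [|K KP] := cyl1_finite_cover SG cC; last by exists K.
  move=> L [gL LS]; apply: AC; apply/(cylinderP _ cA); by rewrite LS.
exists (\max_S f S)%N => L AL.
have LA := shadows_mem N AL; have gL := (cylinderP L cA).1 AL.
have [|k kf CL] := fP _ LA L; first by split=> //; case: gL.
by exists k => //; apply: leq_trans kf _; exact: leq_bigmax.
Qed.

End Compactness.

Section Premeasure.
Variables (R : realType) (F : finFieldType).
Implicit Types (A B : set (Gr0 F)) (L : Gr0 F).
Let q : R := #|F|%:R.

Lemma q_gt0 : 0 < q.
Proof. by rewrite ltr0n (ltn_trans _ (card_field_gt1 F)). Qed.

Definition density N A : R := #|shadows N A|%:R / q ^+ (N * N).

Lemma density_mono m N A : (m <= N)%N -> cylinder m A -> density N A = density m A.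
Proof.
move=> mN cA; have qn e : q ^+ e != 0 by rewrite expf_neq0// gt_eqF// q_gt0.
apply/eqP; rewrite /density eqr_div// -!natrX -!natrM eqr_nat; apply/eqP.
exact: card_shadows_lift.
Qed.

(** The level is immaterial by [density_mono]; any level at which A is a cylinder may be
    chosen. *)
Definition premeasure A : \bar R := (density (xget 0%N [set N | cylinder N A]) A)%:E.

Lemma premeasureE N A : cylinder N A -> premeasure A = (density N A)%:E.
Proof.
move=> cA; rewrite /premeasure; set n := xget _ _.
have cn : cylinder n A by exact: (@xgetPex _ 0%N [set N | cylinder N A] (ex_intro _ N cA)).
by congr EFin; rewrite -(density_mono (leq_maxl n N) cn) (density_mono (leq_maxr n N) cA).
Qed.

Lemma premeasure_ge0 A : (0 <= premeasure A)%E.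
Proof. by rewrite /premeasure lee_fin divr_ge0// exprn_ge0// ltW// q_gt0. Qed.

Lemma premeasure0 : premeasure set0 = 0%E.
Proof. by rewrite (premeasureE (cylinder0 F 0)) /density shadows0 cards0 mul0r. Qed.

Lemma premeasureU A B : is_cylinder A -> is_cylinder B -> A `&` B = set0 ->
  premeasure (A `|` B) = (premeasure A + premeasure B)%E.
Proof.
move=> [m cA] [n cB] AB; have {}cA := cylinder_mono (leq_addr n m) cA.
have {}cB := cylinder_mono (leq_addl m n) cB.
rewrite (premeasureE (cylinderU cA cB)) (premeasureE cA) (premeasureE cB) -EFinD.
congr EFin; rewrite /density -mulrDl -natrD shadowsU cardsU; congr (_%:R / _).
by have := shadows_disjoint cA cB AB; rewrite -finset.setI_eq0 => /eqP ->; rewrite cards0 subn0.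
Qed.

(** A copy of the Grassmannian to carry the ring of cylinders, as the type itself
    carries its Borel sets. *)
Definition cyl_space : Type := Gr0 F.
HB.instance Definition _ := Pointed.on cyl_space.

Lemma is_cylinder0 : is_cylinder (set0 : set cyl_space).
Proof. by exists 0%N; exact: cylinder0. Qed.
Lemma is_cylinderU : setU_closed (@is_cylinder F : set (set cyl_space)).
Proof.
move=> A B [m cA] [n cB]; exists (m + n)%N; apply: cylinderU.
  exact: cylinder_mono (leq_addr _ _) cA.
exact: cylinder_mono (leq_addl _ _) cB.
Qed.
Lemma is_cylinderD : setD_closed (@is_cylinder F : set (set cyl_space)).
Proof.
move=> A B [m cA] [n cB]; exists (m + n)%N; apply: cylinderD.
  exact: cylinder_mono (leq_addr _ _) cA.
exact: cylinder_mono (leq_addl _ _) cB.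
Qed.

HB.instance Definition _ := isRingOfSets.Build default_measure_display cyl_space
  is_cylinder0 is_cylinderU is_cylinderD.

Definition cyl_premeasure : set cyl_space -> \bar R := premeasure.

(** By compactness only finitely many of the disjoint cylinders are nonempty. *)
Lemma premeasure_sigma_additive : semi_sigma_additive cyl_premeasure.
Proof.
move=> C cC tC [N cU].
have {}cC k : is_cylinder (C k) by exact: cC.
have [K KP] := cylinder_finite_cover cU cC (@subset_refl _ _).
pose U n : set (Gr0 F) := [set L | exists2 k, (k < n)%N & C k L].
have US n : U n.+1 = U n `|` C n.
  apply/seteqP; split=> [L [k]|L [[k kn CL]|CL]].
  - by rewrite ltnS leq_eqVlt => /orP[/eqP -> CL|kn CL]; [right|left; exists k].
  - by exists k => //; exact: ltnW.
  - by exists n.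
have cUn n : is_cylinder (U n).
  elim: n => [|n IH]; last by rewrite US; exact: is_cylinderU.
  by rewrite (_ : U _ = set0); [exact: is_cylinder0|apply/seteqP; split=> // L []].
have sumU n : (\sum_(0 <= i < n) premeasure (C i) = premeasure (U n))%E.
  elim: n => [|n IH].
    by rewrite big_geq// (_ : U _ = set0) ?premeasure0//; apply/seteqP; split=> // L [].
  rewrite big_nat_recr//= IH US premeasureU//.
  apply/seteqP; split=> // L [[k kn CkL] CnL].
  have /trivIsetP/(_ k n I I) := tC; rewrite neq_ltn kn => /(_ isT) kn0.
  by have : (C k `&` C n) L by []; rewrite kn0.
apply: cvg_near_cst; exists K => // n /= Kn; rewrite [LHS]sumU; rewrite /cyl_premeasure; congr premeasure.
apply/seteqP; split=> [L [k _ CL]|L UL]; first by exists k.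
by have [k kK CL] := KP L UL; exists k => //; exact: leq_trans kK Kn.
Qed.

HB.instance Definition _ := isMeasure.Build default_measure_display cyl_space R
  cyl_premeasure premeasure0 premeasure_ge0 premeasure_sigma_additive.

(** The Caratheodory extension of the premeasure. *)
Definition gr_measure : set (Gr0 F) -> \bar R :=
  measure_extension cyl_premeasure.

Lemma gr_measure_cylinder N A : cylinder N A -> gr_measure A = (density N A)%:E.
Proof.
move=> cA; rewrite /gr_measure /measure_extension measurable_mu_extE; last by exists N.
exact: premeasureE.
Qed.

Lemma gr_measure0 : gr_measure set0 = 0%E. Proof. exact: measure0. Qed.
Lemma gr_measure_ge0 A : (0 <= gr_measure A)%E. Proof. exact: measure_ge0. Qed.
Lemma gr_measure_sigma_additive : semi_sigma_additive gr_measure.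
Proof.
move=> C mC tC mU; apply: (@measure_semi_sigma_additive _ _ _
  (measure_extension cyl_premeasure)) => //.
  by move=> i; have := mC i; rewrite gr_borelE.
by have := mU; rewrite gr_borelE.
Qed.
HB.instance Definition _ := isMeasure.Build default_measure_display (Gr0 F) R
  gr_measure gr_measure0 gr_measure_ge0 gr_measure_sigma_additive.

End Premeasure.

(** * Counting subspaces *)

Section SubspaceCount.
Variable F : finFieldType.
Let q := #|F|.

(** Bases are built one vector at a time. *)
Lemma row_free_col_mx n k (u : 'rV[F]_n) (A : 'M[F]_(k, n)) :
  row_free (col_mx u A) = row_free A && ~~ (u <= A)%MS.
Proof.
have [uA|uA] := boolP (u <= A)%MS; rewrite ?andbT ?andbF.
  apply/negP; rewrite /row_free -addsmxE (addsmx_idPr uA) => /eqP h.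
  by have := rank_leq_row A; rewrite h add1n ltnn.
rewrite /row_free -addsmxE; have u0 : u != 0 by apply: contraNneq uA => ->; exact: sub0mx.
have -> : \rank (u + A)%MS = (1 + \rank A)%N.
  have := mxrank_sum_cap u A; have -> : (u :&: A = 0)%MS.
    apply/eqP; rewrite -mxrank_eq0 -leqn0 -ltnS.
    have r1 : \rank u = 1%N by rewrite rank_rV u0.
    rewrite -[in ltnRHS]r1; apply: (leq_trans (rank_ltmx _) (leqnn _)).
    rewrite ltmxE capmxSl /= sub_capmx submx_refl /=; exact: uA.
  by rewrite mxrank0 addn0 => ->; rewrite rank_rV u0.
by rewrite eqn_add2l.
Qed.

(** Each new row is chosen outside the span of the previous ones. *)
Lemma card_row_free k n :
  #|[set A : 'M[F]_(k, n) | row_free A]%SET| = (\prod_(i < k) (q ^ n - q ^ i))%N.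
Proof.
elim: k => [|k IH].
  rewrite big_ord0; apply/eqP/cards1P; exists 0; apply/setP => A.
  by rewrite !inE flatmx0 eqxx /row_free -leqn0 rank_leq_row.
rewrite big_ord_recr /= -IH.
pose f (uA : 'M[F]_(k, n) * 'rV[F]_n) : 'M[F]_(1 + k, n) := col_mx uA.2 uA.1.
have finj : injective f by move=> [A u] [A' u'] /eq_col_mx[/= -> ->].
pose X := [set uA : 'M[F]_(k, n) * 'rV[F]_n | row_free uA.1 && ~~ (uA.2 <= uA.1)%MS]%SET.
have -> : [set A : 'M[F]_(k.+1, n) | row_free A]%SET = f @: X.
  apply/setP => A; rewrite inE; apply/idP/imsetP => [|[[B u]]]; last first.
    by rewrite inE /= => uB ->; rewrite /f row_free_col_mx.
  rewrite -[A](@vsubmxK _ 1 k) => /[dup]; rewrite {1}row_free_col_mx => Af _.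
  by exists (@dsubmx _ 1 k n A, @usubmx _ 1 k n A); rewrite ?inE.
rewrite card_imset// -sum1_card.
rewrite (partition_big fst (fun A => row_free A)) /=; last by move=> [A u]; rewrite inE => /andP[].
rewrite -sum_nat_const; apply: eq_big => [A|A Af]; first by rewrite inE.
have -> : (q ^ n - q ^ k)%N = #|[set u : 'rV[F]_n | ~~ (u <= A)%MS]%SET|.
  have := cardsC [set u : 'rV[F]_n | (u <= A)%MS]%SET.
  rewrite card_rowspace card_mx mul1n; have := Af; rewrite /row_free => /eqP -> <-.
  by rewrite addKn; apply: eq_card => u; rewrite !inE.
rewrite -sum1_card (reindex (fun u : 'rV[F]_n => (A, u))) /=; last first.
  exists snd => [u|[B u]] //=; rewrite inE => /andP[_ /eqP /= ->]; by [].
by apply: eq_bigl => u; rewrite !inE /= Af eqxx andbT.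
Qed.

(** An n-dimensional subspace has as many bases as there are invertible matrices of
    size n. *)
Lemma card_finGr n :
  (#|finGr F n| * \prod_(i < n) (q ^ n - q ^ i) = \prod_(i < n) (q ^ (n + n) - q ^ i))%N.
Proof.
rewrite -!card_row_free -[RHS]sum1_card.
pose rs (A : 'M[F]_(n, n + n)) := [set w : 'rV[F]_(n + n) | (w <= A)%MS]%SET.
rewrite (partition_big rs (mem (finGr F n))) /=; last first.
  move=> A; rewrite inE => Af; apply/finGrP; split; last first.
    by rewrite card_rowspace; move/eqP: Af => ->.
  split=> [|a w w']; rewrite !inE ?sub0mx// => wA w'A.
  by rewrite addmx_sub ?scalemx_sub.
rewrite -sum_nat_const; apply: eq_bigr => S /finGrP[[S0 SL] cS].
have [A [Af AE]] := row_free_of_set S0 SL cS.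
have Minj : injective (fun B : 'M[F]_n => B *m A) by move=> B B'; exact: row_free_inj.
rewrite sum1dep_card -(card_imset _ Minj).
apply: eq_card => C; rewrite [RHS]inE; apply/imsetP/idP => [[B]|].
  rewrite inE => Bf ->; rewrite inE /row_free mxrankMfree// -/(row_free B) Bf /=.
  by apply/eqP/setP => w; rewrite inE AE eqmxMfull.
rewrite inE => /andP[Cf /eqP SC].
have CA : (C <= A)%MS.
  by apply/row_subP => i; rewrite -AE -SC inE row_sub.
have /submxP[B CB] := CA; exists B => //; rewrite inE.
by move: Cf; rewrite CB /row_free mxrankMfree.
Qed.

End SubspaceCount.

Section Limit.
Variables (R : realType) (F : finFieldType).
Let q : R := #|F|%:R.
Let a (e : nat) : R := 1 - q ^- e.

Lemma q_ge2 : 2 <= q. Proof. by rewrite ler_nat card_field_gt1. Qed.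

Lemma qV_gt0 e : 0 < q ^- e.
Proof. by rewrite invr_gt0 exprn_gt0// (lt_le_trans _ q_ge2). Qed.

Lemma qV_half e : q ^- e.+1 + q ^- e.+1 <= q ^- e.
Proof.
have q0 : 0 < q by rewrite (lt_le_trans _ q_ge2).
have -> : q ^- e = q * q ^- e.+1 by rewrite exprS invfM mulVKf// gt_eqF.
rewrite -mulr2n -mulr_natl ler_wpM2r ?q_ge2//; exact/ltW/qV_gt0.
Qed.

(** The factors are in [0, 1]. The term q^-(n+k) makes the induction work: it is at
    least twice the next one because q >= 2. *)
Lemma prod_le1 n k : \prod_(1 <= j < k.+1) a (n + j) <= 1 /\
  1 - q ^- n + q ^- (n + k) <= \prod_(1 <= j < k.+1) a (n + j).
Proof.
elim: k => [|k [IH1 IH2]]; first by rewrite big_geq// addn0 subrK.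
rewrite big_nat_recr//=; set p := \prod_(_ <= _ < _) _ in IH1 IH2 *.
have := qV_gt0 (n + k.+1); have := qV_half (n + k); rewrite addnS.
rewrite /a; set x := q ^- (n + k).+1; set y := q ^- (n + k) in IH2 *.
set z := q ^- n in IH2 *; move=> h1 h2.
have x1 : x <= 1.
  rewrite /x invf_le1 ?exprn_gt0 ?exprn_ege1//; have := q_ge2; lra.
have p0 : 0 <= p.
  rewrite /p; apply: prodr_ge0 => j _; rewrite subr_ge0 invf_le1 ?exprn_gt0 ?exprn_ege1//;
  have := q_ge2; lra.
split; nra.
Qed.

Lemma prod_q_sub N n : (n <= N)%N ->
  (\prod_(i < n) (#|F| ^ N - #|F| ^ i))%N%:R =
  q ^+ (N * n) * \prod_(1 <= j < n.+1) a (N - n + j).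
Proof.
move=> nN; have q0 : q != 0 by have := q_ge2; apply: contraTneq => ->; rewrite -ltNge ltr0n.
rewrite natr_prod exprM -[X in _ ^+ X]card_ord -prodr_const big_add1 /= big_nat_rev /= add0n.
rewrite -(big_mkord xpredT (fun i => (#|F| ^ N - #|F| ^ i)%N%:R)).
rewrite -(big_mkord xpredT (fun=> q ^+ N)) -big_split /= big_nat_cond [RHS]big_nat_cond.
apply: eq_bigr => i; rewrite andbT => /andP[_ iN].
have iN' := leq_trans (ltnW iN) nN.
rewrite natrB ?leq_exp2l ?card_field_gt1// !natrX /a mulrBr mulr1; congr (_ - _).
have -> : (N - n + (n - i.+1).+1 = N - i)%N by rewrite subnSK// addnBA ?subnK// ltnW.
have -> : q ^+ N = q ^+ i * q ^+ (N - i) by rewrite -exprD subnKC.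
by rewrite mulfK// expf_neq0.
Qed.

Definition partial_prod (n : nat) : R := \prod_(1 <= j < n.+1) (1 - q ^- j)^-1.

(** The number of n-dimensional subspaces of F^(2n), relative to q^(n^2). *)
Lemma density_good n : density R n (@goodset F n) =
  \prod_(1 <= j < n.+1) a (n + j) * partial_prod n.
Proof.
have q0 : q != 0 by have := q_ge2; apply: contraTneq => ->; rewrite -ltNge ltr0n.
have := congr1 (fun k : nat => k%:R : R) (card_finGr F n).
rewrite natrM !prod_q_sub ?leq_addr// subnn addnK /density shadows_goodset => e.
have -> : partial_prod n = (\prod_(1 <= j < n.+1) a (0 + j))^-1.
  by rewrite /partial_prod prodfV; congr (_ ^-1); apply: eq_bigr => j _.
have p0 : \prod_(1 <= j < n.+1) a (0 + j) != 0.
  rewrite prodf_seq_neq0; apply/allP => -[|j]; rewrite mem_index_iota //= => _.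
  rewrite /a add0n subr_eq0 eq_sym invr_eq1; apply/negP => /eqP qj.
  have : 1 < q ^+ j.+1 by rewrite exprn_egt1//; have := q_ge2; lra.
  by rewrite qj ltxx.
have Q0 : q ^+ (n * n) != 0 by rewrite expf_neq0.
move: e; rewrite mulnDl exprD; set X := \prod_(_ <= _ < _) a (n + _).
move: p0 Q0; set P := \prod_(_ <= _ < _) _; set Q := q ^+ _; set x := #|_|%:R => p0 Q0 e.
have -> : x = Q * Q * X / (Q * P) by rewrite -e mulfK// mulf_neq0.
by field; rewrite p0 Q0.
Qed.

Lemma prod_gt0 n k : (0 < n)%N -> 0 < \prod_(1 <= j < k.+1) a (n + j).
Proof.
move=> n0; apply: lt_le_trans (prod_le1 n k).2; rewrite ltr_wpDl ?qV_gt0//.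
rewrite subr_ge0 invf_le1 ?exprn_gt0 ?exprn_ege1//; have := q_ge2; lra.
Qed.

Lemma partial_prod_le n : partial_prod n <= 4.
Proof.
case: n => [|n]; first by rewrite /partial_prod big_geq//; lra.
rewrite /partial_prod prodfV big_ltn// big_add1 /=.
rewrite (eq_bigr (fun j => a (1 + j))) => [|j _]; last by rewrite add1n.
(* the first factor and the product of the others are both at least 1 - 1/q >= 1/2 *)
have p0 := prod_gt0 n (ltn0Sn 0); have [_] := prod_le1 1 n; have := qV_gt0 (1 + n).
set p := \prod_(_ <= _ < _) _ in p0 *; rewrite expr1 => h1 h2.
have h3 : q^-1 <= 2^-1 by rewrite lef_pV2 ?q_ge2// posrE; have := q_ge2; lra.
have h4 : 4^-1 <= (1 - q^-1) * p by nra.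
rewrite -[leRHS]invrK lef_pV2// posrE; last by lra.
by apply: lt_le_trans h4; lra.
Qed.

(** The densities and the partial products differ by factors in [1 - q^-n, 1]. *)
Lemma density_good_cvg (t : R) : (fun n => density R n (@goodset F n)) @ \oo --> t ->
  partial_prod @ \oo --> t.
Proof.
move=> dt; pose d n := \prod_(1 <= j < n.+1) a (n + j).
have d1 : d @ \oo --> (1 : R).
  apply: (@squeeze_cvgr _ _ _ _ (fun n => 1 - q ^- n) (fun=> 1)).
  - apply: nearW => n; have [h1 h2] := prod_le1 n n; rewrite /d h1 andbT.
    by apply: le_trans h2; rewrite lerDl ltW// qV_gt0.
  - rewrite -[X in _ --> X]subr0; apply: cvgB; first exact: cvg_cst.
    under eq_fun do rewrite -exprVn. apply: cvg_expr.
    rewrite ger0_norm ?invr_ge0 ?invf_lt1; have := q_ge2; lra.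
  - exact: cvg_cst.
have -> : partial_prod = (fun n => density R n (@goodset F n) * (d n)^-1).
  apply/funext => n; rewrite density_good mulrAC divff ?mul1r//.
  rewrite /d; case: n => [|n]; first by rewrite big_geq// oner_neq0.
  by rewrite gt_eqF// prod_gt0.
have -> : t = t * 1^-1 by rewrite invr1 mulr1.
by apply: cvgM => //; apply: cvgV => //; rewrite oner_neq0.
Qed.

End Limit.

(** * Invariance *)

Section ImageMeasure.
Context d1 d2 (T1 : measurableType d1) (T2 : measurableType d2) (R : realType).
Variables (f : T1 -> T2) (finj : injective f).
Hypothesis mf : forall A, measurable A -> measurable (f @` A).
Variable mu : {measure set T2 -> \bar R}.

(** The two conditions on f are arguments so that the measure structure below can be
    found from the term. *)
Definition image_measure of injective f & (forall A, measurable A -> measurable (f @` A)) :=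
  fun A : set T1 => mu (f @` A).
Local Notation nu := (image_measure finj mf).

Let nu0 : nu set0 = 0%E. Proof. by rewrite /image_measure image_set0 measure0. Qed.
Let nu_ge0 A : (0 <= nu A)%E. Proof. exact: measure_ge0. Qed.
Let nu_sigma_additive : semi_sigma_additive nu.
Proof.
move=> C mC tC mU; rewrite /image_measure image_bigcup.
apply: measure_semi_sigma_additive; first by move=> i; exact: mf.
- move=> i j _ _ [_ [[x Cx <-] [y Cy /finj yx]]]; apply: tC => //.
  by exists x; split=> //; rewrite -yx.
- by rewrite -image_bigcup; exact: mf.
Qed.
HB.instance Definition _ := isMeasure.Build d1 T1 R nu nu0 nu_ge0 nu_sigma_additive.

End ImageMeasure.

(** Direct images under an injection commute with countable unions and with
    relative complements. *)
Lemma measurable_image_gen d1 d2 (T1 : measurableType d1) (T2 : measurableType d2)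
    (f : T1 -> T2) (G : set (set T1)) :
  injective f -> measurable = <<s G>> -> measurable (f @` setT) ->
  (forall A, G A -> measurable (f @` A)) -> forall A, measurable A -> measurable (f @` A).
Proof.
move=> finj mG mT mf; rewrite mG.
apply: (@smallest_sub _ _ _ [set A | measurable (f @` A)]) => //; split.
- by rewrite /= image_set0; exact: measurable0.
- move=> A /= mA; rewrite setTD (_ : _ @` _ = f @` setT `\` f @` A).
    exact: measurableD.
  apply/seteqP; split=> [_ [x nAx <-]|_ [[x _ <-] nAx]].
    by split; [exists x|move=> [y Ay /finj e]; apply: nAx; rewrite -e].
  by exists x => // Ax; apply: nAx; exists x.
- by move=> A /= mA; rewrite image_bigcup; exact: bigcupT_measurable.
Qed.

Section Cylinders.
Variables (R : realType) (F : finFieldType).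
Implicit Types (A B : set (Gr0 F)) (L : Gr0 F).

(** The cylinder with a given list of shadows; lists allow inductions that add one
    shadow at a time. *)
Definition shadow_in N (s : seq {set 'rV[F]_(N + N)}) : set (Gr0 F) :=
  [set L | good N (val L) /\ shadow N (val L) \in s].

Lemma cylinder_shadow_in N s : cylinder N (@shadow_in N s).
Proof. by split=> [L []//|L L' gL gL' LL' [_ Ls]]; split; rewrite -?LL'. Qed.

Lemma shadow_in_cons N S s : @shadow_in N (S :: s) = cyl1 S `|` shadow_in s.
Proof.
apply/seteqP; split=> L.
  by move=> [gL]; rewrite inE => /orP[/eqP|]; [left|right].
by move=> [[gL LS]|[gL Ls]]; split=> //; rewrite inE ?LS ?eqxx ?Ls ?orbT.
Qed.

Lemma shadow_in0 N : @shadow_in N [::] = set0.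
Proof. by apply/seteqP; split=> // L []. Qed.

Lemma cylinder_shadow_inE N A : cylinder N A -> A = shadow_in (enum (shadows N A)).
Proof.
move=> cA; apply/seteqP; split=> L; rewrite /shadow_in /= mem_enum.
  by move=> /(cylinderP _ cA).
by move=> gL; apply/(cylinderP _ cA).
Qed.

Lemma measure_shadow_in N (mu : {measure set (Gr0 F) -> \bar R}) s : uniq s ->
  mu (@shadow_in N s) = (\sum_(S <- s) mu (cyl1 S))%E.
Proof.
elim: s => [|S s IH] /=; first by rewrite shadow_in0 measure0 big_nil.
move=> /andP[Ss us]; rewrite big_cons -IH// shadow_in_cons measureU//.
- by apply: measurable_cylinder; exists N; exact: cylinder_cyl1.
- by apply: measurable_cylinder; exists N; exact: cylinder_shadow_in.
- by apply/seteqP; split=> // L [[_ LS] [_]]; rewrite LS (negPf Ss).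
Qed.

Lemma measure_cylinder N (mu : {measure set (Gr0 F) -> \bar R}) A : cylinder N A ->
  mu A = (\sum_(S <- enum (shadows N A)) mu (cyl1 S))%E.
Proof. by move=> cA; rewrite {1}(cylinder_shadow_inE cA) measure_shadow_in// enum_uniq. Qed.

(** Cylinders form a pi-system that generates the Borel sets and contains the
    exhaustion by the good sets. *)
Lemma measure_eq_cylinders (mu nu : {measure set (Gr0 F) -> \bar R}) :
  (forall N, (mu (@goodset F N) < +oo)%E) ->
  (forall N A, cylinder N A -> mu A = nu A) ->
  forall A, measurable A -> mu A = nu A.
Proof.
move=> muoo munu A mA.
apply: (measure_unique (@is_cylinder F) (@goodset F)) => //.
- exact: gr_borelE.
- move=> B C [m cB] [n cC]; exists (m + n)%N; apply: cylinderI.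
    exact: cylinder_mono (leq_addr _ _) cB.
  exact: cylinder_mono (leq_addl _ _) cC.
- by move=> N; exists N; exact: cylinder_good.
- exact: bigcup_goodset.
- by move=> B [N cB]; exact: munu cB.
Qed.

Lemma gr_act_cyl1 N (S : {set 'rV[F]_(N + N)}) (H : 'M[F]_(N + N)) : H \in unitmx ->
  gr_act (@finop F N H) (cyl1 S) = cyl1 [set w *m H | w in S]%SET.
Proof.
move=> Hu; rewrite (gr_actE (finop_GL0 Hu)); apply/seteqP; split=> [_ [L ZL <-]|M [gM MS]].
  exact: finop_cyl1.
have Hu' : invmx H \in unitmx by rewrite unitmx_inv.
exists (gr_map (finop_GL0 Hu') M); last first.
  apply: val_inj => /=; apply/seteqP; split=> [_ [_ [u Mu <-] <-]|u Mu]; rewrite ?finopVK//.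
  by exists (finop (invmx H) u); [exists u|rewrite finopVK].
have -> : S = [set w *m invmx H | w in [set w *m H | w in S]]%SET.
  by rewrite -imset_comp -[LHS]imset_id; apply: eq_imset => w /=; rewrite mulmxK.
exact: finop_cyl1.
Qed.

Lemma cylinder_act N A (H : 'M[F]_(N + N)) : H \in unitmx -> cylinder N A ->
  cylinder N (gr_act (@finop F N H) A) /\
  #|shadows N (gr_act (@finop F N H) A)| = #|shadows N A|.
Proof.
move=> Hu cA; pose mulS (S : {set 'rV[F]_(N + N)}) := [set w *m H | w in S]%SET.
have Finj : injective mulS.
  by apply: imset_inj; exact: (can_inj (mulmxK Hu)).
have actE : gr_act (finop H) A = shadow_in (map mulS (enum (shadows N A))).
  rewrite {1}(cylinder_shadow_inE cA); elim: (enum _) => [|S s IH].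
    by rewrite /= !shadow_in0 (gr_actE (finop_GL0 Hu)) image_set0.
  by rewrite /= !shadow_in_cons (gr_actE (finop_GL0 Hu)) image_setU -!gr_actE IH gr_act_cyl1.
have cB : cylinder N (gr_act (finop H) A) by rewrite actE; exact: cylinder_shadow_in.
split=> //; rewrite -[RHS](card_imset _ Finj); apply: eq_card => S.
rewrite (gr_actE (finop_GL0 Hu)).
apply/idP/imsetP => [/shadowsP[_ [L AL <-] <-]|[_ /shadowsP[L AL <-] ->]].
  by exists (shadow N (val L)); [exact: shadows_mem|exact: shadow_finop].
by apply/shadowsP; exists (gr_map (finop_GL0 Hu) L); [exists L|exact: shadow_finop].
Qed.

End Cylinders.

Section Invariance.
Variables (R : realType) (F : finFieldType).
Implicit Types (A B : set (Gr0 F)) (L : Gr0 F).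
Let mu : {measure set (Gr0 F) -> \bar R} := @gr_measure R F.

Let muE N A : cylinder N A -> mu A = (density R N A)%:E.
Proof. exact: gr_measure_cylinder. Qed.

Section Operator.
Variables (g : {linear ellsum F -> ellsum F}) (Gg : GL0 g).

(** Piece by piece g acts on a cylinder as a finite operator, so that the image is a
    finite union of cylinders. *)
Lemma gr_map_cylinder m A : cylinder m A -> measurable (gr_map Gg @` A).
Proof.
move=> cA; rewrite (cylinder_shadow_inE cA).
have : {subset enum (shadows m A) <= finGr F m}.
  move=> S; rewrite mem_enum -shadows_goodset; apply/fintype.subsetP/shadows_sub.
  by case: cA.
elim: (enum _) => [|S s IH] sG; first by rewrite shadow_in0 image_set0; exact: measurable0.
rewrite shadow_in_cons image_setU; apply: measurableU; last first.
  by apply: IH => T Ts; apply: sG; rewrite inE Ts orbT.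
have /finGrP[cS _] : S \in finGr F m by apply: sG; rewrite inE eqxx.
have [N [H [mN Hu E]]] := act_cyl1 Gg cS.
rewrite -gr_actE E; apply: measurable_cylinder; exists N.
by have [] := cylinder_act Hu (cylinder_mono mN (cylinder_cyl1 S)).
Qed.

Lemma measurable_gr_map A : measurable A -> measurable (gr_map Gg @` A).
Proof.
apply: (measurable_image_gen (G := @is_cylinder F)).
- exact: gr_map_inj.
- exact: gr_borelE.
- rewrite -bigcup_goodset image_bigcup; apply: bigcupT_measurable => n.
  exact: gr_map_cylinder (cylinder_good F n).
- by move=> B [N cB]; exact: gr_map_cylinder cB.
Qed.

(** Both sides are measures in A and agree on the pieces of cylinders, where g acts as a
    finite operator and preserves the number of shadows. *)
Lemma gr_measure_act A : measurable A -> mu (gr_act g A) = mu A.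
Proof.
move=> mA; rewrite (gr_actE Gg); apply/esym.
apply: (@measure_eq_cylinders R F mu (image_measure mu (@gr_map_inj _ _ Gg) measurable_gr_map)) => //.
  by move=> N; rewrite (muE (cylinder_good F N)) ltry.
move=> N B cB; rewrite !(measure_cylinder _ cB); apply: eq_big_seq => S.
rewrite mem_enum => SB.
have /finGrP[cS _] : S \in finGr F N.
  rewrite -shadows_goodset; move: SB; apply/fintype.subsetP/shadows_sub; by case: cB.
have [n [H [Nn Hu E]]] := act_cyl1 Gg cS.
have cZ := cylinder_mono Nn (cylinder_cyl1 S).
have [cHZ cardZ] := cylinder_act Hu cZ.
transitivity (mu (gr_act (finop H) (cyl1 S))); first by rewrite (muE cHZ) (muE cZ) /density cardZ.
by rewrite -E (gr_actE Gg).
Qed.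

End Operator.

Lemma gr_measure_invariant : GL0_invariant mu.
Proof. by move=> g Gg A mA; exact: gr_measure_act. Qed.

Lemma goodset_cvg (nu : {measure set (Gr0 F) -> \bar R}) :
  (fun n => nu (@goodset F n)) @ \oo --> nu [set: Gr0 F].
Proof.
rewrite -bigcup_goodset; apply: nondecreasing_cvg_mu.
- by move=> n; apply: measurable_cylinder; exists n; exact: cylinder_good.
- by apply: bigcupT_measurable => n; apply: measurable_cylinder; exists n; exact: cylinder_good.
- by move=> m n mn; apply/subsetPset; exact: goodset_mono.
Qed.

Lemma gr_measure_le4 : (mu [set: Gr0 F] <= 4%:E)%E.
Proof.
rewrite -(cvg_lim _ (@goodset_cvg mu))//; apply: lime_le.
  by apply/cvg_ex; exists (mu setT); exact: goodset_cvg.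
apply: nearW => n; rewrite (muE (cylinder_good F n)) lee_fin density_good.
have p0 : 0 <= partial_prod R F n.
  have -> : partial_prod R F n = (\prod_(1 <= j < n.+1) (1 - (#|F|%:R : R) ^- j))^-1.
    by rewrite /partial_prod prodfV.
  rewrite invr_ge0; case: n => [|n]; first by rewrite big_geq.
  by apply: prodr_ge0 => j _; rewrite subr_ge0 invf_le1 ?exprn_gt0 ?exprn_ege1//;
    have := q_ge2 R F; lra.
by apply: le_trans (partial_prod_le R F n); rewrite ler_piMl//; have [] := prod_le1 R F n n.
Qed.

End Invariance.

Section Finite.
Variables (R : realType) (F : finFieldType).

Lemma gr_measure_fin : fin_num_fun (@gr_measure R F).
Proof.
apply: lty_fin_num_fun; apply: le_lt_trans (gr_measure_le4 R F) _; exact: ltry.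
Qed.
HB.instance Definition _ := Measure_isFinite.Build default_measure_display (Gr0 F) R
  (@gr_measure R F) gr_measure_fin.

Lemma main_cell_measure1 : @gr_measure R F (@main_cell F) = 1%E.
Proof.
rewrite main_cellE (gr_measure_cylinder R (cylinder_good F 0)) /density.
rewrite -main_cellE card_shadows_cell mul0n expr0 expn0 divr1.
by [].
Qed.

End Finite.

(** * Invariant measures are determined on the cell *)

Section Uniqueness.
Variables (R : realType) (F : finFieldType) (mu : {measure set (Gr0 F) -> \bar R}).
Hypothesis mu_inv : GL0_invariant mu.
Hypothesis mu_fin : fin_num_fun mu.

Let mcell N A : cylinder N A -> measurable (A : set (Gr0 F)).
Proof. by move=> cA; apply: measurable_cylinder; exists N. Qed.

(** Finite operators are transitive on the shadows of a given level. *)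
Lemma invariant_cyl1 N (S S' : {set 'rV[F]_(N + N)}) : S \in finGr F N -> S' \in finGr F N ->
  mu (cyl1 S) = mu (cyl1 S').
Proof.
move=> SG SG'; have [H Hu ->] := finGr_conj SG SG'.
by rewrite -gr_act_cyl1// mu_inv//; [exact: finop_GL0|exact: mcell (cylinder_cyl1 S)].
Qed.

Lemma invariant_sum N A (S0 : {set 'rV[F]_(N + N)}) : S0 \in finGr F N -> cylinder N A ->
  mu A = (#|shadows N A|%:R * fine (mu (cyl1 S0)))%:E.
Proof.
move=> S0G cA; rewrite (measure_cylinder mu cA).
have E S : S \in enum (shadows N A) -> mu (cyl1 S) = (fine (mu (cyl1 S0)))%:E.
  rewrite mem_enum => SA; rewrite (@invariant_cyl1 N S S0)//.
    by rewrite fineK// mu_fin//; exact: mcell (cylinder_cyl1 S0).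
  by rewrite -shadows_goodset; move: SA; apply/fintype.subsetP/shadows_sub; case: cA.
rewrite (eq_big_seq _ E) sumEFin big_const_seq count_predT -cardE iter_addr_0.
by rewrite mulr_natl.
Qed.

(** All shadows of level N have the same mass, and q^(N^2) of them make up the cell. *)
Lemma invariant_density N A : cylinder N A ->
  mu A = ((density R N A)%:E * mu (@main_cell F))%E.
Proof.
move=> cA; have [S0 S0G] : exists S0, S0 \in finGr F N.
  exists (shadow N (@ellset F)); apply/finGrP; split; first exact: shadow_closed (sub_ellset F).
  by have [] : good N (@ellset F) by apply: good_mono (ellset_good0 F) => //; exact: sub_ellset.
have cM : cylinder N (@main_cell F).
  by rewrite main_cellE; apply: (cylinder_mono (leq0n N)); exact: cylinder_good.
have q0 : (#|F|%:R : R) ^+ (N * N) != 0 by rewrite expf_neq0// gt_eqF// q_gt0.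
rewrite (invariant_sum S0G cA) (invariant_sum S0G cM) -EFinM; congr EFin.
by rewrite card_shadows_cell natrX /density mulrA divfK.
Qed.

(** Otherwise all good sets would have measure 0, and they exhaust the Grassmannian. *)
Lemma invariant_main_cell_gt0 : mu [set: Gr0 F] != 0%E -> (0 < mu (@main_cell F))%E.
Proof.
move=> mu0; rewrite lt0e measure_ge0 andbT; apply: contraNneq mu0 => m0.
apply/eqP; rewrite -(cvg_lim _ (@goodset_cvg R F mu))//.
rewrite (_ : (fun n => _) = cst 0%E) ?lim_cst//.
by apply/funext => n; rewrite (invariant_density (cylinder_good F n)) m0 mule0.
Qed.

End Uniqueness.

(** * The measure on the cell *)

Section Cell.
Variable F : finFieldType.

(** By [open_ev] applied to finite sets of coordinates that exhaust I. *)
Lemma open_finite_coords (I : countType) (B : set (Fprod F I)) T : open B -> B T ->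
  exists s : seq I, forall T', (forall k, k \in s -> T' k = T k) -> B T'.
Proof.
move=> oB BT; apply: contrapT => no.
pose s n : seq I := pmap choice.unpickle (iota 0 n).
have sP (k : I) n : (choice.pickle k < n)%N -> k \in s n.
  move=> kn; rewrite mem_pmap; apply/mapP; exists (choice.pickle k); rewrite ?choice.pickleK//.
  by rewrite mem_iota.
have /choice[T_ T_P] : forall n, exists T', (forall k, k \in s n -> T' k = T k) /\ ~ B T'.
  move=> n; apply: contrapT => nT; apply: no; exists (s n) => T' T'T.
  by apply: contrapT => nB; apply: nT; exists T'.
have [|n Bn] := @open_ev F I B T T_ oB BT; last by have [] := T_P n.
by move=> k; exists (choice.pickle k).+1 => n kn; apply: (T_P n).1; exact: sP.
Qed.

Lemma open_cell_unindex (B : set (Fprod F (nat * nat))) : open B -> open (@cell_unindex F @^-1` B).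
Proof.
move=> oB; rewrite openE => T BT.
have [s sB] := open_finite_coords oB BT.
apply: filterS (nbhs_coords [seq (cell_row ij.1, cell_col ij.2) | ij <- s] T) => T' T'T.
apply: sB => k ks; apply: T'T; apply/mapP.
by exists k.
Qed.

Lemma measurable_cell_unindex (B : set (Fprod F (nat * nat))) :
  measurable B -> measurable (@cell_unindex F @^-1` B).
Proof.
move: B; apply: (@smallest_sub _ _ _ [set B | measurable (@cell_unindex F @^-1` B)]); first split.
- by rewrite /= preimage_set0; exact: measurable0.
- by move=> B /= mB; rewrite setTD -preimage_setC; exact: measurableC.
- by move=> B /= mB; rewrite preimage_bigcup; exact: bigcupT_measurable.
by move=> B oB /=; apply: sub_sigma_algebra; exact: open_cell_unindex.
Qed.

Lemma cell_chartE (B : set (Fprod F (nat * nat))) :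
  @cell_chart F @` B = chart (erefl #|` fset0 : {fset nat}|) @` (@cell_unindex F @^-1` B).
Proof.
apply/seteqP; split=> [_ [T BT <-]|_ [T BT <-]].
  exists (cell_reindex T); first by rewrite /preimage/= cell_reindexK.
  by apply: val_inj; rewrite /= opgraph_chart.
exists (cell_unindex T) => //; apply: val_inj.
by rewrite /= opgraph_chart cell_unindexK.
Qed.

Lemma measurable_cell (B : set (Fprod F (nat * nat))) :
  measurable B -> measurable (@cell_chart F @` B).
Proof.
by move=> mB; rewrite cell_chartE gr_borelE; apply: sigma_chart; exact: measurable_cell_unindex.
Qed.

Lemma cell_chart_inj : injective (@cell_chart F).
Proof.
move=> T T' /(congr1 val) /=; rewrite !opgraph_chart => TT'.
apply: (can_inj (@cell_reindexK F)).
by apply: (@chart_inj F _ _ (erefl #|` fset0 : {fset nat}|)); apply: val_inj.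
Qed.

End Cell.

Section Boxes.
Variables (R : realType) (F : finFieldType).
Variables (A : {fset nat * nat}) (B : nat * nat -> {set F}).

Definition box : set (Fprod F (nat * nat)) := [set T | forall k, k \in A -> (T k : F) \in B k].

Lemma cylinder_box N : (forall k, k \in A -> (k.1 < N)%N /\ (k.2 < N)%N) ->
  cylinder N (@cell_chart F @` box).
Proof.
move=> AN; rewrite cell_chartE; apply: cylinder_chart; first by split.
move=> T T' TT' TB k kA; have [k1 k2] := AN _ kA.
by have := TB _ kA; rewrite /cell_unindex TT'//; apply/kcoordP.
Qed.

Let pos N (k : 'I_N * 'I_N) : nat * nat := (nat_of_ord k.1, nat_of_ord k.2).

(** The shadows are the N x N corners that satisfy the conditions on the entries in A. *)
Lemma card_shadows_box N : (forall k, k \in A -> (k.1 < N)%N /\ (k.2 < N)%N) ->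
  #|shadows N (@cell_chart F @` box)| =
  (\prod_(k : 'I_N * 'I_N) #|if pos k \in A then B (pos k) else [set: F]%SET|)%N.
Proof.
move=> AN; pose C (k : 'I_N * 'I_N) : {set F} := if pos k \in A then B (pos k) else [set: F]%SET.
have [f finj fE] := shadow_opgraph F N.
pose mx (t : {ffun 'I_N * 'I_N -> F}) : 'M[F]_N := \matrix_(i, j) t (i, j).
have mxinj : injective mx.
  by move=> t t' /matrixP tt'; apply/ffunP => -[i j]; have := tt' i j; rewrite !mxE.
have fmxinj : injective (f \o mx) by exact: inj_comp.
transitivity #|(family C : {pred {ffun 'I_N * 'I_N -> F}})|.
  rewrite -(card_imset _ fmxinj); apply: eq_card => S.
  apply/idP/imsetP => [/shadowsP[_ [T TB <-] <-]|[t tC ->]].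
    exists [ffun k => T (pos k) : F].
      apply/familyP => k; rewrite ffunE /C; case: ifP => [kA|_]; last by rewrite finset.in_setT.
      exact: TB.
    rewrite /= fE; congr f; apply/matrixP => i j; by rewrite !mxE ffunE.
  have [T TE] := corner_surj (mx t); apply/shadowsP; exists (cell_chart T); last by rewrite /= fE TE.
  exists T => // -[i j] kA; have [/= iN jN] := AN _ kA.
  have := congr1 (fun M : 'M[F]_N => M (Ordinal iN) (Ordinal jN)) TE; rewrite !mxE /= => ->.
  by have /familyP/(_ (Ordinal iN, Ordinal jN)) := tC; rewrite /C /pos /= kA.
by rewrite card_family foldrE big_map big_enum.
Qed.

Lemma density_box N : (forall k, k \in A -> (k.1 < N)%N /\ (k.2 < N)%N) ->
  density R N (@cell_chart F @` box) = \prod_(k <- A) (#|B k|%:R / #|F|%:R).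
Proof.
move=> AN; have q0 : (#|F|%:R : R) != 0 by rewrite gt_eqF// q_gt0.
rewrite /density card_shadows_box// natr_prod.
have -> : (#|F|%:R : R) ^+ (N * N) = \prod_(k : 'I_N * 'I_N) #|F|%:R.
  by rewrite prodr_const card_prod !card_ord.
(* the entries outside A contribute a factor 1 *)
rewrite -prodf_div (eq_bigr (fun k => if pos k \in A then #|B (pos k)|%:R / #|F|%:R else 1)); last first.
  by move=> k _; case: ifP => _ //; rewrite cardsT divff.
rewrite -big_mkcond /=.
have AE : perm_eq A [seq pos k | k <- enum {: 'I_N * 'I_N} & pos k \in A].
  apply: uniq_perm; first exact: fset_uniq.
    rewrite map_inj_uniq; first by rewrite filter_uniq//; exact: enum_uniq.
    by move=> [i j] [i' j'] [ii' jj']; congr (_, _); apply: val_inj.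
  move=> [i j]; apply/idP/mapP => [kA|[k]]; last by rewrite mem_filter => /andP[kA _] ->.
  have [/= iN jN] := AN _ kA; exists (Ordinal iN, Ordinal jN) => //.
  by rewrite mem_filter mem_enum andbT.
by rewrite (perm_big _ AE) /= big_map big_filter big_enum_cond.
Qed.

Lemma ex_box_bound : exists N, forall k, k \in A -> (k.1 < N)%N /\ (k.2 < N)%N.
Proof.
exists (\max_(k <- A) (k.1 + k.2).+1) => k kA.
have h : (k.1 + k.2 < \max_(k <- A) (k.1 + k.2).+1)%N.
  exact: (@leq_bigmax_seq _ _ xpredT (fun k => (k.1 + k.2).+1)).
by split; apply: leq_ltn_trans h; rewrite ?leq_addr ?leq_addl.
Qed.

End Boxes.

Section CellProbability.
Variables (R : realType) (F : finFieldType) (mu : {measure set (Gr0 F) -> \bar R}).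
Hypothesis mu_inv : GL0_invariant mu.
Hypothesis mu_fin : fin_num_fun mu.
Hypothesis mu0 : mu [set: Gr0 F] != 0%E.

(** P is the restriction of mu to the cell, normalized. A box is a cylinder, and its
    density is a product because the entries of a corner are independent. *)
Lemma cell_probability : exists (c : R) (P : probability (Fprod F (nat * nat)) R),
  [/\ 0 < c, is_uniform_product P &
    forall B : set (Fprod F (nat * nat)), measurable B ->
      mu (@cell_chart F @` B) = (c%:E * P B)%E].
Proof.
have m0 := invariant_main_cell_gt0 mu_inv mu_fin mu0.
have mM : measurable (@main_cell F) by exact: measurable_cell measurableT.
have mfin := mu_fin mM.
pose nu : {measure set (Fprod F (nat * nat)) -> \bar R} :=
  image_measure mu (@cell_chart_inj F) (@measurable_cell F).
have nuE B : nu B = mu (@cell_chart F @` B) by [].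
pose P : probability (Fprod F (nat * nat)) R := mnormalize nu (\d_(0 : Fprod F (nat * nat))).
have c0 : 0 < fine (mu (@main_cell F)) by rewrite fine_gt0// m0 ltey_eq mfin.
have PE B : P B = (mu (@cell_chart F @` B) * (fine (mu (@main_cell F)))^-1%:E)%E.
  rewrite /P /= /mnormalize -[nu setT]/(mu (@main_cell F)) gt_eqF//=.
  by move: mfin; case: (mu (@main_cell F)).
exists (fine (mu (@main_cell F))), P; split=> // [A B|B mB]; last first.
  rewrite PE muleCA -EFinM divff ?mule1// gt_eqF//.
have [N AN] := ex_box_bound A.
rewrite PE (invariant_density mu_inv mu_fin (cylinder_box B AN)) density_box//.
by rewrite -[in X in (_ * X * _)%E](fineK mfin) -muleA -EFinM divff ?mulr1 ?gt_eqF.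
Qed.

End CellProbability.

(** * The theorem *)

Theorem theorem1p1 (R : realType) (F : finFieldType) :
  [/\ (exists mu : {finite_measure set (Gr0 F) -> \bar R},
        mu [set: Gr0 F] != 0%E /\ GL0_invariant mu),
      (forall mu nu : {finite_measure set (Gr0 F) -> \bar R},
        mu [set: Gr0 F] != 0%E -> GL0_invariant mu ->
        nu [set: Gr0 F] != 0%E -> GL0_invariant nu ->
        exists2 c : R, 0 < c &
          forall A : set (Gr0 F), measurable A -> nu A = (c%:E * mu A)%E),
      (forall mu : {finite_measure set (Gr0 F) -> \bar R},
        mu [set: Gr0 F] != 0%E -> GL0_invariant mu ->
        exists (c : R) (P : probability (Fprod F (nat * nat)) R),
          [/\ 0 < c, is_uniform_product P &
            forall B : set (Fprod F (nat * nat)), measurable B ->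
              mu (@cell_chart F @` B) = (c%:E * P B)%E]) &
      (forall mu : {finite_measure set (Gr0 F) -> \bar R},
        mu [set: Gr0 F] != 0%E -> GL0_invariant mu ->
        mu (@main_cell F) = 1%E ->
        (fun n : nat =>
          (\prod_(1 <= j < n.+1) (1 - (#|F|%:R : R) ^- j)^-1)%:E) @ \oo
          --> mu [set: Gr0 F])].
Proof.
have fin (mu : {finite_measure set (Gr0 F) -> \bar R}) : fin_num_fun mu by exact: fin_num_measure.
have mM : measurable (@main_cell F) by exact: measurable_cell measurableT.
split.
- exists (@gr_measure R F); split; last exact: gr_measure_invariant.
  apply/negP => /eqP m0; have : (@gr_measure R F (@main_cell F) <= @gr_measure R F setT)%E.
    by apply: le_measure => //; rewrite inE.
  by rewrite main_cell_measure1 m0 lee_fin ler10.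
- move=> mu nu mu0 muI nu0 nuI.
  have m0 := invariant_main_cell_gt0 muI (fin mu) mu0.
  have n0 := invariant_main_cell_gt0 nuI (fin nu) nu0.
  pose c := fine (nu (@main_cell F)) / fine (mu (@main_cell F)).
  have m0' : 0 < fine (mu (@main_cell F)) by rewrite fine_gt0// m0 ltey_eq fin.
  have c0 : 0 < c by rewrite divr_gt0// fine_gt0// n0 ltey_eq fin.
  exists c => // A mA.
  apply: (@measure_eq_cylinders R F nu (mscale (NngNum (ltW c0)) mu)) => //.
    by move=> N; rewrite ltey_eq fin//; apply: measurable_cylinder; exists N; exact: cylinder_good.
  move=> N B cB; rewrite /= /mscale /= (invariant_density nuI (fin nu) cB).
  rewrite (invariant_density muI (fin mu) cB) muleCA; congr (_ * _)%E.
  rewrite -[X in (_ * X)%E]fineK ?fin// -[LHS]fineK ?fin// -EFinM /c divfK//.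
  by rewrite gt_eqF.
- by move=> mu mu0 muI; exact: cell_probability (fin mu) mu0.
- move=> mu mu0 muI m1.
  have muT : mu [set: Gr0 F] = (fine (mu [set: Gr0 F]))%:E by rewrite fineK ?fin.
  rewrite muT; apply: cvg_EFin; first exact: nearW.
  apply: density_good_cvg.
  have gcvg : (fun n => mu (@goodset F n)) @ \oo --> (fine (mu [set: Gr0 F]))%:E.
    by rewrite -muT; exact: goodset_cvg.
  have dE : (fun n => density R n (@goodset F n)) = fine \o (fun n => mu (@goodset F n)).
    apply/funext => n.
    have e : mu (@goodset F n) = ((density R n (@goodset F n))%:E * mu (@main_cell F))%E.
      exact: invariant_density (fin mu) n _ (cylinder_good F n).
    by rewrite /= e m1 mule1.
  by rewrite dE; exact: fine_cvg.
Qed.
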